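(* Fix $p\in[2,\infty)$, and let $\{k_n\}_{n\in\mathbb N}$ be an increasing sequence of positive integers with $k_n\le n$ such that $\lim_{n\to\infty}k_n=\infty$ and $\lim_{n\to\infty}k_n/n=0$. For each $n\in\mathbb N$, let $Y^{(n)}$ be uniformly distributed on $\mathbb B_p^n=\{x\in\mathbb R^n:\sum_{i=1}^n|x_i|^p\le n\}$. Then for $\sigma$-a.e. (deterministic) sequence $a=\{a^{(n)}\}_{n\in\mathbb N}\in\mathbb V$, the sequence $$\left\{\left\|n^{-1/2}(a^{(n)})^{\mathsf T}Y^{(n)}\right\|_\infty\right\}_{n\in\mathbb N}$$ satisfies a large deviation principle in $\mathbb R$ with speed $n$ and good rate function $\mathcal I_{\max}$ given by $$\mathcal I_{\max}(r)=\mathcal I_p\big((r,0,0,\dots),r\big)\quad\text{for } r\ge0,\qquad \mathcal I_{\max}(r)=+\infty\quad\text{for } r<0.$$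
   Context: Notation: $\mathbb R_+=[0,\infty)$. ''Increasing'' means $k_{n+1}\ge k_n$ for all $n$. For $k\le n$, $\mathbb V_{n,k}=\{A\in\mathbb R^{n\times k}:A^{\mathsf T}A=I_k\}$ is the Stiefel manifold; $\sigma_n$ is the Haar (invariant) probability measure on $\mathbb V_{n,k_n}$; $\mathbb V=\prod_n\mathbb V_{n,k_n}$; and $\sigma$ is any probability measure on $\mathbb V$ whose $n$-th marginal is $\sigma_n$ for every $n$. $\|x\|_\infty=\max_i|x_i|$. Rate function: let $Z_p$ be a real random variable with density $f_p(x)=\frac{1}{2p^{1/p}\Gamma(1+1/p)}\exp(-|x|^p/p)$, and let $\overline\Lambda_p(t_1,t_2)=\log\mathbb E[\exp(t_1Z_p+t_2|Z_p|^p)]\in\mathbb R\cup\{\infty\}$. Let $g_0,g_1,g_2,\dots$ be i.i.d. standard Gaussians, $g=(g_1,g_2,\dots)$. For $(u,b,c)\in\ell^2\times\mathbb R\times\mathbb R$ set $\Lambda_p(u,b,c)=\mathbb E[\overline\Lambda_p(\langle u,g\rangle+bg_0,c)]$ and $$\Lambda_p^*(w,t,s)=\sup_{(u,b,c)\in\ell^2\times\mathbb R\times\mathbb R}\{\langle u,w\rangle+bt+cs-\Lambda_p(u,b,c)\}.$$ For $w\in\ell^2$ with $\|w\|_2\le r$ and $s\ge0$, set $I_p(w,r,s)=\Lambda_p^*(w,\sqrt{r^2-\|w\|_2^2},s)$ and $$\mathcal I_p(w,r)=\inf_{s>0}I_p\left(\frac{w}{\rho(s)},\frac{r}{\rho(s)},s\right),\qquad\rho(s)=s^{-1/p}.$$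 Large deviation principle (LDP): random variables $Z^{(n)}$ in a topological space $\mathcal T$ satisfy an LDP with speed $s_n$ and rate function $J:\mathcal T\to[0,\infty]$ if for every Borel set $B$, $-\inf_{B^\circ}J\le\liminf_n\frac1{s_n}\log\mathbb P(Z^{(n)}\in B)\le\limsup_n\frac1{s_n}\log\mathbb P(Z^{(n)}\in B)\le-\inf_{\overline B}J$. The rate function $J$ is good if all sets $\{J\le\alpha\}$, $\alpha\in[0,\infty)$, are compact. *)

(* Defs.v *)
From mathcomp Require Import all_boot all_order all_algebra.
From mathcomp Require Import finmap.
From mathcomp Require Import all_classical all_reals all_analysis.

Set Implicit Arguments.
Unset Strict Implicit.
Unset Printing Implicit Defensive.

Import Order.TTheory GRing.Theory Num.Theory.
Import numFieldNormedType.Exports.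

Local Open Scope classical_set_scope.
Local Open Scope ring_scope.

Definition borel (T : ptopologicalType) := g_sigma_algebraType (@open T).

(** Large deviation principles *)

Definition LDP (R : realType) (T : topologicalType)
    (d : nat -> measure_display) (W : forall n, measurableType (d n))
    (P : forall n, probability (W n) R) (Z : forall n, W n -> T)
    (speed : nat -> R) (J : T -> \bar R) : Prop :=
  (forall x, 0 <= J x)%E /\
  forall B : set T, <<s @open T >> B ->
    [/\ (- ereal_inf (J @` (interior B))
           <= limn_einf (fun n => (speed n)^-1%:E * lne (P n (Z n @^-1` B))))%E,
        (limn_einf (fun n => (speed n)^-1%:E * lne (P n (Z n @^-1` B)))
           <= limn_esup (fun n => (speed n)^-1%:E * lne (P n (Z n @^-1` B))))%E
      & (limn_esup (fun n => (speed n)^-1%:E * lne (P n (Z n @^-1` B)))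
           <= - ereal_inf (J @` (closure B)))%E].

Definition good_rate_function (R : realType) (T : topologicalType)
    (J : T -> \bar R) : Prop :=
  forall alpha : R, 0 <= alpha -> compact [set x | (J x <= alpha%:E)%E].

(** The Stiefel manifold and its invariant probability measure *)

Definition stiefel (R : realType) (n k : nat) : set 'M[R]_(n, k) :=
  [set A | A^T *m A = 1%:M].

(* The orthogonal group O(n) acts transitively on the compact set
   [stiefel R n k], so these two conditions determine [mu]. *)
Definition is_stiefel_haar (R : realType) (n k : nat)
    (mu : probability (borel 'M[R]_(n, k)) R) : Prop :=
  mu (@stiefel R n k) = 1%E /\
  forall U : 'M[R]_n, U^T *m U = 1%:M ->
  forall B : set (borel 'M[R]_(n, k)), measurable B ->
    mu [set A | B (U *m A)] = mu B.

(* The index [n : nat] stands for the dimension [n.+1], so that [a n] is the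
   matrix called a^(n+1) in the mathematical text. *)
Definition frames (R : realType) (k : nat -> nat) :=
  forall n : nat, borel 'M[R]_(n.+1, k n.+1).

Definition cylinders (R : realType) (k : nat -> nat) : set (set (frames R k)) :=
  [set C | exists n, exists2 B : set (borel 'M[R]_(n.+1, k n.+1)),
     measurable B & C = [set a : frames R k | B (a n)]].

Definition frame_space (R : realType) (k : nat -> nat) :=
  g_sigma_algebraType (@cylinders R k).

Definition stiefel_seq (R : realType) (k : nat -> nat) : set (frame_space R k) :=
  [set a | forall n, stiefel (a n)].

(** The uniform distribution on the l^p ball *)

(* Lebesgue measure on R^n, as the n-fold product of the one-dimensional
   Lebesgue measure; compare [product_measure1]. *)
Fixpoint volume (R : realType) (n : nat) : set 'cV[R]_n -> \bar R :=
  match n with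
  | 0 => fun A => (\1_A 0)%:E
  | m.+1 => fun A => (\int[@lebesgue_measure R]_x
      volume [set v : 'cV[R]_m | A (col_mx (const_mx x : 'cV[R]_1) v)])%E
  end.

Definition lp_ball (R : realType) (p : R) (n : nat) : set 'cV[R]_n :=
  [set x | \sum_(i < n) `|x i 0| `^ p <= n%:R].

Definition uniform_on (R : realType) (n : nat) (K : set 'cV[R]_n)
    (d : measure_display) (W : measurableType d) (P : probability W R)
    (Y : {RV P >-> borel 'cV[R]_n}) : Prop :=
  forall B : set (borel 'cV[R]_n), measurable B ->
    distribution P Y B = (volume (B `&` K) / volume K)%E.

(** The rate function *)

Definition Gamma (R : realType) (z : R) : R :=
  \int[@lebesgue_measure R]_(x in `]0, +oo[) (x `^ (z - 1) * expR (- x)).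

Definition density (R : realType) (p z : R) : R :=
  (2 * p `^ p^-1 * Gamma (1 + p^-1))^-1 * expR (- (`|z| `^ p / p)).

Definition Lambda_bar (R : realType) (p t1 t2 : R) : \bar R :=
  lne (\int[@lebesgue_measure R]_z
         (expR (t1 * z + t2 * `|z| `^ p) * density p z)%:E)%E.

Definition ell2 (R : realType) : set (nat -> R) :=
  [set u : nat -> R | cvgn (series (fun i => u i ^+ 2))].

(* Also used for <u, g> with u in l^2 and g a Gaussian sequence: the series
   then converges almost surely although g is almost surely not in l^2. *)
Definition inner (R : realType) (u w : nat -> R) : R :=
  limn (series (fun i => u i * w i)).

Definition ell2_norm (R : realType) (w : nat -> R) : R := Num.sqrt (inner w w).

Definition iid_standard_gaussian (R : realType) (d : measure_display)
    (O : measurableType d) (Q : probability O R) (g : nat -> {RV Q >-> R}) :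
    Prop :=
  (forall (i : nat) (B : set R), measurable B ->
     distribution Q (g i) B = normal_prob 0 1 B) /\
  (forall (F : {fset nat}) (B : nat -> set R), (forall i, measurable (B i)) ->
     Q (\bigcap_(i in [set` F]) (g i @^-1` B i))
     = (\prod_(i <- F) Q (g i @^-1` B i))%E).

Section rate.
Variables (R : realType) (d : measure_display) (O : measurableType d).
Variables (Q : probability O R) (g : nat -> {RV Q >-> R}) (p : R).

(* Coordinates of [u] start at 0: [u i] is paired with [g i.+1], and [g 0] is
   the separate Gaussian multiplied by [b]. *)
Definition Lambda (u : nat -> R) (b c : R) : \bar R :=
  (\int[Q]_x Lambda_bar p (inner u (fun i => g i.+1 x) + b * g 0%N x) c)%E.

Definition Lambda_star (w : nat -> R) (t s : R) : \bar R :=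
  ereal_sup [set y | exists u : nat -> R, exists b c : R, ell2 u /\
    y = ((inner u w + b * t + c * s)%:E - Lambda u b c)%E].

Definition rate_I (w : nat -> R) (r s : R) : \bar R :=
  Lambda_star w (Num.sqrt (r ^+ 2 - ell2_norm w ^+ 2)) s.

Definition rho (s : R) : R := s `^ (- p^-1).

Definition rate_cal_I (w : nat -> R) (r : R) : \bar R :=
  ereal_inf [set rate_I (fun i => w i / rho s) (r / rho s) s |
             s in [set s : R | 0 < s]].

Definition rate_max (r : R) : \bar R :=
  if 0 <= r then rate_cal_I (fun i => if i == 0%N then r else 0) r else +oo%E.

End rate.

(* Main.v *)
From HB Require Import structures.
Require Import Defs.
From mathcomp Require Import all_boot all_order all_algebra.
From mathcomp Require Import finmap.
From mathcomp Require Import all_classical all_reals all_analysis.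
From mathcomp Require Import measurable_realfun ring lra.

Set Implicit Arguments.
Unset Strict Implicit.
Unset Printing Implicit Defensive.

Import Order.TTheory GRing.Theory Num.Theory.
Import numFieldNormedType.Exports.

Local Open Scope classical_set_scope.
Local Open Scope ring_scope.

(** Up to the scaling [s], the law of the projection of [Y] on a unit vector [a]
    depends on [a] only through the averages over [i] of [psi (v sqrt n a_i)], where
    [psi] is the logarithm of the Laplace transform of [exp (- |x|^p)]. When these
    averages converge to [phi v = E (psi (v g_0))], tilting Lebesgue measure by
    [exp (v s sum_i sqrt n a_i x_i - s^p sum_i |x_i|^p)] gives matching exponential
    bounds for the volumes of slices of the ball, hence for one projection, with rate
    the supremum over [v] and [s] of [v s r - s^p + ln s - phi v] plus a constant.
    The maximum over [k_n <= n] columns only costs a factor [n].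

    The convergence holds almost surely, uniformly over the columns: comparing
    a column of a Haar frame with a normalized Gaussian vector in the same small
    spherical cap bounds the probability of a bad column by that of a bad Gaussian
    vector, which is exponentially small by Chernoff's inequality.

    Finally the variational formula of the paper reduces to the supremum above:
    [psi] being even and convex, the components of [u] other than the first only
    increase [Lambda], and the infimum over [s] is absorbed by scaling. *)

(** * Lebesgue integrals and the log-Laplace transform of exp (- |x|^p) *)

(** Membership in the ball and the projection on a column involve only the pair of a linear form and
    of the sum of the [|x_i|^p]. Volumes are therefore handled as iterated one-dimensional integrals
    of functions of two variables, and exponentials of the pair factor over the coordinates. The
    assumption [2 <= p] enters through [x^2 <= 1 + |x|^p]: it makes [psi] at most quadratic, so that
    [psi (v g_0)] has exponential moments. The lower bound must keep the maximum below a level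
    although nothing is known about the joint law of the columns. One column is placed slightly
    below [r]. Some column reaching a higher level costs strictly more, because at a critical point
    of the tilting functional raising [r] changes the slope in [v]. This is why exact critical
    points, not just near-optimal tilts, are constructed. Haar measure is given only by its
    invariance, so caps serve to transfer events to Gaussian vectors. The cap may shrink with [n],
    since its probability cancels. Finally the null set of frames must serve all [v] at once, which
    monotonicity of [psi] in [|v|] reduces to rational [v]. *)

Section lebesgue_affine.
Context {R : realType}.
Local Notation mu := (@lebesgue_measure R).

Lemma lebesgue_measure_shift (c : R) (A : set R) : measurable A ->
  pushforward mu ((fun x => x + c) : measurableTypeR R -> measurableTypeR R) A = mu A.
Proof.
move=> mA.
have mf : measurable_fun setT ((fun x => x + c) : measurableTypeR R -> measurableTypeR R).
  exact: measurable_funD.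
pose f : {mfun measurableTypeR R >-> measurableTypeR R} :=
  HB.pack (_ : measurableTypeR R -> measurableTypeR R) (isMeasurableFun.Build _ _ _ _ _ mf).
apply/esym; apply: (@lebesgue_measure_unique R (pushforward mu f)) => //.
move=> _ [[a b]] _ <-.
rewrite /pushforward /=.
rewrite [RHS](_ : _ = mu [set` `](a - c), (b - c)]]); last first.
  congr (mu _).
  by apply/seteqP; split => x /=; rewrite !in_itv/= ltrBlDr lerBrDr.
rewrite /= !lebesgue_measure_itv/= !lte_fin ltrD2r; case: ifPn => // _.
by rewrite -!EFinD; congr EFin; ring.
Qed.

Lemma lebesgue_measure_scale (s : R) (A : set R) : 0 < s -> measurable A ->
  (s%:E * pushforward mu ((fun x => s * x)%R : measurableTypeR R -> measurableTypeR R) A = mu A)%E.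
Proof.
move=> s0 mA.
have mf : measurable_fun setT ((fun x => s * x) : measurableTypeR R -> measurableTypeR R).
  exact: measurable_funM.
pose f : {mfun measurableTypeR R >-> measurableTypeR R} :=
  HB.pack (_ : measurableTypeR R -> measurableTypeR R) (isMeasurableFun.Build _ _ _ _ _ mf).
apply/esym.
apply: (@lebesgue_measure_unique R (mscale (NngNum (ltW s0)) (pushforward mu f))) => //.
move=> _ [[a b]] _ <-.
rewrite /mscale/= /pushforward/=.
rewrite [RHS](_ : _ = (s%:E * mu [set` `](a / s)%R, (b / s)%R]])%E); last first.
  congr (_ * mu _)%E; apply/seteqP; split => x /=; rewrite !in_itv/= ltr_pdivrMr// ler_pdivlMr//.
    by rewrite mulrC.
  by rewrite mulrC.
rewrite /= !lebesgue_measure_itv/= !lte_fin ltr_pM2r ?invr_gt0//.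
case: ifPn => // _; last by rewrite mule0.
rewrite -!EFinD -EFinM; congr EFin; field; exact: lt0r_neq0.
Qed.

Local Open Scope ereal_scope.

Lemma ge0_integral_shift (f : R -> \bar R) (c : R) :
  measurable_fun setT f -> (forall x, 0 <= f x) ->
  \int[mu]_x f (x + c)%R = \int[mu]_x f x.
Proof.
move=> mf f0.
have mp : measurable_fun setT ((fun x => x + c)%R : measurableTypeR R -> measurableTypeR R).
  exact: measurable_funD.
rewrite -[LHS]/(\int[mu]_(x in (fun x => x + c)%R @^-1` setT) (f \o (fun x => x + c)%R) x).
rewrite -(ge0_integral_pushforward mp)//.
by apply: eq_measure_integral => A mA _; exact: lebesgue_measure_shift.
Qed.

Lemma ge0_integral_opp (f : R -> \bar R) :
  measurable_fun setT f -> (forall x, 0 <= f x) ->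
  \int[mu]_x f (- x)%R = \int[mu]_x f x.
Proof.
move=> mf f0.
have mp : measurable_fun setT (-%R : measurableTypeR R -> measurableTypeR R).
  exact: oppr_measurable.
rewrite -[LHS]/(\int[mu]_(x in -%R @^-1` setT) (f \o -%R) x).
rewrite -(ge0_integral_pushforward mp)//.
by apply: eq_measure_integral => A mA _; exact: lebesgue_measureN.
Qed.

Lemma ge0_integral_scale (f : R -> \bar R) (s : R) : (0 < s)%R ->
  measurable_fun setT f -> (forall x, 0 <= f x) ->
  s%:E * \int[mu]_x f (s * x)%R = \int[mu]_x f x.
Proof.
move=> s0 mf f0.
have mp : measurable_fun setT ((fun x => s * x)%R : measurableTypeR R -> measurableTypeR R).
  exact: measurable_funM.
rewrite -[X in _ * X]/(\int[mu]_(x in (fun x => s * x)%R @^-1` setT) (f \o (fun x => s * x)%R) x).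
rewrite -(ge0_integral_pushforward mp)//.
pose g : {mfun measurableTypeR R >-> measurableTypeR R} :=
  HB.pack (_ : measurableTypeR R -> measurableTypeR R) (isMeasurableFun.Build _ _ _ _ _ mp).
rewrite -(ge0_integral_mscale (pushforward mu g) measurableT (NngNum (ltW s0)))//.
by apply: eq_measure_integral => A mA _; exact: lebesgue_measure_scale.
Qed.

End lebesgue_affine.

HB.lock Definition mgf (R : realType) (p c t : R) : R :=
  \int[@lebesgue_measure R]_x expR (t * x - c * `|x| `^ p).

HB.lock Definition dmgf (R : realType) (p t : R) : R :=
  \int[@lebesgue_measure R]_x (x * expR (t * x - 1 * `|x| `^ p)).

(** Not normalised: [psi p 0] is the logarithm of the total mass of [exp (- |x|^p)] and reappears in
    the volume rate [kappa]. *)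
HB.lock Definition psi (R : realType) (p t : R) : R := ln (mgf p 1 t).

HB.lock Definition dpsi (R : realType) (p t : R) : R := dmgf p t / mgf p 1 t.

(** This is [sqrt (pi / c)], the mass of [exp (- c x^2)]: the inverse peak of the centred normal
    density of variance [1 / (2 c)]. *)
HB.lock Definition gauss_const (R : realType) (c : R) : R :=
  (normal_peak (Num.sqrt (2 * c)^-1))^-1.

(** The constant term of the quadratic bound [psi_le]: the factor [e] is the price of replacing
    [|x|^p] by [x^2 - 1]. *)
HB.lock Definition psi_const (R : realType) : R := ln (expR 1 * gauss_const (1 : R)).

Section moment_generating.
Context {R : realType}.
Local Notation mu := (@lebesgue_measure R).
Implicit Types c t x h : R.

Lemma gauss_normalE c t x : 0 < c ->
  expR (t * x - c * x ^+ 2) =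
  expR (t ^+ 2 / (4 * c)) / normal_peak (Num.sqrt (2 * c)^-1) *
  normal_pdf (t / (2 * c)) (Num.sqrt (2 * c)^-1) x.
Proof.
move=> c0; have c20 : 0 < 2 * c by rewrite mulr_gt0.
have s0 : Num.sqrt (2 * c)^-1 != 0 by rewrite gt_eqF// sqrtr_gt0 invr_gt0.
rewrite /normal_pdf (negbTE s0) [RHS]mulrA (divfK (lt0r_neq0 (normal_peak_gt0 s0)))//.
rewrite /normal_fun -expRD sqr_sqrtr ?invr_ge0 ?ltW//; congr expR.
by rewrite -mulr_natl; field; rewrite gt_eqF.
Qed.

Lemma gauss_integrable c t : 0 < c ->
  mu.-integrable setT (fun x => (expR (t * x - c * x ^+ 2))%:E).
Proof.
move=> c0; under eq_fun do rewrite gauss_normalE// EFinM.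
by apply: integrableZl => //; exact: integrable_normal_pdf.
Qed.

Lemma gauss_const_gt0 c : 0 < c -> 0 < gauss_const c.
Proof.
move=> c0; rewrite gauss_const.unlock  invr_gt0 normal_peak_gt0// gt_eqF// sqrtr_gt0.
by rewrite invr_gt0 mulr_gt0.
Qed.

Lemma gauss_integral c t : 0 < c ->
  (\int[mu]_x (expR (t * x - c * x ^+ 2))%:E =
   (expR (t ^+ 2 / (4 * c)) * gauss_const c)%:E)%E.
Proof.
move=> c0; under eq_integral do rewrite gauss_normalE// EFinM.
rewrite integralZl//; last exact: integrable_normal_pdf.
by rewrite integral_normal_pdf mule1 gauss_const.unlock.
Qed.

Context (p : R) (hp : 2 <= p).

(** Here [2 <= p] provides the Gaussian majorant of [exp (- |x|^p)], hence all the integrability and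
    the quadratic growth of [psi]. *)
Lemma sqr_le_powR x : x ^+ 2 <= 1 + `|x| `^ p.
Proof.
have [x1|x1] := lerP `|x| 1.
  by rewrite -real_normK ?num_real// (@le_trans _ _ 1) ?exprn_ile1// lerDl powR_ge0.
rewrite -real_normK ?num_real// -powR_mulrn//.
by rewrite (le_trans (ler_powR (ltW x1) hp))// lerDr.
Qed.

Lemma measurable_norm_powR : measurable_fun setT (fun x : R => `|x| `^ p).
Proof. exact: (measurableT_comp (measurable_powR p)). Qed.

Lemma measurable_tilt c t :
  measurable_fun setT (fun x : R => expR (t * x - c * `|x| `^ p)).
Proof.
apply: measurableT_comp => //; apply: measurable_funB => //.
by apply: measurable_funM => //; exact: measurable_norm_powR.
Qed.

Lemma tilt_le_gauss c t x : 0 < c ->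
  expR (t * x - c * `|x| `^ p) <= expR c * expR (t * x - c * x ^+ 2).
Proof.
move=> c0; rewrite -expRD ler_expR.
by have := ler_wpM2l (ltW c0) (sqr_le_powR x); rewrite mulrDr mulr1; lra.
Qed.

Lemma tilt_integrable c t : 0 < c ->
  mu.-integrable setT (fun x => (expR (t * x - c * `|x| `^ p))%:E).
Proof.
move=> c0.
apply: (@le_integrable _ _ _ mu _ measurableT _
   (fun x => (expR c)%:E * (expR (t * x - c * x ^+ 2))%:E)%E).
- apply/measurable_EFinP; exact: measurable_tilt.
- move=> x _; rewrite -EFinM !abse_EFin lee_fin normrM !(ger0_norm (expR_ge0 _)).
  exact: tilt_le_gauss.
- by apply: integrableZl => //; exact: gauss_integrable.
Qed.

Local Notation mgf := (mgf p).
Local Notation dmgf := (dmgf p).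
Local Notation psi := (psi p).
Local Notation dpsi := (dpsi p).
Local Notation psi_const := (psi_const R).

Lemma EFin_mgf c t : 0 < c ->
  ((mgf c t)%:E = \int[mu]_x (expR (t * x - c * `|x| `^ p))%:E)%E.
Proof.
move=> c0; rewrite mgf.unlock  /Rintegral fineK//.
by apply: integrable_fin_num => //; exact: tilt_integrable.
Qed.

Lemma mgf_gt0 c t : 0 < c -> 0 < mgf c t.
Proof.
have p0 : 0 <= p by rewrite (le_trans _ hp).
move=> c0; rewrite -lte_fin EFin_mgf//.
apply: (@lt_le_trans _ _ (\int[mu]_(x in `[0%R, 1%R]) (expR (- `|t| - c))%:E)%E).
  rewrite integral_cst//= lebesgue_measure_itv/= lte_fin ltr01 oppr0 adde0 mule1.
  by rewrite lte_fin expR_gt0.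
apply: (@le_trans _ _ (\int[mu]_(x in `[0%R, 1%R]) (expR (t * x - c * `|x| `^ p))%:E)%E).
  apply: ge0_le_integral => //.
  - apply/measurable_EFinP/measurable_funTS; exact: measurable_tilt.
  - move=> x /=; rewrite in_itv/= => /andP[x0 x1]; rewrite lee_fin ler_expR.
    apply: lerB.
      rewrite lerNl; apply: (le_trans (ler_norm _)); rewrite normrN normrM.
      by rewrite (ger0_norm x0) ler_piMr.
    rewrite ger_pMr//.
    have : `|x : R| `^ p <= (1 : R) `^ p.
      by apply: ge0_ler_powR; rewrite ?nnegrE ?(ger0_norm x0).
    by rewrite powR1.
apply: ge0_subset_integral => //.
apply/measurable_EFinP; exact: measurable_tilt.
Qed.

Lemma mgfN c t : 0 < c -> mgf c (- t) = mgf c t.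
Proof.
move=> c0; apply: EFin_inj; rewrite (EFin_mgf (- t) c0) (EFin_mgf t c0).
rewrite -[RHS]ge0_integral_opp; last 2 first.
- apply/measurable_EFinP; exact: measurable_tilt.
- by move=> x; rewrite lee_fin expR_ge0.
by apply: eq_integral => x _; rewrite normrN mulrN mulNr.
Qed.

(** Substitution [x -> s x]. By this homogeneity every weight [c = s^p] reduces to [c = 1], so the
    single function [psi] suffices once [t] is written [v * s]. *)
Lemma mgf_scale c t (s : R) : 0 < c -> 0 < s ->
  mgf (c * s `^ p) (t * s) = s^-1 * mgf c t.
Proof.
move=> c0 s0; have csp : 0 < c * s `^ p by rewrite mulr_gt0// powR_gt0.
apply: (mulfI (lt0r_neq0 s0)); rewrite mulrA divff ?gt_eqF// mul1r.
apply: EFin_inj; rewrite EFinM !EFin_mgf//.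
rewrite -[RHS](ge0_integral_scale s0); last 2 first.
- apply/measurable_EFinP; exact: measurable_tilt.
- by move=> x; rewrite lee_fin expR_ge0.
by under [in RHS]eq_integral => x _ do
  rewrite normrM (gtr0_norm s0) powRM ?(ltW s0)// !mulrA.
Qed.

Lemma mgf1_le t : mgf 1 t <= expR 1 * gauss_const 1 * expR (t ^+ 2 / 4).
Proof.
rewrite -lee_fin EFin_mgf//.
apply: (@le_trans _ _ (\int[mu]_x ((expR 1)%:E * (expR (t * x - 1 * x ^+ 2))%:E))%E).
  apply: ge0_le_integral => //.
  - apply/measurable_EFinP; exact: measurable_tilt.
  - by apply: (measurable_int mu); apply: integrableZl => //; exact: gauss_integrable.
  - by move=> x _; rewrite -EFinM lee_fin tilt_le_gauss.
rewrite integralZl//; last exact: gauss_integrable.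
rewrite gauss_integral// -EFinM lee_fin (_ : 4 * 1 = 4 :> R) ?mulr1//.
by rewrite [X in _ * X]mulrC mulrA.
Qed.

(** Dominates the derivative for all parameters within 1 of [t]: the factor [|x|] costs one
    [exp |x|] and the change of parameter another, whence the 2. The two terms serve the two signs
    of [x]. *)
Let dom t x := expR ((t + 2) * x - 1 * `|x| `^ p) + expR ((t - 2) * x - 1 * `|x| `^ p).

Let dom_ge t s x : `|s - t| < 1 -> `|x * expR (s * x - 1 * `|x| `^ p)| <= dom t x.
Proof.
move=> st; rewrite normrM (ger0_norm (expR_ge0 _)).
have H1 : `|x| <= expR `|x| by have := expR_ge1Dx `|x|; lra.
apply: (le_trans (ler_wpM2r (expR_ge0 _) H1)); rewrite -expRD.
have H2 : s * x <= t * x + `|x|.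
  rewrite -lerBlDl -mulrBl (le_trans (ler_norm _))// normrM ler_piMl// ltW//.
have [x0|x0] := lerP 0 x.
  rewrite /dom (@le_trans _ _ (expR ((t + 2) * x - 1 * `|x| `^ p)))// ?lerDl ?expR_ge0//.
  by rewrite ler_expR; move: H2; rewrite (ger0_norm x0); lra.
rewrite /dom (@le_trans _ _ (expR ((t - 2) * x - 1 * `|x| `^ p)))// ?lerDr ?expR_ge0//.
by rewrite ler_expR; move: H2; rewrite (ltr0_norm x0); lra.
Qed.

Let dom_integrable t : mu.-integrable setT (EFin \o dom t).
Proof.
rewrite /comp/dom; under eq_fun do rewrite EFinD.
by apply: integrableD => //; exact: tilt_integrable.
Qed.

Lemma dtilt_integrable t :
  mu.-integrable setT (fun x => (x * expR (t * x - 1 * `|x| `^ p))%:E).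
Proof.
apply: (@le_integrable _ _ _ mu _ measurableT _ (EFin \o dom t)) => //.
- by apply/measurable_EFinP/measurable_funM => //; exact: measurable_tilt.
- move=> x _; rewrite !abse_EFin lee_fin (le_trans (@dom_ge t t x _)) ?subrr ?normr0//.
  exact: ler_norm.
Qed.

Lemma is_derive_mgf t : is_derive t 1 (mgf 1) (dmgf t).
Proof.
have It : (`]t - 1, t + 1[%classic : set R) t by rewrite /= in_itv/=; lra.
pose f t x := expR (t * x - 1 * `|x| `^ p).
have df (s x : R) : is_derive s (1 : R) (fun s : R => f s x) (x * f s x).
  rewrite /f; apply: is_derive_eq; rewrite /= subr0 scaler0 add0r mulrC.
  by congr (_ * _); exact: mulr1.
have d1f s x : partial1of2 f s x = x * f s x.
  by rewrite partial1of2E; apply: derive_val.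
have intf s : (`]t - 1, t + 1[%classic : set R) s -> mu.-integrable setT (EFin \o f s).
  by move=> _; exact: tilt_integrable.
have derf s x : (`]t - 1, t + 1[%classic : set R) s -> setT x -> derivable (f ^~ x) s 1.
  by move=> _ _; apply: ex_derive.
have dom0 x : 0 <= dom t x by rewrite addr_ge0 ?expR_ge0.
have ub s x : (`]t - 1, t + 1[%classic : set R) s -> setT x ->
    `|partial1of2 f s x| <= dom t x.
  rewrite /= in_itv/= => /andP[s1 s2] _; rewrite d1f dom_ge// ltr_norml; lra.
have E : mgf 1 = (fun s => \int[mu]_(x in setT) f s x) by apply/funext => s; rewrite mgf.unlock.
rewrite E; apply: DeriveDef.
  exact: (derivable_under_integral measurableT It intf derf dom0 (dom_integrable t) ub).
rewrite -derive1E (differentiation_under_integral measurableT It intf derf dom0 (dom_integrable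
    t) ub).
by rewrite dmgf.unlock; apply: eq_Rintegral => x _; rewrite d1f.
Qed.

Lemma is_derive_psi t : is_derive t 1 psi (dpsi t).
Proof.
have h0 := mgf_gt0 t (@ltr01 R).
have h1 := is_derive_mgf t.
have h2 : is_derive (mgf 1 t) 1 (@ln R) (mgf 1 t)^-1 by exact: is_derive1_ln.
have := is_derive1_comp h2 h1.
by rewrite psi.unlock dpsi.unlock /comp  => /is_derive_eq; apply; rewrite mulrC.
Qed.

(** Convexity by Jensen: [exp y >= 1 + y] at [y = h (x - m)], where [m = dpsi t] is the mean of the
    tilted law, so that the linear term integrates to zero. *)
Lemma psi_tangent t h : psi t + h * dpsi t <= psi (t + h).
Proof.
have m0 s := mgf_gt0 s (@ltr01 R).
suff : expR (h * dpsi t) * mgf 1 t <= mgf 1 (t + h).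
  move=> H; rewrite psi.unlock .
  rewrite -(expRK (h * dpsi t)) -lnM ?posrE ?expR_gt0//.
  by rewrite ler_ln ?posrE ?mulr_gt0 ?expR_gt0// mulrC.
set m := dpsi t.
rewrite -lee_fin EFin_mgf//.
have -> : (expR (h * m) * mgf 1 t)%:E = (\int[mu]_x
   ((expR (h * m) * (1 - h * m))%:E * (expR (t * x - 1 * `|x| `^ p))%:E +
    (expR (h * m) * h)%:E * (x * expR (t * x - 1 * `|x| `^ p))%:E))%E.
  rewrite integralD//; last 2 first.
  - by apply: integrableZl => //; exact: tilt_integrable.
  - by apply: integrableZl => //; exact: dtilt_integrable.
  rewrite !integralZl//; last 2 first.
  - exact: dtilt_integrable.
  - exact: tilt_integrable.
  rewrite -EFin_mgf//.
  have -> : (\int[mu]_x (x * expR (t * x - 1 * `|x| `^ p))%:E = (dmgf t)%:E)%E.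
    rewrite dmgf.unlock /Rintegral fineK//.
    by apply: integrable_fin_num => //; exact: dtilt_integrable.
  rewrite -!EFinM -EFinD; congr EFin.
  have -> : dmgf t = m * mgf 1 t by rewrite /m dpsi.unlock divfK// gt_eqF.
  by ring.
apply: le_integral => //.
- apply: integrableD => //; apply: integrableZl => //; first exact: tilt_integrable.
  exact: dtilt_integrable.
- exact: tilt_integrable.
- move=> x _; rewrite -!EFinM -EFinD lee_fin.
  rewrite [leRHS](_ : _ = expR (h * m) * expR (h * (x - m)) * expR (t * x - 1 * `|x| `^ p));
      last first.
    by rewrite -!expRD; congr expR; ring.
  rewrite [leLHS](_ : _ = expR (h * m) * (1 + h * (x - m)) * expR (t * x - 1 * `|x| `^ p));
      last by ring.
  by rewrite ler_wpM2r ?expR_ge0// ler_wpM2l ?expR_ge0// expR_ge1Dx.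
Qed.

Lemma psiN t : psi (- t) = psi t.
Proof. by rewrite psi.unlock  mgfN. Qed.

Lemma psi_midpoint t h : 2 * psi t <= psi (t + h) + psi (t - h).
Proof.
by have := psi_tangent t h; have := psi_tangent t (- h); lra.
Qed.

(** An even convex function increases with the absolute value: the tangent at [a] is followed to [b]
    when its slope is nonnegative, and otherwise to [- b], where [psi] takes the same value. *)
Lemma psi_convex_bound s t : `|s| <= `|t| -> psi s <= psi t.
Proof.
have H (a b : R) : 0 <= a -> a <= b -> psi a <= psi b.
  move=> a0 ab.
  have h2 := psi_tangent a (b - a); have h1 := psi_tangent a (- a - b).
  rewrite (_ : a + (b - a) = b) in h2; last by ring.
  rewrite (_ : a + (- a - b) = - b) ?psiN in h1; last by ring.
  have [d0|d0] := lerP 0 (dpsi a).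
    by apply: le_trans h2; rewrite lerDl mulr_ge0// subr_ge0.
  apply: le_trans h1; rewrite lerDl; apply: mulr_le0; [lra|exact: ltW].
have absE x : psi `|x| = psi x.
  by have [x0|x0] := lerP 0 x; [rewrite ger0_norm | rewrite ltr0_norm// psiN].
by move=> st; rewrite -(absE s) -(absE t) H.
Qed.

Lemma psi_ge0 t : psi 0 <= psi t.
Proof. by apply: psi_convex_bound; rewrite normr0. Qed.

Lemma psi_le t : psi t <= psi_const + t ^+ 2 / 4.
Proof.
have c0 : 0 < expR 1 * gauss_const (1 : R) by rewrite mulr_gt0 ?expR_gt0// gauss_const_gt0.
rewrite psi_const.unlock psi.unlock -[t ^+ 2 / 4]expRK.
rewrite -lnM ?posrE ?expR_gt0// ler_ln ?posrE ?mgf_gt0 ?mulr_gt0 ?expR_gt0 ?gauss_const_gt0//.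
exact: mgf1_le.
Qed.

Lemma continuous_psi : continuous psi.
Proof.
move=> t; apply: differentiable_continuous; apply/derivable1_diffP.
by case: (is_derive_psi t).
Qed.

Lemma measurable_psi : measurable_fun setT psi.
Proof. exact: continuous_measurable_fun continuous_psi. Qed.

(** By convexity the slope lies between the increments of [psi] over one unit to the left and to the
    right, and these are controlled by [psi_le] and [psi_ge0]. *)
Lemma dpsi_le t : `|dpsi t| <= `|psi_const - psi 0| + (`|t| + 1) ^+ 2 / 4.
Proof.
have H s : 0 <= psi_const - psi 0 + (s ^+ 2) / 4 by have := psi_le s; have := psi_ge0 s; lra.
have h1 := psi_tangent t 1; have h2 := psi_tangent t (- 1).
have h3 := psi_le (t + 1); have h4 := psi_le (t - 1); have h5 := psi_ge0 t.
have h6 : (t + 1) ^+ 2 <= (`|t| + 1) ^+ 2.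
  by rewrite -[leLHS]real_normK ?num_real// lerXn2r ?nnegrE ?addr_ge0// (le_trans (ler_normD _
      _))// normr1.
have h7 : (t - 1) ^+ 2 <= (`|t| + 1) ^+ 2.
  by rewrite -[leLHS]real_normK ?num_real// lerXn2r ?nnegrE ?addr_ge0// (le_trans (ler_normB _
      _))// normr1.
have h8 := ler_norm (psi_const - psi 0).
rewrite ler_norml; apply/andP; split; lra.
Qed.

End moment_generating.

(** * Gaussian sequences *)

Section gaussian_integrals.
Context {R : realType}.
Local Notation mu := (@lebesgue_measure R).
Local Notation N := (@normal_prob R 0 1).

(** The Radon-Nikodym derivative of [normal_prob] agrees almost everywhere with [normal_pdf], both
    having the same integrals over measurable sets. *)
Lemma ge0_integral_normal (f : R -> \bar R) :
  measurable_fun setT f -> (forall x, 0 <= f x)%E ->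
  (\int[N]_x f x = \int[mu]_x (f x * (normal_pdf 0 1 x)%:E))%E.
Proof.
move=> mf f0; have Nmu : N `<< mu := @normal_prob_dominates R 0 1.
rewrite -(Radon_Nikodym_SigmaFinite.change_of_variables Nmu)//.
have mg := measurable_int _ (Radon_Nikodym_SigmaFinite.f_integrable Nmu).
have mpdf : measurable_fun setT (fun x : measurableTypeR R => (normal_pdf 0 1 x)%:E).
  by apply/measurable_EFinP; exact: measurable_normal_pdf.
apply: ae_eq_integral => //.
- exact: emeasurable_funM.
- exact: emeasurable_funM.
apply: ae_eqe_mul2l; apply: integral_ae_eq => //.
- exact: (Radon_Nikodym_SigmaFinite.f_integrable Nmu).
- move=> E _ mE; rewrite -Radon_Nikodym_SigmaFinite.f_integral//.
Qed.

Lemma normal_pdf01E (x : R) :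
  normal_pdf 0 1 x = (gauss_const 2^-1)^-1 * expR (- (2^-1 * x ^+ 2)).
Proof.
rewrite /normal_pdf (negbTE (oner_neq0 R)) gauss_const.unlock invrK.
rewrite divff// invr1 sqrtr1; congr (_ * _).
by rewrite /normal_fun subr0 expr1n; congr expR; rewrite mulNr mulrC.
Qed.

Lemma normal_expR_integrable (s t : R) : s < 2^-1 ->
  N.-integrable setT (fun z => (expR (t * z + s * z ^+ 2))%:E).
Proof.
move=> s2; have c0 : 0 < 2^-1 - s by rewrite subr_gt0.
have mf : measurable_fun setT (fun z : R => expR (t * z + s * z ^+ 2)).
  apply: measurableT_comp => //; apply: measurable_funD => //.
  by apply: measurable_funM => //; exact: exprn_measurable.
apply/integrableP; split; first by apply/measurable_EFinP; exact: mf.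
under eq_integral do rewrite abse_EFin (ger0_norm (expR_ge0 _)).
rewrite ge0_integral_normal; last 2 first.
- by apply/measurable_EFinP; exact: mf.
- by move=> x; rewrite lee_fin expR_ge0.
rewrite (eq_integral (fun z : measurableTypeR R => (gauss_const 2^-1)^-1%:E * (expR (t * z -
    (2^-1 - s) * z ^+ 2))%:E)%E); last first.
  move=> z _; rewrite normal_pdf01E -!EFinM mulrCA -expRD; congr (_ * expR _)%:E.
  by ring.
by rewrite integralZl// ?gauss_integral// ?ltry//; exact: gauss_integrable.
Qed.

(** The majorant comes from [y^(n+1) <= (n+1)! exp y] at [y = 1 + |z|] and from
    [|z| <= 1 + z^2 / 4]; the coefficient 1/4 stays below the Gaussian 1/2. *)
Lemma normal_poly_integrable (f : R -> R) (C : R) (n : nat) :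
  measurable_fun setT f -> (forall z, `|f z| <= C * (1 + `|z|) ^+ n.+1) ->
  N.-integrable setT (EFin \o f).
Proof.
move=> mf fC.
have C0 : 0 <= C by have := fC 0; rewrite normr0 addr0 expr1n mulr1; exact: le_trans.
apply: (@le_integrable _ _ _ N _ measurableT _
  (fun z => (C * (n.+1)`!%:R * expR 2)%:E * (expR (0 * z + 4^-1 * z ^+ 2))%:E)%E).
- by apply/measurable_EFinP; exact: mf.
- move=> z _; rewrite -EFinM /= lee_fin (le_trans (fC z))//.
  rewrite [leRHS]ger0_norm ?mulr_ge0 ?expR_ge0//.
  rewrite -!mulrA ler_wpM2l// -expRD.
  have z1 : 0 <= 1 + `|z| by rewrite addr_ge0.
  have h1 : (1 + `|z|) ^+ n.+1 <= (n.+1)`!%:R * expR (1 + `|z|).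
    rewrite mulrC -ler_pdivrMr ?ltr0n ?fact_gt0//.
    by apply: le_trans (expR_ge1Dxn n z1); rewrite lerDr.
  apply: (le_trans h1); rewrite ler_wpM2l// ler_expR.
  rewrite mul0r add0r -(real_normK (num_real z)).
  have := sqr_ge0 (`|z| - 2); rewrite sqrrB; lra.
- apply: integrableZl => //; apply: normal_expR_integrable; lra.
Qed.

End gaussian_integrals.

HB.lock Definition phi (R : realType) (p v : R) : R :=
  \int[normal_prob 0 1]_z psi p (v * z).

HB.lock Definition dphi (R : realType) (p v : R) : R :=
  \int[normal_prob 0 1]_z (z * dpsi p (v * z)).

Section gaussian_mean.
Context {R : realType} (p : R) (hp : 2 <= p).
Local Notation mu := (@lebesgue_measure R).
Local Notation N := (@normal_prob R 0 1).
Local Notation psi := (psi p).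
Local Notation dpsi := (dpsi p).
Local Notation phi := (phi p).
Local Notation dphi := (dphi p).
Local Notation psi_const := (psi_const R).

Lemma psi_growth (v z : R) :
  `|psi (v * z)| <= (`|psi 0| + `|psi_const| + v ^+ 2) * (1 + `|z|) ^+ 2.
Proof.
have h1 := psi_le hp (v * z); have h2 := psi_ge0 hp (v * z).
have h3 : `|psi (v * z)| <= `|psi 0| + `|psi_const| + v ^+ 2 * z ^+ 2.
  have h4 := ler_norm psi_const; have h5 := ler_norm (- psi 0); rewrite normrN in h5.
  have h6 := normr_ge0 (psi 0); have h7 := normr_ge0 psi_const.
  have h8 : 0 <= v ^+ 2 * z ^+ 2 by rewrite mulr_ge0 ?sqr_ge0.
  rewrite exprMn in h1.
  rewrite ler_norml; apply/andP; split; lra.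
apply: (le_trans h3).
have z1 : 1 <= (1 + `|z|) ^+ 2 by rewrite exprn_ege1// lerDl.
have z2 : z ^+ 2 <= (1 + `|z|) ^+ 2.
  by rewrite -(real_normK (num_real z)) lerXn2r ?nnegrE ?addr_ge0// lerDr.
rewrite [leRHS]mulrDl lerD//; last by rewrite ler_wpM2l// sqr_ge0.
by rewrite ler_peMr// addr_ge0.
Qed.

Lemma measurable_psiM (v : R) : measurable_fun setT (fun z => psi (v * z)).
Proof. by apply: measurableT_comp => //; exact: measurable_psi. Qed.

Lemma psi_integrable (v : R) : N.-integrable setT (fun z => (psi (v * z))%:E).
Proof.
exact: (normal_poly_integrable (measurable_psiM v) (psi_growth v)).
Qed.

Lemma EFin_phi (v : R) : ((phi v)%:E = \int[N]_z (psi (v * z))%:E)%E.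
Proof.
rewrite phi.unlock /Rintegral fineK//.
by apply: integrable_fin_num => //; exact: psi_integrable.
Qed.

Lemma phi0 : phi 0 = psi 0.
Proof.
apply: EFin_inj; rewrite EFin_phi; under eq_integral do rewrite mul0r.
by rewrite integral_cst//= probability_setT mule1.
Qed.

Lemma phi_ge0 v : phi 0 <= phi v.
Proof.
rewrite -lee_fin !EFin_phi; apply: le_integral => //; [exact: psi_integrable..|].
by move=> z _; rewrite lee_fin mul0r psi_ge0.
Qed.

Lemma phiN v : phi (- v) = phi v.
Proof. by rewrite !phi.unlock; apply: eq_Rintegral => z _; rewrite mulNr psiN. Qed.

Lemma is_derive_phi (v : R) : is_derive v 1 phi (dphi v).
Proof.
have Iv : (`]v - 1, v + 1[%classic : set R) v by rewrite /= in_itv/=; lra.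
pose f (v z : R) := psi (v * z).
have df (s z : R) : is_derive s (1 : R) (fun s : R => f s z) (z * dpsi (s * z)).
  have h1 : is_derive s (1 : R) (fun s : R => s * z) z.
    apply: is_derive_eq; rewrite scaler0 add0r; exact: mulr1.
  have h2 := @is_derive_psi R p hp (s * z).
  by have := @is_derive1_comp _ psi ( *%R^~ z) _ _ _ h2 h1; rewrite /comp mulrC.
have d1f (s z : R) : partial1of2 f s z = z * dpsi (s * z).
  by rewrite partial1of2E; have := df s z => /@derive_val.
have intf s : (`]v - 1, v + 1[%classic : set R) s -> N.-integrable setT (EFin \o f s).
  by move=> _; exact: psi_integrable.
have derf s z : (`]v - 1, v + 1[%classic : set R) s -> setT z -> derivable (f ^~ z) s 1.
  by move=> _ _; case: (df s z).
pose K : R := `|psi_const - psi 0|.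
(* For [|s| <= |v| + 1] one has [|s z| + 1 <= (|v| + 2) (1 + |z|)]. The bound on [dpsi] is quadratic
   in this, and the inner derivative [z] raises the degree of [dom] to 3. *)
pose C := K + (`|v| + 2) ^+ 2.
pose dom (z : R) := C * (1 + `|z|) ^+ 3.
have K0 : 0 <= K by exact: normr_ge0.
have C0 : 0 <= C by rewrite addr_ge0// sqr_ge0.
have dom0 z : 0 <= dom z by rewrite mulr_ge0// exprn_ge0// addr_ge0.
have mdom : measurable_fun setT dom.
  apply: measurable_funM => //; apply: measurable_funX.
  by apply: measurable_funD.
have idom : N.-integrable setT (EFin \o dom).
  apply: (@normal_poly_integrable _ _ C 2) => // z.
  by rewrite ger0_norm.
have ub s z : (`]v - 1, v + 1[%classic : set R) s -> setT z ->
    `|partial1of2 f s z| <= dom z.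
  rewrite /= in_itv/= => /andP[s1 s2] _; rewrite d1f normrM.
  have z0 := normr_ge0 z.
  have sv : `|s| <= `|v| + 1.
    by rewrite -lerBlDl (le_trans (lerB_dist _ _))// ler_norml; lra.
  have h := dpsi_le hp (s * z).
  have h2 : (`|s * z| + 1) ^+ 2 / 4 <= (`|v| + 2) ^+ 2 * (1 + `|z|) ^+ 2.
    rewrite -exprMn; apply: (@le_trans _ _ ((`|s * z| + 1) ^+ 2)).
      by rewrite ler_pdivrMr// ler_peMr ?sqr_ge0//; lra.
    rewrite lerXn2r ?nnegrE ?addr_ge0// ?mulr_ge0 ?addr_ge0//.
    rewrite normrM; have := ler_wpM2r z0 sv; have := normr_ge0 v; nra.
  have z1 : 1 <= (1 + `|z|) ^+ 2 by rewrite exprn_ege1// lerDl.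
  have h3 : `|dpsi (s * z)| <= C * (1 + `|z|) ^+ 2.
    apply: (le_trans h); rewrite /C mulrDl lerD//.
    by rewrite -/K ler_peMr.
  rewrite /dom exprS mulrCA ler_pM//.
  by rewrite lerDr.
have E : phi = (fun s => \int[N]_(z in setT) f s z).
  by apply/funext => s; rewrite phi.unlock.
rewrite E; apply: DeriveDef.
  exact: (derivable_under_integral measurableT Iv intf derf dom0 idom ub).
rewrite -derive1E (differentiation_under_integral measurableT Iv intf derf dom0 idom ub).
by rewrite dphi.unlock; apply: eq_Rintegral => z _; rewrite d1f.
Qed.

Lemma continuous_phi : continuous phi.
Proof.
move=> t; apply: differentiable_continuous; apply/derivable1_diffP.
by case: (is_derive_phi t).
Qed.

Lemma dphi0 : dphi 0 = 0.
Proof.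
have : is_derive (0 : R) 1 phi 0.
  apply: (@derive1_at_min _ phi (-1) 1) => //.
  - by move=> x _; case: (is_derive_phi x).
  - by rewrite in_itv/=; lra.
  - by move=> x _; exact: phi_ge0.
by move=> [_ h]; have [_ <-] := is_derive_phi 0.
Qed.

End gaussian_mean.

(** * Independence of one Gaussian from all the others *)

Section independence.
Context {R : realType} {d : measure_display} {O : measurableType d}.
Variables (Q : probability O R) (g : nat -> {RV Q >-> R}).
Hypothesis g_iid : iid_standard_gaussian g.
Local Notation mu := (@lebesgue_measure R).
Local Notation N := (@normal_prob R 0 1).

(** Generators of the sigma-algebra of all the Gaussians except the [m]-th. A function measurable
    for it can be frozen while [g m] is integrated out. *)
Definition other (m : nat) : set (set O) :=
  [set A | exists i, exists2 B : set R, measurable B & i != m /\ A = g i @^-1` B].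

Definition other_space (m : nat) := g_sigma_algebraType (other m).

Lemma measurable_preim_g i (B : set R) : measurable B -> measurable (g i @^-1` B).
Proof. by move=> mB; rewrite -[X in measurable X]setTI; exact: (measurable_funP (g i)). Qed.

Lemma other_measurable m : <<s other m >> `<=` (measurable : set (set O)).
Proof.
apply: smallest_sub; first exact: sigma_algebra_measurable.
by move=> _ [i [B mB [_ ->]]]; exact: measurable_preim_g.
Qed.

Let cyl (m : nat) : set (set O) := [set A | exists F : {fset nat}, exists B : nat -> set R,
  [/\ m \notin F, forall i, measurable (B i) & A = \bigcap_(i in [set` F]) g i @^-1` B i]].

(** As functions of [A], both sides are finite measures. They agree on the cylinders avoiding the
    index [m], which are stable under intersection and generate the sigma-algebra. *)
Lemma independent_other m (A : set O) (B : set R) : <<s other m >> A -> measurable B ->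
  Q (A `&` g m @^-1` B) = (Q A * Q (g m @^-1` B))%E.
Proof.
move=> oA mB; set E := g m @^-1` B.
have mE : measurable E by exact: measurable_preim_g.
have QEfin : Q E \is a fin_num by exact: fin_num_measure.
pose r : {nonneg R} := NngNum (fine_ge0 (measure_ge0 Q E)).
suff : mrestr Q mE A = mscale r Q A.
  by rewrite /mrestr/mscale/= fineK// muleC.
have ocyl : other m `<=` cyl m.
  move=> _ [i [B' mB' [im ->]]]; exists [fset i]%fset, (fun=> B'); split => //.
    by rewrite inE eq_sym.
  by rewrite set_fset1 bigcap_set1.
have cylm : cyl m `<=` measurable.
  move=> _ [F [B' [_ mB' ->]]]; apply: bigcap_measurableType => // i _.
  exact: measurable_preim_g.
apply: (@g_sigma_algebra_measure_unique _ _ _ (cyl m) cylm (fun=> setT)) => //.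
- move=> _; exists fset0, (fun=> setT); split => //.
  by apply/seteqP; split => // x _ i; rewrite /= inE.
- by rewrite bigcup_const//; exists 0%N.
- move=> _ _ [F [B1 [mF mB1 ->]]] [G [B2 [mG mB2 ->]]].
  exists (F `|` G)%fset, (fun i => (if i \in F then B1 i else setT) `&`
     (if i \in G then B2 i else setT)); split.
  + by rewrite inE negb_or mF.
  + by move=> i; apply: measurableI; case: ifPn.
  + apply/seteqP; split => x /=.
      move=> [h1 h2] i /=; rewrite inE => _; split; case: ifPn => //.
        by move=> iF; exact: h1.
      by move=> iG; exact: h2.
    move=> h; split => i /= iF; have := h i; rewrite /= inE iF ?orbT => /(_ isT) [].
      by [].
    by [].
- move=> _ [F [B' [mF mB' ->]]].
  rewrite -[LHS]/(Q (_ `&` E)) -[RHS]/((fine (Q E))%:E * Q _)%E fineK//.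
  pose B2 i := if i == m then B else B' i.
  have mB2 i : measurable (B2 i) by rewrite /B2; case: ifPn.
  have -> : \bigcap_(i in [set` F]) g i @^-1` B' i `&` E =
      \bigcap_(i in [set` (m |` F)%fset]) g i @^-1` B2 i.
    apply/seteqP; split => x.
      move=> [h1 h2] i /=; rewrite !inE /B2; case: eqP => [->//|_ /= iF].
      exact: h1.
    move=> h; split => [i /= iF|].
      have := h i; rewrite /= !inE iF orbT /B2 => /(_ isT).
      by case: (eqVneq i m) => [im _|//]; move: mF; rewrite -im iF.
    by have := h m; rewrite /= !inE eqxx /B2 eqxx => /(_ isT).
  have [_ ind] := g_iid.
  rewrite !ind// big_fsetU1//= {1}/B2 eqxx; congr (_ * _)%E.
  apply: eq_big_seq => i iF; rewrite /B2; case: (eqVneq i m) => [im|//].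
  by move: mF; rewrite -im iF.
- by move=> k; rewrite -[X in (X < _)%E]/(Q (_ `&` E)) setTI (le_lt_trans (probability_le1 _
    _))// ltry.
- have : <<s other m >> `<=` <<s cyl m >>.
    apply: smallest_sub; first exact: smallest_sigma_algebra.
    by move=> C /ocyl; exact: sub_sigma_algebra.
  exact.
Qed.

Lemma distribution_gauss i (B : set R) : measurable B -> Q (g i @^-1` B) = N B.
Proof. by move=> mB; have [+ _] := g_iid => /(_ i B mB). Qed.

Lemma other_mfun m d' (T : measurableType d') (X : O -> T) :
  @measurable_fun _ _ (other_space m) T setT X -> measurable_fun setT X.
Proof.
by move=> mX _ A mA; apply: (@other_measurable m); exact: mX.
Qed.

(** By independence the law of the pair [(X, g m)] is a product measure, identified by its values on
    rectangles; Tonelli's theorem concludes. *)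
Lemma integral_other m d' (T : measurableType d') (X : O -> T) (F : T * measurableTypeR R ->
    \bar R) :
  @measurable_fun _ _ (other_space m) T setT X ->
  measurable_fun setT F -> (forall t, 0 <= F t)%E ->
  (\int[Q]_x F (X x, g m x) = \int[Q]_x \int[N]_z F (X x, z))%E.
Proof.
move=> oX mF F0; have mX := other_mfun oX.
have mXg : measurable_fun setT (fun x => (X x, g m x : measurableTypeR R)).
  by apply: measurable_fun_pair => //; exact: (measurable_funP (g m)).
pose X' : {mfun O >-> T} := HB.pack X (isMeasurableFun.Build _ _ _ _ _ mX).
pose Xg : {mfun O >-> (T * measurableTypeR R)%type} := HB.pack (fun x => (X x, g m x))
  (isMeasurableFun.Build _ _ _ _ _ mXg).
have H := @product_measure_unique _ _ T (measurableTypeR R) R (distribution Q X') N (distribution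
    Q Xg).
rewrite -[LHS]/(\int[Q]_(x in Xg @^-1` setT) (F \o Xg) x)%E.
rewrite -(ge0_integral_pushforward mXg)//.
transitivity (\int[(distribution Q X') \x N]_t F t)%E.
  apply: eq_measure_integral => A mA _; apply/esym; apply: H => // A' B mA' mB.
  rewrite /distribution /pushforward/=.
  rewrite -(distribution_gauss m mB) -(@independent_other m (X @^-1` A') B)//.
  by rewrite -[X in <<s _ >> X]setTI; exact: oX.
rewrite fubini_tonelli1//.
rewrite (ge0_integral_pushforward mX)//; last 2 first.
- exact: measurable_fun_fubini_tonelli_F.
- by move=> y _; apply: integral_ge0.
Qed.

End independence.

(** * Kolmogorov's inequality for Gaussian series *)

Section kolmogorov.
Context {R : realType} {d : measure_display} {O : measurableType d}.
Variables (Q : probability O R) (g : nat -> {RV Q >-> R}).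
Hypothesis g_iid : iid_standard_gaussian g.
Local Notation N := (@normal_prob R 0 1).

Lemma ge0_integral_normal_opp (f : R -> \bar R) :
  measurable_fun setT f -> (forall x, 0 <= f x)%E ->
  (\int[N]_z f (- z)%R = \int[N]_z f z)%E.
Proof.
move=> mf f0.
have mo : measurable_fun setT (-%R : measurableTypeR R -> measurableTypeR R).
  exact: oppr_measurable.
rewrite !ge0_integral_normal//; last exact: measurableT_comp mo.
rewrite -[RHS]ge0_integral_opp; last 2 first.
- apply: emeasurable_funM => //.
  by apply/measurable_EFinP; exact: measurable_normal_pdf.
- by move=> x; rewrite mule_ge0// lee_fin normal_pdf_ge0.
apply: eq_integral => x _; congr (_ * (_)%:E)%E.
by rewrite !normal_pdf01E sqrrN.
Qed.

(** Its finiteness is all that almost sure convergence requires; the value is computed in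
    [normal_var1]. *)
Definition normal_var : \bar R := (\int[N]_z (z ^+ 2)%:E)%E.

Lemma normal_var_fin : normal_var \is a fin_num.
Proof.
apply: integrable_fin_num => //.
apply: (@normal_poly_integrable _ (fun z => z ^+ 2) 1 1).
  exact: exprn_measurable.
move=> z; rewrite mul1r normrX lerXn2r ?nnegrE ?addr_ge0//.
by rewrite lerDr.
Qed.

(** The integral is added to its reflection under [z -> - z]: the cross term cancels pointwise, so
    only nonnegative integrands occur. *)
Lemma normal_sqr_shift (t b : R) :
  (\int[N]_z ((t + b * z) ^+ 2)%:E = (t ^+ 2)%:E + (b ^+ 2)%:E * normal_var)%E.
Proof.
have mz (c : R) : measurable_fun setT (fun z : measurableTypeR R => (t + c * z) ^+ 2).
  by apply: measurable_funX; apply: measurable_funD.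
have mz' (c : R) : measurable_fun setT (fun z : measurableTypeR R => ((t + c * z) ^+ 2)%:E).
  by apply/measurable_EFinP; exact: mz.
have p0 (c : R) : (forall z : R, 0 <= ((t + c * z) ^+ 2)%:E)%E.
  by move=> z; rewrite lee_fin sqr_ge0.
have H : (\int[N]_z ((t + b * z) ^+ 2)%:E + \int[N]_z ((t + b * z) ^+ 2)%:E =
   2%:E * ((t ^+ 2)%:E + (b ^+ 2)%:E * normal_var))%E.
  rewrite -[X in (_ + X)%E](ge0_integral_normal_opp (mz' b) (p0 b)).
  rewrite -ge0_integralD//; last first.
    under eq_fun do rewrite mulrN -mulNr.
    exact: mz'.
  rewrite (eq_integral (fun z : measurableTypeR R => 2%:E * ((t ^+ 2)%:E + (b ^+ 2)%:E * (z ^+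
      2)%:E))%E); last first.
    move=> z _; rewrite -[RHS]/((2 * (t ^+ 2 + b ^+ 2 * (z : R) ^+ 2))%:E) -EFinD.
    by congr EFin; ring.
  have msq : measurable_fun setT (fun z : measurableTypeR R => (z ^+ 2)%:E).
    by apply/measurable_EFinP; exact: exprn_measurable.
  rewrite ge0_integralZl//; last 2 first.
  - by apply: emeasurable_funD => //; exact: emeasurable_funM.
  - by move=> z _; rewrite adde_ge0// ?mule_ge0// lee_fin sqr_ge0.
  rewrite ge0_integralD//; last 3 first.
  - by move=> z _; rewrite lee_fin sqr_ge0.
  - by move=> z _; rewrite mule_ge0// lee_fin sqr_ge0.
  - exact: emeasurable_funM.
  rewrite integral_cst//= probability_setT mule1 ge0_integralZl//.
  - by move=> z _; rewrite lee_fin sqr_ge0.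
  - by rewrite lee_fin sqr_ge0.
have V0 := normal_var_fin; rewrite -(fineK V0) -EFinM -EFinD in H *.
move: H; set I := (\int[N]_z _)%E.
have : (0 <= I)%E by apply: integral_ge0 => z _; exact: p0.
case: I => [r| |] //= _; rewrite -?EFinD -?EFinM//.
by case=> K; congr EFin; move: (fine _) K => V K; lra.
Qed.

(* The walk with steps [u i * g i.+1] from time [m] on, frozen once it leaves ]-e, e[. *)
Fixpoint stopped (u : nat -> R) (m : nat) (e : R) (n : nat) (x : O) : R :=
  if n is k.+1 then
    let s := stopped u m e k x in
    s + (if `|s| < e then u (m + k)%N else 0) * g (m + k).+1 x
  else 0.

Lemma measurable_other_g i j : i != j ->
  @measurable_fun _ _ (other_space g j) R setT (g i).
Proof.
move=> ij _ B mB; rewrite setTI; apply: sub_sigma_algebra.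
by exists i, B.
Qed.

Lemma measurable_stop_coef (a e : R) :
  measurable_fun setT (fun s : R => if `|s| < e then a else 0).
Proof.
apply: measurable_fun_ifT => //; apply: measurable_fun_ltr => //.
Qed.

Lemma measurable_stopped u m e n j : (m + n < j)%N ->
  @measurable_fun _ _ (other_space g j) R setT (stopped u m e n).
Proof.
elim: n => [|n IH] mnj /=; first exact: measurable_cst.
have {}IH : @measurable_fun _ _ (other_space g j) R setT (stopped u m e n).
  by apply: IH; rewrite (leq_ltn_trans _ mnj)// leq_add2l.
apply: measurable_funD => //; apply: measurable_funM.
  exact: (measurableT_comp (measurable_stop_coef _ _) IH).
apply: measurable_other_g; rewrite neq_ltn addnS in mnj *.
by rewrite mnj.
Qed.

Lemma measurable_stoppedT u m e n : measurable_fun setT (stopped u m e n).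
Proof. exact: (other_mfun (measurable_stopped u e (ltnSn (m + n)))). Qed.

(** Given the past, the next step is centred, so second moments add up; freezing the walk only
    removes some of the terms. *)
Lemma stopped_var u m e n : (\int[Q]_x (stopped u m e n x ^+ 2)%:E <=
  (\sum_(m <= i < m + n) u i ^+ 2)%:E * normal_var)%E.
Proof.
elim: n => [|n IH].
  rewrite addn0 big_geq// mul0e; under eq_integral do rewrite /= expr0n/=.
  by rewrite integral0.
pose F (t : R * measurableTypeR R) : \bar R :=
  ((t.1 + (if `|t.1| < e then u (m + n)%N else 0) * t.2) ^+ 2)%:E.
have mF : measurable_fun setT F.
  apply/measurable_EFinP; apply: measurable_funX; apply: measurable_funD => //.
  apply: measurable_funM => //.
  exact: (measurableT_comp (measurable_stop_coef _ _)).
rewrite -[leLHS]/(\int[Q]_x F (stopped u m e n x, g (m + n).+1 x))%E.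
rewrite (integral_other g_iid (measurable_stopped u e (ltnSn (m + n))) mF); last first.
  by move=> t; rewrite lee_fin sqr_ge0.
have V0 : (0 <= normal_var)%E by apply: integral_ge0 => z _; rewrite lee_fin sqr_ge0.
have mT : measurable_fun setT (fun x => (stopped u m e n x ^+ 2)%:E).
  by apply/measurable_EFinP; apply: measurable_funX; exact: measurable_stoppedT.
apply: (@le_trans _ _ (\int[Q]_x ((stopped u m e n x ^+ 2)%:E +
    (u (m + n)%N ^+ 2)%:E * normal_var))%E).
  under eq_integral do rewrite /F/= normal_sqr_shift.
  apply: ge0_le_integral => //.
  - by move=> x _; rewrite adde_ge0 ?mule_ge0 ?lee_fin ?sqr_ge0.
  - apply: emeasurable_funD => //; apply: emeasurable_funM => //.
    apply/measurable_EFinP; apply: measurable_funX.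
    apply: (measurableT_comp (measurable_stop_coef _ _)).
    exact: measurable_stoppedT.
  - exact: emeasurable_funD.
  - move=> x _; rewrite leeD2l// lee_wpmul2r//.
    by rewrite lee_fin; case: ifPn => // _; rewrite expr0n sqr_ge0.
rewrite ge0_integralD//; last 2 first.
- by move=> x _; rewrite lee_fin sqr_ge0.
- by move=> x _; rewrite mule_ge0// lee_fin sqr_ge0.
rewrite integral_cst//= probability_setT mule1 addnS big_nat_recr ?leq_addr//=.
rewrite EFinD ge0_muleDl ?lee_fin ?sqr_ge0 ?sumr_ge0//; last by move=> *; exact: sqr_ge0.
by rewrite leeD2r.
Qed.

(** A walk that is still inside at time [n] has never been frozen, so it coincides with the plain
    partial sums; the induction carries this identity along. *)
Lemma stopped_exit u m e n x : `|stopped u m e n x| < e ->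
  forall k, (k <= n)%N ->
  `|\sum_(m <= i < m + k) u i * g i.+1 x| < e.
Proof.
suff H : forall n, `|stopped u m e n x| < e ->
    stopped u m e n x = \sum_(m <= i < m + n) u i * g i.+1 x /\
    forall k, (k <= n)%N -> `|\sum_(m <= i < m + k) u i * g i.+1 x| < e.
  by move=> /H[].
elim=> [|{}n IH] /=.
  rewrite addn0 big_geq// => e0; split => // k; rewrite leqn0 => /eqP->.
  by rewrite addn0 big_geq.
case: ifPn => [s1|s1]; last first.
  by rewrite mul0r addr0 => s2; rewrite s2 in s1.
have [E1 E2] := IH s1.
rewrite E1 addnS big_nat_recr ?leq_addr//= => s2; split => // k.
rewrite leq_eqVlt => /orP[/eqP->|]; last exact: E2.
by rewrite addnS big_nat_recr ?leq_addr.
Qed.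

End kolmogorov.

Section as_convergence.
Context {R : realType} {d : measure_display} {O : measurableType d}.
Variables (Q : probability O R) (g : nat -> {RV Q >-> R}).
Hypothesis g_iid : iid_standard_gaussian g.

Let S (u : nat -> R) m n x := \sum_(m <= i < m + n) u i * g i.+1 x.

Lemma maximal_inequality (u : nat -> R) m (e : R) n : 0 < e ->
  (Q [set x | exists2 k, (k <= n)%N & (e <= `|S u m k x|)%R] <=
   ((\sum_(m <= i < m + n) u i ^+ 2) / e ^+ 2)%R%:E * @normal_var R)%E.
Proof.
move=> e0.
have mT := measurable_stoppedT g u m e n.
have mS k : measurable_fun setT (S u m k).
  by apply: measurable_sum => i; apply: measurable_funM.
have mA : measurable [set x | exists2 k, (k <= n)%N & e <= `|S u m k x|].
  rewrite (_ : [set _ | _] = \bigcup_(k in [set k | (k <= n)%N]) [set x | e <= `|S u m k x|]);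
      last first.
    by apply/seteqP; split => x /= [k kn h]; exists k.
  apply: bigcup_measurable => k _; rewrite -[X in measurable X]setTI.
  by apply: measurable_fun_ler => //; exact: measurableT_comp.
have e20 : 0 < e ^+ 2 by rewrite exprn_gt0.
apply: (@le_trans _ _ (Q [set x | (e ^+ 2)%:E <= `|(stopped g u m e n x ^+ 2)%:E|]%E)).
  apply: le_measure; rewrite ?inE//.
    rewrite -[X in measurable X]setTI; apply: emeasurable_fun_c_infty => //.
    by apply: measurableT_comp => //; apply/measurable_EFinP; exact: measurable_funX.
  move=> x /= [k kn h].
  have h2 : e <= `|stopped g u m e n x|.
    by rewrite leNgt; apply/negP => h2; have := stopped_exit h2 kn; rewrite ltNge h.
  by rewrite lee_fin normrX lerXn2r// nnegrE ltW.
have := @le_integral_abse _ _ _ Q setT measurableT (fun x =>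
    (stopped g u m e n x ^+ 2)%:E) (e ^+ 2).
rewrite setTI => /(_ _ e20) H.
have {}H := H (iffRL (measurable_EFinP _ _) (measurable_funX 2 mT)).
rewrite -lee_pdivlMl// in H.
apply: (le_trans H).
under eq_integral do rewrite abse_EFin ger0_norm ?sqr_ge0//.
rewrite mulrC EFinM -muleA.
apply: lee_wpmul2l; first by rewrite lee_fin ltW// invr_gt0.
exact: (stopped_var g_iid).
Qed.

Lemma ae_cvg_series u : ell2 u ->
  {ae Q, forall x, cvgn (series (fun i => u i * g i.+1 x))}.
Proof.
move=> u2.
have mS m k : measurable_fun setT (S u m k).
  by apply: measurable_sum => i; apply: measurable_funM.
pose A m (e : R) n := [set x | exists2 k, (k <= n)%N & e <= `|S u m k x|].
have mA m e n : measurable (A m e n).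
  rewrite (_ : A m e n = \bigcup_(k in [set k | (k <= n)%N]) [set x | e <= `|S u m k x|]);
      last first.
    by apply/seteqP; split => x /= [k kn h]; exists k.
  apply: bigcup_measurable => k _; rewrite -[X in measurable X]setTI.
  by apply: measurable_fun_ler => //; exact: measurableT_comp.
(* On [B j], a block of size at least [1 / (j + 1)] starts at every index; outside all the [B j] the
   partial sums are Cauchy. *)
pose B (j : nat) := \bigcap_m \bigcup_n A m j.+1%:R^-1 n.
have mU m e : measurable (\bigcup_n A m e n) by exact: bigcup_measurable.
have mB j : measurable (B j) by apply: bigcapT_measurable => m; exact: mU.
have V0 : (0 <= @normal_var R)%E by apply: integral_ge0 => z _; rewrite lee_fin sqr_ge0.
have Vfin := @normal_var_fin R.
have QB j : Q (B j) = 0%E.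
  set e : R := j.+1%:R^-1; have e0 : 0 < e by rewrite invr_gt0.
  apply/eqP; rewrite eq_le measure_ge0 andbT; apply/lee_addgt0Pr => r r0; rewrite add0e.
  pose V := fine (@normal_var R).
  have V0' : 0 <= V by exact: fine_ge0.
  (* With this bound on the tail of the squares, the maximal inequality gives [r V / (V + 1)], which
     is at most [r]; the [+ 1] covers [V = 0]. *)
  pose r' := r / (V + 1) * e ^+ 2.
  have r'0 : 0 < r' by rewrite mulr_gt0 ?exprn_gt0// divr_gt0// ltr_wpDl.
  have /cvgrPdist_lt/(_ _ r'0)[M _ HM] := u2.
  have HS n : \sum_(M <= i < M + n) u i ^+ 2 <= r'.
    have nd : nondecreasing_seq (series (fun i => u i ^+ 2)).
      apply/nondecreasing_seqP => k; rewrite seriesSr lerDl sqr_ge0 //.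
    have h1 := nondecreasing_cvgn_le nd u2 (M + n).
    have h2 : limn (series (fun i => u i ^+ 2)) - series (fun i => u i ^+ 2) M < r'.
      by apply: (le_lt_trans (ler_norm _)); apply: HM => /=.
    have h3 := sub_series (fun i => u i ^+ 2) M (M + n).
    rewrite leq_addr in h3; rewrite -h3; lra.
  apply: (@le_trans _ _ (Q (\bigcup_n A M e n))).
    by apply: le_measure; rewrite ?inE//; apply: bigcap_inf.
  have cA := @nondecreasing_cvg_mu _ _ _ Q (A M e) (mA M e) (mU M e).
  have ndA : nondecreasing_seq (A M e).
    move=> n1 n2 n12; apply/subsetPset => x [k kn h]; exists k => //.
    exact: leq_trans n12.
  have {}cA := cA ndA.
  rewrite -(cvg_lim _ cA)//; apply: lime_le; first by apply/cvg_ex; eexists; exact: cA.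
  apply: nearW => n /=.
  apply: (le_trans (maximal_inequality u M n e0)).
  rewrite -(fineK Vfin) -EFinM lee_fin -/V.
  apply: (@le_trans _ _ (r' / e ^+ 2 * V)).
    by rewrite ler_wpM2r// ler_wpM2r// ?invr_ge0 ?exprn_ge0// ltW.
  rewrite /r' mulfK ?gt_eqF ?exprn_gt0// -mulrA ler_piMr ?(ltW r0)//.
  by rewrite mulrC ler_pdivrMr ?ltr_wpDl// mul1r lerDl.
have : Q.-negligible (\bigcup_j B j).
  apply: negligible_bigcup => j; exists (B j).
  split => //; exact: QB.
apply: negligibleS => x /= ncv; apply: contrapT => nB; apply: ncv.
apply/cauchy_cvgP; apply: cauchy_exP => e e0.
have [j je] : exists j : nat, j.+1%:R^-1 < e.
  have [n _ hn] := near_infty_natSinv_lt (PosNum e0).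
  by exists n; apply: (hn n); exact: leqnn.
have [m nU] : exists m, ~ (\bigcup_n A m j.+1%:R^-1 n) x.
  apply: contrapT => h; apply: nB; exists j => // m _.
  by apply: contrapT => h'; apply: h; exists m.
exists (series (fun i => u i * g i.+1 x) m); exists m => // n /= mn.
rewrite /ball/= distrC sub_series mn.
apply: le_lt_trans je.
have -> : n = (m + (n - m))%N by rewrite subnKC.
rewrite leNgt; apply/negP => h; apply: nU; exists (n - m)%N => //.
by exists (n - m)%N => //; exact: ltW.
Qed.

End as_convergence.

(** * The rate function *)

Section integral_extra.
Context {R : realType} {d : measure_display} {T : measurableType d}.
Variable mu : {measure set T -> \bar R}.
Local Open Scope ereal_scope.

(* No measurability: the integral of a nonnegative function is a supremum over
   the simple functions below it. *)
Lemma integral_mono (f g : T -> \bar R) : (forall x, f x <= g x) ->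
  \int[mu]_x f x <= \int[mu]_x g x.
Proof.
have H (h k : T -> \bar R) : (forall x, 0 <= h x) -> (forall x, h x <= k x) ->
    \int[mu]_x h x <= \int[mu]_x k x.
  move=> h0 hk; rewrite !ge0_integralTE//; last by move=> x; apply: le_trans (hk x).
  apply: le_ereal_sup => _ [s sh <-]; exists s => // x.
  exact: le_trans (sh x) (hk x).
move=> fg; rewrite integralE [leRHS]integralE leeB//; apply: H => //.
- by move=> x; rewrite !funeposE ge_max !le_max fg lexx orbT.
- by move=> x; rewrite !funenegE ge_max !le_max leeN2 fg lexx orbT.
Qed.

End integral_extra.

Section integral_shift.
Context {R : realType} {d : measure_display} {T : measurableType d}.
Variable P : probability T R.

(** The case of an infinite integral is included: in [Lambda_ge] it is applied to a function of an
    arbitrary Gaussian series whose integrability has not been established. *)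
Lemma ge0_integral_addr (f : T -> R) (k : R) : measurable_fun setT f ->
  (forall x, 0 <= f x) ->
  (\int[P]_x (f x + k)%:E = \int[P]_x (f x)%:E + k%:E)%E.
Proof.
move=> mf f0.
have mfE : measurable_fun setT (EFin \o f) by exact/measurable_EFinP.
have I0 : (0 <= \int[P]_x (f x)%:E)%E by apply: integral_ge0 => x _; rewrite lee_fin.
have [Ifin|Iinf] := ltP (\int[P]_x (f x)%:E)%E +oo%E.
  under eq_integral do rewrite EFinD.
  rewrite integralD//.
  - by rewrite integral_cst//= probability_setT mule1.
  - apply/integrableP; split => //.
    by under eq_integral do rewrite /= ger0_norm//.
  - exact: finite_measure_integrable_cst.
have {}Iinf : (\int[P]_x (f x)%:E = +oo)%E by apply/eqP; rewrite eq_le leey Iinf.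
rewrite Iinf addye//; apply/eqP; rewrite eq_le leey/=.
rewrite integralE.
have hn : (\int[P]_x ((fun x => (f x + k)%:E)^\- x) <= `|k|%:E)%E.
  apply: (@le_trans _ _ (\int[P]_x (`|k|%:E)))%E.
    apply: integral_mono => x; rewrite funenegE -EFinN -EFin_max lee_fin ge_max normr_ge0 andbT.
    by have h := f0 x; have h2 := ler_norm (- k); rewrite normrN in h2; lra.
  by rewrite integral_cst//= probability_setT mule1.
have hp : (\int[P]_x ((fun x => (f x + k)%:E)^\+ x) = +oo)%E.
  apply/eqP; rewrite eq_le leey/=.
  have : (\int[P]_x (f x)%:E <= \int[P]_x (((fun x => (f x + k)%:E)^\+ x) + `|k|%:E))%E.
    apply: integral_mono => x; rewrite funeposE -EFin_max -EFinD lee_fin.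
    rewrite -lerBlDr le_max; apply/orP; left; rewrite lerD2l lerNl.
    by rewrite (le_trans (ler_norm _))// normrN.
  rewrite Iinf ge0_integralD//.
  - rewrite integral_cst//= probability_setT mule1.
    by case: (\int[P]_x _)%E => // r; rewrite -EFinD leye_eq.
  - by apply: measurable_funepos; apply/measurable_EFinP; exact: measurable_funD.
rewrite hp; move: hn.
have : (0 <= \int[P]_x ((fun x => (f x + k)%:E)^\- x))%E by exact: integral_ge0.
by case: (\int[P]_x _)%E => //.
Qed.

End integral_shift.

(** * The normalising constant of the density *)

Section gamma.
Context {R : realType}.
Variables (p : R) (hp : 2 <= p).
Local Notation mu := (@lebesgue_measure R).

Let p0 : 0 < p. Proof. by rewrite (lt_le_trans _ hp). Qed.

Lemma integral_expRN_gt (c : R) :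
  (\int[mu]_x ((c < x)%R%:R * expR (- x))%:E = (expR (- c))%:E)%E.
Proof.
have mf : measurable_fun setT (fun x : R => ((c < x)%R%:R * expR (- x))%:E).
  apply/measurable_EFinP; apply: measurable_funM.
    rewrite (_ : (fun x => _) = \1_(`]c, +oo[%classic : set R)).
      by apply: measurable_indic.
    by apply/funext => x; rewrite indicE mem_setE in_itv/= andbT.
  by apply: measurableT_comp => //; exact: oppr_measurable.
rewrite -(ge0_integral_shift c mf); last by move=> x; rewrite lee_fin mulr_ge0 ?expR_ge0.
have := @integral_exponential_pdf R 1 ltr01.
have mE : measurable_fun setT (fun x : measurableTypeR R => (exponential_pdf 1 x)%:E).
  by apply/measurable_EFinP; exact: measurable_exponential_pdf.
move=> H; rewrite -[RHS]mule1 -[in RHS]H -ge0_integralZl//; last first.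
  by move=> x _; rewrite lee_fin exponential_pdf_ge0.
apply: ae_eq_integral => //.
- apply: (measurableT_comp mf); exact: (@measurable_funD _ (measurableTypeR R)).
- exact: emeasurable_funM.
- exists [set 0]; split => //; first exact: lebesgue_measure_set1.
  move=> x /=; apply: contra_notP => x0 _; rewrite -EFinM; congr EFin.
  rewrite -[X in X < _]add0r ltrD2r.
  have [xlt0|xgt0|xe0] := ltgtP (x : R) 0; last by case: x0.
    by rewrite mul0r lt0_exponential_pdf// mulr0.
  rewrite mul1r exponential_pdfE ?ltW//= mul1r mulN1r -expRD opprD.
  by rewrite addrC.
Qed.

(** Layer cake: integrating over the second variable first gives [exp (- |x|^p)], while for [y > 0]
    integrating over the first gives [2 y^(1/p) exp (- y)], twice the integrand of
    [Gamma (1 + 1/p)]. *)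
Let layer (t : measurableTypeR R * measurableTypeR R) : \bar R :=
  ((`|t.1| `^ p < t.2)%R%:R * expR (- t.2))%:E.

Let measurable_layer : measurable_fun setT layer.
Proof.
apply/measurable_EFinP; apply: measurable_funM; last first.
  by apply: measurableT_comp => //; apply: measurableT_comp => //; exact: measurable_snd.
have mlt : measurable_fun setT (fun t : measurableTypeR R * measurableTypeR R =>
    (`|t.1| `^ p < t.2)%R).
  apply: measurable_fun_ltr; last exact: measurable_snd.
  exact: (measurableT_comp (measurable_norm_powR p) measurable_fst).
rewrite (_ : (fun t => _) = (fun t => if (`|t.1| `^ p < t.2)%R then 1 else 0)).
  exact: measurable_fun_ifT.
by apply/funext => t; case: ifPn.
Qed.

Lemma lebesgue_norm_powR_lt (y : R) :
  (\int[mu]_x layer (x, y) =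
   ((2 * (y `^ p^-1 * expR (- y))) * \1_(`]0, +oo[%classic : set R) y)%:E)%E.
Proof.
have [y0|y0] := lerP y 0.
  rewrite indicE memNset ?mulr0/=; last by rewrite in_itv/= andbT ltNge y0.
  rewrite (eq_integral (cst 0%E)) ?integral0// => x _.
  by rewrite /layer/= ltNge (le_trans y0) ?powR_ge0//= mul0r.
rewrite indicE mem_set ?mulr1/=; last by rewrite in_itv/= y0.
have q0 : 0 <= p^-1 by rewrite invr_ge0 ltW.
rewrite (eq_integral (fun x : measurableTypeR R => (expR (- y))%:E *
    (\1_(`] (- (y `^ p^-1)), (y `^ p^-1)[%classic : set R) x)%:E)%E); last first.
  move=> x _; rewrite -EFinM /layer/= indicE mulrC; congr ((_ * (nat_of_bool _)%:R)%:E).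
  have yE : y = (y `^ p^-1) `^ p by rewrite -powRrM mulVf ?gt_eqF// powRr1// ltW.
  rewrite {1}yE mem_setE in_itv/= -ltr_norml.
  apply/idP/idP => h; last first.
    by apply: gt0_ltr_powR; rewrite ?nnegrE ?powR_ge0.
  rewrite ltNge; apply/negP => h2; move: h; rewrite ltNge => /negP; apply.
  by apply: ge0_ler_powR; rewrite ?nnegrE ?powR_ge0// ltW.
rewrite ge0_integralZl//=; last first.
  by apply/measurable_EFinP; exact: measurable_indic.
rewrite integral_indic//= setIT lebesgue_measure_itv/= lte_fin.
rewrite gtrN ?powR_gt0// -EFinD -EFinM; congr EFin; ring.
Qed.

Lemma mgf_Gamma : mgf p 1 0 = 2 * Gamma (1 + p^-1).
Proof.
set D := (`]0, +oo[%classic : set R).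
have mD : measurable D by exact: measurable_itv.
set I := (\int[mu]_(x in D) (x `^ p^-1 * expR (- x))%:E)%E.
have E : ((mgf p 1 0)%:E = 2%:E * I)%E.
  rewrite EFin_mgf// /I.
  have mf : measurable_fun setT (fun x : measurableTypeR R => x `^ p^-1 * expR (- x)).
    apply: measurable_funM; first exact: measurable_powR.
    by apply: measurableT_comp => //; exact: oppr_measurable.
  rewrite -ge0_integralZl//; last 2 first.
  - by apply/measurable_EFinP; exact: measurable_funTS.
  - by move=> x _; rewrite lee_fin mulr_ge0 ?powR_ge0 ?expR_ge0.
  rewrite [RHS]integral_mkcond.
  transitivity (\int[mu]_x \int[mu]_y layer (x, y))%E.
    apply: eq_integral => x _; rewrite /layer/= integral_expRN_gt.
    by rewrite mul0r mul1r sub0r.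
  rewrite (@fubini_tonelli _ _ _ _ _ mu mu layer measurable_layer); last first.
    by move=> t; rewrite lee_fin mulr_ge0 ?expR_ge0.
  apply: eq_integral => y _; rewrite lebesgue_norm_powR_lt indicE patchE -/D.
  by case: ifPn => yD; rewrite ?mulr1 ?mulr0 ?mule0 ?EFinM.
have I0 : (0 <= I)%E.
  by apply: integral_ge0 => x _; rewrite lee_fin mulr_ge0 ?powR_ge0 ?expR_ge0.
rewrite /Gamma /Rintegral addrAC subrr add0r -/D -/I.
move: I0 E; case: I => [r| |] //= _.
  by case.
by rewrite mulry gtr0_sg// mul1e.
Qed.

Lemma mgf_normalization : mgf p p^-1 0 = 2 * p `^ p^-1 * Gamma (1 + p^-1).
Proof.
have s0 : 0 < p `^ (- p^-1) by rewrite powR_gt0.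
have := mgf_scale hp 0 ltr01 s0.
rewrite mul0r mul1r -powRrM mulNr mulVf ?gt_eqF// powR_inv1 ?ltW// => ->.
by rewrite powRN invrK mgf_Gamma mulrCA mulrA.
Qed.

End gamma.

(** The exponential growth rate of the volume of the ball: the minimum over [s] of
    [s^p - ln s + psi p 0], attained at [s^p = 1/p]. *)
Definition kappa (R : realType) (p : R) : R := p^-1 + ln p / p + psi p 0.

(* The functional [u r - c - Phi(u, c)] of the tilting parameters [u = v s], [c = s ^ p]. *)
Definition tilt_gain (R : realType) (p r v s : R) : R :=
  v * s * r - s `^ p + ln s - phi p v + kappa p.

Definition tilt_rate (R : realType) (p r : R) : \bar R :=
  ereal_sup [set y | exists v s, 0 < s /\ y = (tilt_gain p r v s)%:E].

(** * Evaluation of the variational formula *)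

Section rate_identity.
Context {R : realType} {d : measure_display} {O : measurableType d}.
Variables (Q : probability O R) (g : nat -> {RV Q >-> R}).
Hypothesis g_iid : iid_standard_gaussian g.
Variables (p : R) (hp : 2 <= p).
Local Notation mu := (@lebesgue_measure R).
Local Notation N := (@normal_prob R 0 1).

Let p0 : 0 < p. Proof. by rewrite (lt_le_trans _ hp). Qed.

Let K := mgf p p^-1 0.

Let K0 : 0 < K. Proof. by rewrite mgf_gt0// invr_gt0. Qed.

Lemma ln_normalization : ln K = ln p / p + psi p 0.
Proof.
have s0 : 0 < p `^ (- p^-1) by rewrite powR_gt0.
have := mgf_scale hp 0 ltr01 s0.
rewrite mul0r mul1r -powRrM mulNr mulVf ?gt_eqF// powR_inv1 ?ltW// -/K => ->.
by rewrite powRN invrK psi.unlock lnM ?posrE ?powR_gt0 ?mgf_gt0// ln_powR mulrC.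
Qed.

Lemma densityE z : density p z = K^-1 * expR (- (p^-1 * `|z| `^ p)).
Proof. by rewrite /density -mgf_normalization// -/K mulrC [_ / p]mulrC mulrC. Qed.

(** The density contributes [- |z|^p / p], so the total coefficient of [|z|^p] is [c - 1/p]; writing
    it as [- s^p] brings in [mgf_scale]. *)
Lemma Lambda_barE (t c s : R) : 0 < s -> c = p^-1 - s `^ p ->
  Lambda_bar p t c = (psi p (t / s) + (- ln s - ln K))%:E.
Proof.
move=> s0 ->; rewrite /Lambda_bar.
have sp0 : 0 < s `^ p by rewrite powR_gt0.
have -> : (\int[mu]_z (expR (t * z + (p^-1 - s `^ p) * `|z| `^ p) * density p z)%:E
    = (K^-1 * mgf p (s `^ p) t)%:E)%E.
  rewrite EFinM EFin_mgf// -integralZl//; last exact: tilt_integrable.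
  apply: eq_integral => z _; rewrite densityE -EFinM mulrCA -expRD.
  by congr (_ * expR _)%:E; ring.
have := mgf_scale hp (t / s) ltr01 s0.
rewrite mul1r divfK ?gt_eqF// => ->.
have m0 : 0 < mgf p 1 (t / s) by exact: mgf_gt0.
rewrite lne_EFin ?mulr_gt0 ?invr_gt0//; congr EFin.
rewrite lnM ?posrE ?mulr_gt0 ?invr_gt0// lnV// lnM ?posrE ?invr_gt0// lnV//.
by rewrite psi.unlock; ring.
Qed.

(** The weight then outgrows the density: on the half-line where [t z >= 0] the integrand is at
    least the constant [K^-1]. *)
Lemma Lambda_bar_infty (t c : R) : p^-1 <= c -> Lambda_bar p t c = +oo%E.
Proof.
move=> pc; rewrite /Lambda_bar.
have mf : measurable_fun setT (fun z : measurableTypeR R =>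
    (expR (t * z + c * `|z| `^ p) * density p z)%:E).
  apply/measurable_EFinP; apply: measurable_funM.
    apply: measurableT_comp => //; apply: measurable_funD => //.
    by apply: measurable_funM => //; exact: measurable_norm_powR.
  rewrite (_ : density p = fun z => K^-1 * expR (- (p^-1 * `|z| `^ p))); last first.
    by apply/funext => z; rewrite densityE.
  apply: measurable_funM => //; apply: measurableT_comp => //.
  apply: measurableT_comp => //; apply: measurable_funM => //.
  exact: measurable_norm_powR.
suff -> : (\int[mu]_z (expR (t * z + c * `|z| `^ p) * density p z)%:E = +oo)%E by [].
have H (n : nat) : (((K^-1) * n%:R)%:E <=
    \int[mu]_z (expR (t * z + c * `|z| `^ p) * density p z)%:E)%E.
  pose I : interval R := if 0 <= t then `[0, n%:R] else `[- n%:R, 0].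
  pose D : set (measurableTypeR R) := [set` I].
  have mD : measurable D by exact: measurable_itv.
  have muD : mu D = n%:R%:E.
    rewrite /D /I; have [->|n0] := posnP n.
      by case: ifPn => _; rewrite lebesgue_measure_itv/= lte_fin ?oppr0 ltxx.
    have n0' : 0 < n%:R :> R by rewrite ltr0n.
    case: ifPn => _; rewrite lebesgue_measure_itv/= lte_fin ?oppr_lt0 n0' -EFinD.
      by rewrite subr0.
    by rewrite sub0r opprK.
  apply: (@le_trans _ _ (\int[mu]_(z in D) (K^-1)%:E)%E).
    by rewrite integral_cst//= muD -EFinM.
  apply: (@le_trans _ _ (\int[mu]_(z in D) (expR (t * z + c * `|z| `^ p) * density p z)%:E)%E).
    apply: ge0_le_integral => //.
    - by move=> z _; rewrite lee_fin invr_ge0 ltW.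
    - exact: measurable_funTS.
    - move=> z Dz; rewrite lee_fin densityE mulrCA -expRD ler_peMr ?invr_ge0 ?(ltW K0)//.
      rewrite -expR0 ler_expR.
      have tz : 0 <= t * z.
        have [t0|t0] := boolP (0 <= t).
          by move: Dz; rewrite /D /I t0 /= in_itv/= => /andP[z1 _]; exact: mulr_ge0.
        move: Dz; rewrite /D /I (negbTE t0) /= in_itv/= => /andP[_ z1].
        by rewrite -ltNge in t0; apply: mulr_le0 => //; exact: ltW.
      by have := ler_wpM2r (powR_ge0 `|z| p) pc; lra.
  apply: ge0_subset_integral => //.
  by move=> z _; rewrite lee_fin mulr_ge0 ?expR_ge0// densityE mulr_ge0 ?expR_ge0 ?invr_ge0 ?ltW.
apply/eqyP => a a0.
have [n an] : exists n : nat, K * a <= n%:R.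
  by exists (Num.bound (K * a)); rewrite ltW// (le_lt_trans _ (archi_boundP _))// mulr_ge0// ltW.
apply: le_trans (H n); rewrite lee_fin mulrC ler_pdivlMr//.
by rewrite mulrC.
Qed.

Lemma ge0_integral_gauss (f : measurableTypeR R -> \bar R) i :
  measurable_fun setT f -> (forall z, 0 <= f z)%E ->
  (\int[Q]_x f (g i x) = \int[N]_z f z)%E.
Proof.
move=> mf f0.
have mF : measurable_fun setT (fun t : unit * measurableTypeR R => f t.2).
  exact: measurableT_comp.
rewrite (@integral_other _ _ _ Q g g_iid i _ unit (cst tt) _ _ mF)//.
  transitivity (\int[Q]_x cst (\int[N]_z f z)%E x)%E; first exact: eq_integral.
  by rewrite integral_cst//= probability_setT mule1.
Qed.

Lemma integral_normal_psiB (a : R) :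
  (\int[N]_z (psi p (a * z) - psi p 0)%:E = (phi p a - psi p 0)%:E)%E.
Proof.
under eq_integral do rewrite EFinB.
rewrite integralB//=; last 2 first.
- exact: psi_integrable.
- exact: finite_measure_integrable_cst.
by rewrite -EFin_phi// integral_cst//= probability_setT mule1 EFinB.
Qed.

Lemma measurable_psiB (a : R) :
  measurable_fun setT (fun z : measurableTypeR R => (psi p (a * z) - psi p 0)%:E).
Proof.
apply/measurable_EFinP; apply: measurable_funB => //; exact: measurable_psiM.
Qed.

Lemma integral_psi_gauss (a k : R) i :
  (\int[Q]_x (psi p (a * g i x) + k)%:E = (phi p a + k)%:E)%E.
Proof.
have -> : (\int[Q]_x (psi p (a * g i x) + k)%:E =
   \int[Q]_x ((psi p (a * g i x) - psi p 0) + (psi p 0 + k))%:E)%E.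
  by apply: eq_integral => x _; congr EFin; ring.
rewrite ge0_integral_addr; last 2 first.
- apply: measurable_funB => //; exact: (measurableT_comp (measurable_psiM hp a)).
- by move=> x; rewrite subr_ge0 psi_ge0.
have H := ge0_integral_gauss i (measurable_psiB a).
rewrite H; last by move=> z; rewrite lee_fin subr_ge0 psi_ge0.
by rewrite integral_normal_psiB -EFinD; congr EFin; ring.
Qed.

Lemma half_le (x : R) (J : \bar R) : (0 <= J)%E -> (x%:E + x%:E <= J + J)%E -> (x%:E <= J)%E.
Proof.
case: J => [r _|_ _|//]; last by rewrite leey.
by rewrite -!EFinD !lee_fin; lra.
Qed.

(* Flipping the sign of [z] does not change the integral, and [psi] is even and
   midpoint convex: shifting the Gaussian can only increase the mean. *)
Lemma integral_psi_shift (a y : R) :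
  ((phi p a - psi p 0)%:E <= \int[N]_z (psi p (a * z + y) - psi p 0)%:E)%E.
Proof.
have m (c : R) : measurable_fun setT (fun z : measurableTypeR R =>
    (psi p (c * z + y) - psi p 0)%:E).
  apply/measurable_EFinP; apply: measurable_funB => //.
  apply: (measurableT_comp (measurable_psi hp)).
  by apply: (@measurable_funD _ (measurableTypeR R)).
have n0 (c : R) : forall z : measurableTypeR R, (0 <= (psi p (c * z + y) - psi p 0)%:E)%E.
  by move=> z; rewrite lee_fin subr_ge0 psi_ge0.
rewrite -integral_normal_psiB.
suff : (\int[N]_z (psi p (a * z) - psi p 0)%:E + \int[N]_z (psi p (a * z) - psi p 0)%:E <=
    \int[N]_z (psi p (a * z + y) - psi p 0)%:E + \int[N]_z (psi p (a * z + y) - psi p 0)%:E)%E.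
  rewrite integral_normal_psiB; apply: half_le.
  exact: integral_ge0.
rewrite -[X in (_ <= _ + X)%E](ge0_integral_normal_opp (m a) (n0 a)).
rewrite -ge0_integralD//; last 4 first.
- by move=> z _; rewrite lee_fin subr_ge0 psi_ge0.
- exact: measurable_psiB.
- by move=> z _; rewrite lee_fin subr_ge0 psi_ge0.
- exact: measurable_psiB.
have mN : measurable_fun setT (fun z : measurableTypeR R => (psi p (a * - z + y) - psi p 0)%:E).
  by under eq_fun do rewrite mulrN -mulNr; exact: m.
rewrite -ge0_integralD//.
apply: ge0_le_integral => //.
- by move=> z _; rewrite adde_ge0// lee_fin subr_ge0 psi_ge0.
- by apply: emeasurable_funD; exact: measurable_psiB.
- exact: emeasurable_funD.
- move=> z _; rewrite -!EFinD lee_fin.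
  have := psi_midpoint hp (a * z) y.
  rewrite -(psiN hp (a * z - y)) opprB addrC [y - _]addrC -mulrN.
  move: (psi p _) (psi p _) (psi p _) (psi p _) => *; lra.
Qed.

(** Relative to [g 1], the argument [<u, g> + b g_0] is [u_0 g_1] plus an independent shift.
    Integrating out [g 1] first, [integral_psi_shift] discards the shift. *)
Lemma Lambda_ge (u : nat -> R) (b c s : R) : ell2 u -> 0 < s -> c = p^-1 - s `^ p ->
  ((phi p (u 0%N / s) - ln s - ln K)%:E <= Lambda g p u b c)%E.
Proof.
move=> u2 s0 cE; rewrite /Lambda.
set k := - ln s - ln K.
have [Z [mZ Z0 nZ]] := ae_cvg_series g_iid u2.
pose tail n x := (\sum_(1 <= i < n) u i * g i.+1 x)%:E.
have mtail n : @measurable_fun _ _ (other_space g 1) _ setT (tail n).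
  apply/measurable_EFinP.
  rewrite (_ : (fun x => _) = fun x => \sum_(i < n) (if (0 < i)%N then u i * g i.+1 x else 0)).
    apply: measurable_sum => i; have [i0|i0] := posnP i.
      exact: measurable_cst.
    apply: measurable_funM; first exact: measurable_cst.
    by apply: measurable_other_g; rewrite eqSS -lt0n.
  apply/funext => x; rewrite -(big_mkord xpredT (fun i => if (0 < i)%N then u i * g i.+1 x else 0)).
  case: n => [|n]; first by rewrite !big_geq.
  by rewrite big_nat_recl//= add0r big_add1.
(* A limit superior is measurable everywhere and visibly does not involve [g 1]; off the null set
   [Z] it is the tail of the series. *)
pose L x := limn_esup (tail ^~ x).
pose Y x := (fine (L x) + b * g 0%N x) / s.
have mY : @measurable_fun _ _ (other_space g 1) R setT Y.
  apply: measurable_funM; last exact: measurable_cst.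
  apply: measurable_funD.
    apply: measurableT_comp; first exact: fine_measurable.
    exact: measurable_fun_limn_esup.
  apply: measurable_funM; first exact: measurable_cst.
  exact: measurable_other_g.
have Lx x : ~ Z x -> inner u (fun i => g i.+1 x) = u 0%N * g 1%N x + fine (L x).
  move=> nZx; have cx : cvgn (series (fun i => u i * g i.+1 x)).
    by apply: contrapT => h; apply: nZx; exact: nZ.
  set l := inner u _.
  have ctail : tail ^~ x @ \oo --> (l - u 0%N * g 1%N x)%:E.
    apply: cvg_EFin; first exact: nearW.
    have : (fun n => series (fun i => u i * g i.+1 x) n - u 0%N * g 1%N x) @ \oo -->
        l - u 0%N * g 1%N x.
      by apply: cvgB => //; exact: cvg_cst.
    apply: cvg_trans; apply: near_eq_cvg; exists 1%N => // -[//|n] _ /=.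
    by rewrite /series/= big_nat_recl//= addrAC subrr add0r big_add1.
  rewrite /L is_cvg_limn_esupE; last by apply/cvg_ex; eexists; exact: ctail.
  by rewrite (cvg_lim _ ctail)//= addrC subrK.
have mYT := other_mfun mY.
pose h x := psi p (u 0%N / s * g 1%N x + Y x) - psi p 0.
have mh : measurable_fun setT h.
  apply: measurable_funB => //; apply: (measurableT_comp (measurable_psi hp)).
  by apply: measurable_funD => //; apply: measurable_funM.
have h0 x : 0 <= h x by rewrite subr_ge0 psi_ge0.
(* On [Z] the value of [inner] is uncontrolled, and only [psi 0 <= psi] is used there. *)
apply: (@le_trans _ _ (\int[Q]_x (h x * \1_(~` Z) x + (psi p 0 + k))%:E)%E); last first.
  apply: integral_mono => x; rewrite (Lambda_barE _ s0 cE) lee_fin indicE.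
  have [xZ|xZ] := pselect (Z x).
    rewrite memNset ?mulr0 ?add0r; last by move=> /(_ xZ).
    by rewrite lerD2r psi_ge0.
  rewrite mem_set// mulr1 /h addrA subrK Lx// /Y.
  rewrite [X in psi p X + _ <= _](_ : _ = (u 0%N * g 1%N x + fine (L x) + b * g 0%N x) / s)//.
  by ring.
rewrite ge0_integral_addr; last 2 first.
- by apply: measurable_funM => //; apply: measurable_indic; exact: measurableC.
- by move=> x; rewrite mulr_ge0.
have -> : (\int[Q]_x (h x * \1_(~` Z) x)%:E = \int[Q]_x (h x)%:E)%E.
  apply: ge0_ae_eq_integral => //.
  - apply/measurable_EFinP; apply: measurable_funM => //; apply: measurable_indic.
    exact: measurableC.
  - exact/measurable_EFinP.
  - by move=> x _; rewrite lee_fin mulr_ge0.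
  - by move=> x _; rewrite lee_fin.
  exists Z; split => // x /=; apply: contra_notP => xZ _.
  by rewrite indicE mem_set// mulr1.
pose F (t : R * measurableTypeR R) : \bar R := (psi p (u 0%N / s * t.2 + t.1) - psi p 0)%:E.
have mF : measurable_fun setT F.
  apply/measurable_EFinP; apply: measurable_funB => //.
  apply: (measurableT_comp (measurable_psi hp)).
  by apply: measurable_funD => //; apply: measurable_funM.
rewrite -[X in (_ <= X + _)%E]/(\int[Q]_x F (Y x, g 1%N x))%E.
rewrite (integral_other g_iid mY mF); last by move=> t; rewrite lee_fin subr_ge0 psi_ge0.
apply: (@le_trans _ _ (\int[Q]_x (cst (phi p (u 0%N / s) - psi p 0)%:E x) + (psi p 0 + k)%:E)%E).
  rewrite integral_cst//= probability_setT mule1 -EFinD lee_fin /k.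
  by move: (phi p _) => ?; lra.
by rewrite leeD2r//; apply: integral_mono => x; exact: integral_psi_shift.
Qed.

Lemma inner_single (u w : nat -> R) : (forall i, (0 < i)%N -> u i * w i = 0) ->
  inner u w = u 0%N * w 0%N.
Proof.
move=> uw; apply/cvg_lim => //; apply: cvg_near_cst; exists 1%N => // -[//|n] _ /=.
by rewrite /series/= big_nat_recl//= big1 ?addr0// => i _; rewrite uw.
Qed.

Lemma Lambda_single (a c s : R) : 0 < s -> c = p^-1 - s `^ p ->
  Lambda g p (fun i => if i == 0%N then a else 0) 0 c =
  (phi p (a / s) - ln s - ln K)%:E.
Proof.
move=> s0 cE; rewrite /Lambda -addrA -(integral_psi_gauss (a / s) (- ln s - ln K) 1).
apply: eq_integral => x _; rewrite (Lambda_barE _ s0 cE) inner_single/=.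
  by rewrite mul0r addr0 mulrAC.
by case=> // i _; rewrite mul0r.
Qed.

Lemma ell2_single (a : R) : ell2 (fun i => if i == 0%N then a else 0).
Proof.
apply/cvg_ex; exists (a ^+ 2); apply: cvg_near_cst; exists 1%N => // -[//|n] _ /=.
by rewrite /series/= big_nat_recl//= big1 ?addr0// => i _; rewrite expr0n.
Qed.

End rate_identity.

Section rate_maxE.
Context {R : realType} {d : measure_display} {O : measurableType d}.
Variables (Q : probability O R) (g : nat -> {RV Q >-> R}).
Hypothesis g_iid : iid_standard_gaussian g.
Variables (p : R) (hp : 2 <= p).

Let p0 : 0 < p. Proof. by rewrite (lt_le_trans _ hp). Qed.

Let single (a : R) (i : nat) := if i == 0%N then a else 0.

(** A vector carried by the first coordinate has norm [r / rho], which leaves zero under the square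
    root. *)
Lemma rate_I_single (r s : R) : 0 <= r -> 0 < s ->
  rate_I g p (fun i => single r i / rho p s) (r / rho p s) s =
  Lambda_star g p (single (r / rho p s)) 0 s.
Proof.
move=> r0 s0; set a := r / rho p s.
have -> : (fun i => single r i / rho p s) = single a.
  by apply/funext => -[|i]; rewrite /single//= mul0r.
rewrite /rate_I /ell2_norm inner_single; last by case=> // i _; rewrite /single/= mul0r.
have -> : single a 0 * single a 0 = a ^+ 2 by rewrite expr2.
by rewrite sqr_sqrtr ?sqr_ge0// subrr sqrtr0.
Qed.

Lemma Lambda_infty (u : nat -> R) (b c : R) : p^-1 <= c -> Lambda g p u b c = +oo%E.
Proof.
move=> pc; rewrite /Lambda.
transitivity (\int[Q]_x cst +oo x)%E.
  by apply: eq_integral => x _; rewrite Lambda_bar_infty.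
by rewrite integral_cst//= probability_setT mule1.
Qed.

Lemma Lambda_star_le (r : R) : (Lambda_star g p (single r) 0 1 <= tilt_rate p r)%E.
Proof.
apply: ge_ereal_sup => _ [u [b [c [u2 ->]]]].
rewrite inner_single; last by case=> // i _; rewrite /single/= mulr0.
rewrite /single/= mulr0 addr0 mulr1.
have [pc|cp] := lerP p^-1 c; first by rewrite Lambda_infty// leNye.
have c0 : 0 < p^-1 - c by rewrite subr_gt0.
pose s := (p^-1 - c) `^ p^-1.
have s0 : 0 < s by rewrite powR_gt0.
have sp : s `^ p = p^-1 - c by rewrite -powRrM mulVf ?gt_eqF// powRr1// ltW.
have cE : c = p^-1 - s `^ p by rewrite sp; ring.
apply: (@le_trans _ _ (tilt_gain p r (u 0%N / s) s)%:E); last first.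
  by apply: ereal_sup_ubound; exists (u 0%N / s), s.
have := Lambda_ge g_iid hp b u2 s0 cE.
rewrite ln_normalization//.
case: (Lambda g p u b c) => [l| |] //; rewrite ?leNye// => h.
rewrite lee_fin in h; rewrite -EFinB lee_fin.
rewrite /tilt_gain divfK ?gt_eqF// sp /kappa.
move: (phi p _) (ln s) (ln p / p) (psi p 0) h => *; lra.
Qed.

(** Rescaling the tilt by [q = rho s] turns the functional at [s] into the one at 1 plus
    [(s - 1 - ln s) / p], which is nonnegative. So no [s] does better than [s = 1]. *)
Lemma Lambda_star_ge (r s : R) : 0 < s ->
  (tilt_rate p r <= Lambda_star g p (single (r / rho p s)) 0 s)%E.
Proof.
move=> s0; apply: ge_ereal_sup => _ [v [t [t0 ->]]].
pose q := s `^ (- p^-1).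
have q0 : 0 < q by rewrite powR_gt0.
have qp : q `^ p = s^-1 by rewrite -powRrM mulNr mulVf ?gt_eqF// powR_inv1// ltW.
pose t' := t * q; have t'0 : 0 < t' by rewrite mulr_gt0.
pose c := p^-1 - t' `^ p.
apply: (@le_trans _ _ (v * t' * (r / q) + 0 * 0 + c * s -
    (phi p (v * t' / t') - ln t' - ln (mgf p p^-1 0)))%:E); last first.
  apply: ereal_sup_ubound; exists (single (v * t')), 0, c; split; first exact: ell2_single.
  rewrite inner_single; last by case=> // i _; rewrite /single/= mul0r.
  by rewrite (Lambda_single g_iid hp _ t'0 erefl).
rewrite lee_fin ln_normalization// mulfK ?gt_eqF//.
have -> : ln t' = ln t - ln s / p.
  by rewrite /t' lnM ?posrE// /q ln_powR; congr (_ + _); rewrite mulNr mulrC.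
have -> : v * t' * (r / q) = v * t * r by rewrite /t'; field; rewrite gt_eqF.
have -> : c * s = s / p - t `^ p.
  rewrite /c /t' powRM ?ltW// qp mulrBl; congr (_ - _); first by rewrite mulrC.
  by rewrite mulfVK// gt_eqF.
have : p^-1 * (1 + ln s) <= p^-1 * s.
  rewrite ler_wpM2l ?invr_ge0 ?(ltW p0)//.
  have := le_ln1Dx (_ : -1 < s - 1); rewrite ltrBrDl subrr => /(_ s0).
  by rewrite addrC subrK; lra.
rewrite /tilt_gain /kappa mulrDr mulr1 [p^-1 * ln s]mulrC [p^-1 * s]mulrC.
by move: (phi p v) (psi p 0) (ln p / p) (ln s / p) (s / p) (ln t) (t `^ p) (p^-1) (v * t * r) =>
    *; lra.
Qed.

Lemma rate_maxE (r : R) : 0 <= r -> rate_max g p r = tilt_rate p r.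
Proof.
move=> r0; rewrite /rate_max r0 /rate_cal_I; apply/eqP; rewrite eq_le; apply/andP; split.
  apply: (@le_trans _ _ (Lambda_star g p (single r) 0 1)); last exact: Lambda_star_le.
  apply: ereal_inf_lbound; exists 1 => //=.
  rewrite -/(single r) (@rate_I_single r 1)//.
  by rewrite /rho powR1 divr1.
apply: le_ereal_inf_tmp => _ [s /= s0 <-].
rewrite -/(single r) (@rate_I_single r s)//.
exact: Lambda_star_ge.
Qed.

End rate_maxE.

(** * Critical points and compactness of sublevel sets *)

Section rate_properties.
Context {R : realType}.
Variables (p : R) (hp : 2 <= p).

Let p0 : 0 < p. Proof. by rewrite (lt_le_trans _ hp). Qed.

Let s1 := p `^ (- p^-1).

Let s1_gt0 : 0 < s1. Proof. by rewrite powR_gt0. Qed.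

Let s1p : s1 `^ p = p^-1.
Proof. by rewrite -powRrM mulNr mulVf ?gt_eqF// powR_inv1// ltW. Qed.

Lemma tilt_gain_le (r v s : R) : 0 < s -> ((tilt_gain p r v s)%:E <= tilt_rate p r)%E.
Proof. by move=> s0; apply: ereal_sup_ubound; exists v, s. Qed.

Lemma tilt_rate_ge0 (r : R) : (0 <= tilt_rate p r)%E.
Proof.
apply: le_trans (tilt_gain_le r 0 s1_gt0).
rewrite lee_fin /tilt_gain s1p /s1 ln_powR phi0// /kappa.
by rewrite le_eqVlt; apply/orP; left; apply/eqP; field; rewrite gt_eqF.
Qed.

Lemma tilt_gain_mono (r1 r2 v s : R) : 0 <= v -> 0 < s -> r1 <= r2 ->
  tilt_gain p r1 v s <= tilt_gain p r2 v s.
Proof.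
move=> v0 s0 r12; rewrite /tilt_gain !lerD2r ler_wpM2l//.
by rewrite mulr_ge0// ltW.
Qed.

(** When [v] is critical for [r1], the derivative in [v] of the gain at [r2] is [s (r2 - r1)], which
    is not zero, so [v] is not optimal there. The strict gap makes overshooting negligible in
    [max_lower]. *)
Lemma tilt_gain_strict (r1 r2 v s : R) : 0 <= v -> 0 < s -> r1 < r2 ->
  dphi p v = s * r1 -> ((tilt_gain p r1 v s)%:E < tilt_rate p r2)%E.
Proof.
move=> v0 s0 r12 dv.
have [w hw] : exists w, tilt_gain p r2 v s < tilt_gain p r2 w s.
  apply: contrapT => /forallNP h.
  have h' w : w * s * r2 - phi p w <= v * s * r2 - phi p v.
    by have := h w => /negP; rewrite -leNgt /tilt_gain; lra.
  have D : is_derive v (1 : R) (fun w => w * s * r2 - phi p w) (s * r2 - dphi p v).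
    have := is_derive_phi hp v => D1.
    have D2 : is_derive v (1 : R) (fun w : R => w * s * r2) (s * r2).
      rewrite (_ : (fun w : R => w * s * r2) = (fun w : R => w * (s * r2))).
        apply: is_derive_eq; rewrite scaler0 add0r; exact: mulr1.
      by apply/funext => w; rewrite mulrA.
    exact: is_deriveB.
  have : is_derive v (1 : R) (fun w => w * s * r2 - phi p w) 0.
    apply: (@derive1_at_max _ _ (v - 1) (v + 1)).
    - by rewrite lerBlDr -addrA lerDl; lra.
    - move=> t _; apply: derivableB.
        by [].
      by case: (is_derive_phi hp t).
    - by rewrite in_itv/=; apply/andP; split; lra.
    - by move=> t _; exact: h'.
  move=> [_ E0]; have [_ E1] := D; move: E1; rewrite E0 dv -mulrBr => /esym/eqP.
  by rewrite mulf_eq0 subr_eq0 (gt_eqF s0) (gt_eqF r12).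
apply: (@lt_le_trans _ _ (tilt_gain p r2 w s)%:E); last exact: tilt_gain_le.
rewrite lte_fin (le_lt_trans _ hw)// tilt_gain_mono// ltW//.
Qed.

Lemma exists_critical0 : exists v s : R,
  [/\ 0 <= v, 0 < s, dphi p v = s * 0 & p * s `^ p = v * s * 0 + 1].
Proof.
exists 0, s1; split => //; first by rewrite dphi0// mulr0.
by rewrite s1p mulr0 add0r mulfV// gt_eqF.
Qed.

(** The gain is maximised over [v] and [ln s]. Finiteness of the rate at a larger [r] gives
    coercivity: the gain at [r1] is at most a constant minus [v s (r - r1)]. *)
Lemma exists_critical (r1 r : R) : 0 < r1 -> r1 < r -> (tilt_rate p r < +oo)%E ->
  exists v s : R,
    [/\ 0 <= v, 0 < s, dphi p v = s * r1 & p * s `^ p = v * s * r1 + 1].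
Proof.
move=> r10 r1r rfin.
have Bfin : tilt_rate p r \is a fin_num by rewrite ge0_fin_numE// tilt_rate_ge0.
pose B := fine (tilt_rate p r).
have hB v s : 0 < s -> tilt_gain p r v s <= B.
  by move=> s0; rewrite -lee_fin fineK// tilt_gain_le.
(* With [s = exp y] the constraint [0 < s] disappears and the maximum is an interior one. *)
pose G (t : R * R) := t.1 * expR t.2 * r1 - expR (t.2 * p) + t.2 - phi p t.1 + kappa p.
have GE v y : G (v, y) = tilt_gain p r1 v (expR y).
  by rewrite /G /tilt_gain/= expRM expRK.
have c1 : continuous (fun t : R * R => t.1) by move=> t; exact: cvg_fst.
have c2 : continuous (fun t : R * R => t.2) by move=> t; exact: cvg_snd.
have ce : continuous (fun t : R * R => expR t.2).
  by move=> t; apply: continuous_comp; [exact: c2|exact: continuous_expR].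
have cep : continuous (fun t : R * R => expR (t.2 * p)).
  move=> t; apply: (@continuous_comp _ _ _ (fun t : R * R => t.2 * p)); last exact: continuous_expR.
  by apply: cvgM; [exact: c2|exact: cvg_cst].
have cphi : continuous (fun t : R * R => phi p t.1).
  by move=> t; apply: continuous_comp; [exact: c1|exact: continuous_phi].
have cG : continuous G.
  move=> t; apply: cvgD; last exact: cvg_cst.
  apply: cvgB; last exact: cphi.
  apply: cvgD; last exact: c2.
  apply: cvgB; last exact: cep.
  apply: cvgM; last exact: cvg_cst.
  by apply: cvgM; [exact: c1|exact: ce].
(* The region where [G] is at least its value at the origin is nonempty; for [v >= 0] it is shown to
   be bounded. *)
pose M0 := G (0, 0).
have rr : 0 < r - r1 by rewrite subr_gt0.
pose D := (B - M0) / (r - r1).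
have G_le v y : G (v, y) <= B - v * expR y * (r - r1).
  by rewrite GE; have := hB v (expR y) (expR_gt0 _); rewrite /tilt_gain; lra.
have D0 : 0 <= D.
  rewrite divr_ge0 ?(ltW rr)// subr_ge0.
  by have := G_le 0 0; rewrite !mul0r subr0.
have vyD v y : M0 <= G (v, y) -> v * expR y <= D.
  by move=> h; rewrite ler_pdivlMr// lerBrDr -lerBrDl (le_trans h)// G_le.
(* In that region [exp (p y) <= y + C]. Positivity of the exponential bounds [y] below, and
   [exp (p y) >= 1 + 2 y] for positive [y] bounds it above. *)
pose C := D * r1 - phi p 0 + kappa p - M0.
have yC v y : M0 <= G (v, y) -> `|y| <= `|C|.
  move=> h; have h1 := vyD _ _ h.
  have h2 : expR (y * p) <= y + C.
    have h3 : v * expR y * r1 <= D * r1 by rewrite ler_wpM2r// ltW.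
    have h4 := phi_ge0 hp v.
    by move: h; rewrite /C {1}/G/=; lra.
  have h3 := expR_ge0 (y * p); have h4 := ler_norm C.
  rewrite ler_norml; apply/andP; split; first lra.
  have [y0|y0] := lerP y 0; first exact: le_trans y0 (normr_ge0 _).
  have h5 := expR_ge1Dx (y * p).
  have h6 : y * 2 <= y * p by rewrite ler_wpM2l// ltW.
  lra.
pose V := D * expR `|C|.
have vV v y : 0 <= v -> M0 <= G (v, y) -> v <= V.
  move=> v0 h; have := vyD _ _ h; rewrite -ler_pdivlMr ?expR_gt0// => /le_trans; apply.
  rewrite ler_wpM2l// -expRN ler_expR lerNl.
  by have := yC _ _ h; rewrite ler_norml => /andP[].
pose A : set (R * R) := `[0, V] `*` `[- `|C|, `|C|].
have cA : compact A by apply: compact_setX; exact: segment_compact.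
have A00 : A (0, 0).
  split; rewrite /= in_itv/= ?lexx ?oppr_le0 ?normr_ge0//= mulr_ge0// expR_ge0.
have [[v y] /set_mem Avy Gmax] : exists2 c, c \in A & forall t, t \in A -> G t <= G c.
  apply: compact_EVT_max => //; first by exists (0, 0).
  exact: continuous_subspaceT.
have M0G : M0 <= G (v, y) by apply: Gmax; exact: mem_set.
(* The maximum over the compact is global: [phi] is even and [r1] positive, so passing from [w] to
   [|w|] cannot lower [G]. *)
have Gmax' w z : G (w, z) <= G (v, y).
  have [w0 wabs] : 0 <= `|w| /\ G (w, z) <= G (`|w|, z).
    split => //; rewrite /G/= !lerD2r lerB//.
      by rewrite !lerD2r ler_wpM2r ?(ltW r10)// ler_wpM2r ?expR_ge0// ler_norm.
    by have [w0|w0] := lerP 0 w; [rewrite ger0_norm|rewrite ltr0_norm// phiN].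
  apply: (le_trans wabs).
  have [h|h] := lerP M0 (G (`|w|, z)); last exact: le_trans (ltW h) M0G.
  apply: Gmax; apply: mem_set; split; rewrite /= in_itv/=.
    by rewrite w0 (vV _ _ w0 h).
  by rewrite -ler_norml (yC _ _ h).
exists v, (expR y); split.
- by case: Avy; rewrite /= in_itv/= => /andP[].
- exact: expR_gt0.
- have D1 : is_derive v (1 : R) (fun w => w * (expR y * r1) - phi p w) (expR y * r1 - dphi p v).
    have D1 := is_derive_phi hp v.
    have D2 : is_derive v (1 : R) (fun w : R => w * (expR y * r1)) (expR y * r1).
      apply: is_derive_eq; rewrite scaler0 add0r; exact: mulr1.
    exact: is_deriveB.
  have : is_derive v (1 : R) (fun w => w * (expR y * r1) - phi p w) 0.
    apply: (@derive1_at_max _ _ (v - 1) (v + 1)).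
    - by rewrite lerBlDr -addrA lerDl; lra.
    - move=> t _; apply: derivableB; first by [].
      by case: (is_derive_phi hp t).
    - by rewrite in_itv/=; apply/andP; split; lra.
    - by move=> t _; have := Gmax' t y; rewrite /G/=; lra.
  move=> [_ E0]; have [_ E1] := D1; move: E1; rewrite E0 => /esym/eqP.
  by rewrite subr_eq0 => /eqP.
- pose f (z : R) := v * r1 * expR z - expR (z * p) + z.
  have D1 (z : R) : is_derive z (1 : R) f (v * r1 * expR z - p * expR (z * p) + 1).
    have D2 : is_derive z (1 : R) (fun z => expR (z * p)) (p * expR (z * p)).
      have h1 : is_derive z (1 : R) (fun z : R => z * p) p.
        apply: is_derive_eq; rewrite scaler0 add0r; exact: mulr1.
      have := @is_derive1_comp _ expR (fun z : R => z * p) z _ _ (is_derive_expR _) h1.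
      by rewrite mulrC.
    have D3 : is_derive z (1 : R) (fun z => v * r1 * expR z) (v * r1 * expR z).
      exact: (is_deriveZ (v * r1) (is_derive_expR z)).
    by apply: is_deriveD.
  have : is_derive y (1 : R) f 0.
    apply: (@derive1_at_max _ _ (y - 1) (y + 1)).
    - by rewrite lerBlDr -addrA lerDl; lra.
    - by move=> t _; case: (D1 t).
    - by rewrite in_itv/=; apply/andP; split; lra.
    - by move=> t _; have := Gmax' v t; rewrite /G /f/=;
      move: (expR t) (expR y) (expR (t * p)) (expR (y * p)) => e1 e2 e3 e4; lra.
  move=> [_ E0]; have [_ E1] := D1 y; move: E1; rewrite E0 -expRM => h.
  by move: (expR y) (expR (y * p)) h => e1 e2 h; lra.
Qed.

(** The rate is a supremum of functions affine in [r], whence closedness; the single tilt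
    [v = s = 1] already bounds [r]. *)
Lemma tilt_rate_compact (alpha : R) :
  compact [set r : R | 0 <= r /\ (tilt_rate p r <= alpha%:E)%E].
Proof.
set S := [set r | _].
have E : S = [set r | 0 <= r] `&`
    \bigcap_(t in [set t : R * R | 0 < t.2]) [set r | tilt_gain p r t.1 t.2 <= alpha].
  apply/seteqP; split => r /=.
    move=> [r0 ra]; split => //.
    move=> [v s] /= s0; rewrite -lee_fin; exact: le_trans (tilt_gain_le _ _ s0) ra.
  move=> [r0 h]; split => //.
  by apply: ge_ereal_sup => _ [v [s [s0 ->]]]; rewrite lee_fin; exact: (h (v, s)).
have cS : closed S.
  rewrite E; apply: closedI; first exact: closed_ge.
  apply: closed_bigI => -[v s] _.
  rewrite (_ : [set _ | _] = (fun r => tilt_gain p r v s) @^-1` [set x | x <= alpha])//.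
  apply: closed_comp; last exact: closed_le.
  move=> r _; apply: cvgD; last exact: cvg_cst.
  apply: cvgB; last exact: cvg_cst.
  apply: cvgD; last exact: cvg_cst.
  apply: cvgB; last exact: cvg_cst.
  by apply: cvgM => //; exact: cvg_cst.
apply: (@subclosed_compact _ _ `[0, alpha + 1 + phi p 1 - kappa p]) => //.
  exact: segment_compact.
move=> r [r0 ra] /=; rewrite in_itv/= r0/=.
have := le_trans (tilt_gain_le r 1 ltr01) ra.
rewrite lee_fin /tilt_gain powR1 ln1 !mul1r; lra.
Qed.

End rate_properties.

(** * Volumes of slices of the l^p ball *)

Section slices.
Context {R : realType}.
Local Notation mu := (@lebesgue_measure R).
Local Notation T2 := (measurableTypeR R * measurableTypeR R)%type.
Variables (p : R) (hp : 2 <= p).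

(* The integral over [x] in R^n of [f (t.1 + sum_i th i * x_i, t.2 + sum_i |x_i|^p)]. *)
Fixpoint slice_integral (n : nat) (th : nat -> R) (f : T2 -> \bar R) (t : T2) : \bar R :=
  if n is m.+1 then
    (\int[mu]_x slice_integral m (fun i => th i.+1) f
                  (t.1 + th 0%N * x, t.2 + `|x| `^ p)%R)%E
  else f t.

Local Notation J := slice_integral.

Lemma slice_ge0 n th f t : (forall t, 0 <= f t)%E -> (0 <= J n th f t)%E.
Proof.
by elim: n th t => [|n IH] th t f0 //=; apply: integral_ge0 => x _; exact: IH.
Qed.

Lemma measurable_slice_step (a : R) : measurable_fun setT
  (fun tx : T2 * measurableTypeR R => (tx.1.1 + a * tx.2, tx.1.2 + `|tx.2| `^ p) : T2).
Proof.
apply: measurable_fun_pair.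
  apply: (@measurable_funD _ _ R _ (fun tx : T2 * measurableTypeR R => tx.1.1)).
    exact: (measurableT_comp measurable_fst measurable_fst).
  by apply: measurable_funM => //; exact: measurable_snd.
apply: (@measurable_funD _ _ R _ (fun tx : T2 * measurableTypeR R => tx.1.2)).
  exact: (measurableT_comp measurable_snd measurable_fst).
exact: (measurableT_comp (measurable_norm_powR p) measurable_snd).
Qed.

Lemma measurable_slice n th f : measurable_fun setT f -> (forall t, 0 <= f t)%E ->
  measurable_fun setT (J n th f).
Proof.
move=> mf f0; elim: n th => [|n IH] th //=.
pose F (tx : T2 * measurableTypeR R) :=
  J n (fun i => th i.+1) f (tx.1.1 + th 0%N * tx.2, tx.1.2 + `|tx.2| `^ p).
have mF : measurable_fun setT F.
  exact: (measurableT_comp (IH _) (measurable_slice_step _)).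
apply: (@measurable_fun_fubini_tonelli_F _ _ T2 (measurableTypeR R) R mu F mF).
by move=> tx; exact: slice_ge0.
Qed.

Lemma measurable_slice_x n th f (a : R) (t : T2) : measurable_fun setT f ->
  (forall t, 0 <= f t)%E ->
  measurable_fun setT (fun x : measurableTypeR R => J n th f (t.1 + a * x, t.2 + `|x| `^ p)).
Proof.
move=> mf f0.
have := measurable_slice_step a => /(measurableT_comp (measurable_slice n th mf f0)) h.
by apply: (measurableT_comp h (measurable_pair1 t)).
Qed.

Lemma slice_mono n th f h t : measurable_fun setT f -> measurable_fun setT h ->
  (forall t, 0 <= f t)%E -> (forall t, f t <= h t)%E -> (J n th f t <= J n th h t)%E.
Proof.
move=> mf mh f0 fh; have h0 t' : (0 <= h t')%E by exact: le_trans (fh t').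
elim: n th t => [|n IH] th t //=; apply: ge0_le_integral => //.
- by move=> x _; exact: slice_ge0.
- exact: measurable_slice_x.
- exact: measurable_slice_x.
Qed.

Lemma slice_add n th f h t : measurable_fun setT f -> measurable_fun setT h ->
  (forall t, 0 <= f t)%E -> (forall t, 0 <= h t)%E ->
  (J n th (fun t => f t + h t) t = J n th f t + J n th h t)%E.
Proof.
move=> mf mh f0 h0; elim: n th t => [|n IH] th t //=.
under eq_integral do rewrite IH.
rewrite ge0_integralD//.
- by move=> x _; exact: slice_ge0.
- exact: measurable_slice_x.
- by move=> x _; exact: slice_ge0.
- exact: measurable_slice_x.
Qed.

Lemma slice_scale n th f (k : R) t : measurable_fun setT f ->
  (forall t, 0 <= f t)%E -> 0 <= k ->
  (J n th (fun t => k%:E * f t) t = k%:E * J n th f t)%E.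
Proof.
move=> mf f0 k0; elim: n th t => [|n IH] th t //=.
under eq_integral do rewrite IH.
rewrite ge0_integralZl//.
- exact: measurable_slice_x.
- by move=> x _; exact: slice_ge0.
Qed.

Definition tilt_weight (u c : R) (t : T2) : \bar R := (expR (u * t.1 - c * t.2))%:E.

Lemma measurable_tilt_weight u c : measurable_fun setT (tilt_weight u c).
Proof.
apply/measurable_EFinP; apply: measurableT_comp => //; apply: measurable_funB.
  by apply: measurable_funM => //; exact: measurable_fst.
by apply: measurable_funM => //; exact: measurable_snd.
Qed.

Lemma tilt_weight_ge0 u c t : (0 <= tilt_weight u c t)%E.
Proof. by rewrite lee_fin expR_ge0. Qed.

(** Exponentials of the pair factor over the coordinates, so the iterated integral is a product of
    one-dimensional transforms. *)
Lemma slice_tilt_weight n th u c t : 0 < c ->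
  J n th (tilt_weight u c) t =
  (expR (u * t.1 - c * t.2) * \prod_(i < n) mgf p c (u * th i))%:E.
Proof.
move=> c0; elim: n th t => [|n IH] th t /=; first by rewrite big_ord0 mulr1.
rewrite (eq_integral (fun x : measurableTypeR R =>
   (expR (u * t.1 - c * t.2) * \prod_(i < n) mgf p c (u * th i.+1))%:E *
   (expR (u * th 0%N * x - c * `|x| `^ p))%:E)%E); last first.
  move=> x _; rewrite IH/= -EFinM; congr EFin; rewrite mulrAC -expRD.
  by congr (expR _ * _); ring.
rewrite integralZl//; last exact: tilt_integrable.
rewrite -EFin_mgf// -EFinM big_ord_recl/=; congr EFin.
by rewrite mulrAC -mulrA.
Qed.

(** The offsets [a] and [b] make the induction work: fixing the first coordinate only moves them. *)
Lemma volume_slice n (th : nat -> R) (D : set T2) (a b : R) :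
  volume [set v : 'cV[R]_n | D (a + \sum_(i < n) th i * v i 0,
                               b + \sum_(i < n) `|v i 0| `^ p)] =
  J n th (fun t => (\1_D t)%:E) (a, b).
Proof.
elim: n th a b => [|n IH] th a b /=.
  by rewrite !indicE/=; congr ((_ _)%:R)%:E; apply/idP/idP; rewrite !inE/= !big_ord0 !addr0.
apply: eq_integral => x _ /=; rewrite -IH; congr volume; apply/seteqP.
have E0 (v : 'cV[R]_n) : col_mx (const_mx x : 'cV[R]_1) v ord0 0 = x.
  by rewrite (_ : ord0 = lshift n (ord0 : 'I_1)) ?col_mxEu ?mxE//; exact: val_inj.
have E1 (v : 'cV[R]_n) i : col_mx (const_mx x : 'cV[R]_1) v (lift ord0 i) 0 = v i 0.
  by rewrite (_ : lift ord0 i = rshift 1 i) ?col_mxEd//; exact: val_inj.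
have E (v : 'cV[R]_n) : (a + \sum_(i < n.+1) th i * col_mx (const_mx x : 'cV[R]_1) v i 0,
    b + \sum_(i < n.+1) `|col_mx (const_mx x : 'cV[R]_1) v i 0| `^ p) =
   (a + th 0%N * x + \sum_(i < n) th i.+1 * v i 0, b + `|x| `^ p + \sum_(i < n) `|v i 0| `^ p).
  rewrite !big_ord_recl E0 !addrA; congr (_ + _, _ + _); apply: eq_bigr => i _; by rewrite E1.
by split => v /=; rewrite E.
Qed.

End slices.

Section calculus.
Context {R : realType}.

Lemma derive_small (f : R -> R) (y d e : R) : is_derive y 1 f d -> 0 < e ->
  exists2 h0, 0 < h0 & forall h, `|h| < h0 -> `|f (y + h) - f y - h * d| <= e * `|h|.
Proof.
move=> D e0; have [/cvg_ex[l fl] dE] := D.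
have dl : d = l by rewrite -dE /derive; apply/cvg_lim.
move: fl; rewrite -dl => /cvgrPdist_le/(_ e e0)[h0 /= h00 H].
exists h0 => // h hh0; have [->|h1] := eqVneq h 0.
  by rewrite addr0 subrr mul0r subr0 !normr0 mulr0.
have := H h; rewrite /= sub0r normrN => /(_ hh0 h1).
rewrite -[h%:A]/(h * 1) mulr1 => H1.
have -> : f (y + h) - f y - h * d = - (h * (d - h^-1 *: (f (h + y) - f y))).
  by rewrite -[h^-1 *: _]/(h^-1 * _) mulrBr mulVKf// (addrC h y) opprB.
by rewrite normrN normrM mulrC ler_wpM2r.
Qed.

Lemma derive_lt0_right (f : R -> R) (y d : R) : is_derive y 1 f d -> d < 0 ->
  exists2 h, 0 < h & f (y + h) < f y.
Proof.
move=> D d0; have e0 : 0 < - d / 2 by lra.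
have [h0 h00 H] := derive_small D e0.
have h1 : `|h0 / 2| < h0 by rewrite ger0_norm; lra.
exists (h0 / 2); first lra.
have := H _ h1; rewrite (ger0_norm (_ : 0 <= h0 / 2)); last lra.
have : d * h0 < 0 by rewrite nmulr_rlt0.
by move: (f _) (f _) => a b dh /ler_normlP[_]; nra.
Qed.

Lemma derive_gt0_left (f : R -> R) (y d : R) : is_derive y 1 f d -> 0 < d ->
  exists2 h, 0 < h & f (y - h) < f y.
Proof.
move=> D d0; have e0 : 0 < d / 2 by lra.
have [h0 h00 H] := derive_small D e0.
have h1 : `|- (h0 / 2)| < h0 by rewrite normrN ger0_norm; lra.
exists (h0 / 2); first lra.
have := H _ h1; rewrite normrN (ger0_norm (_ : 0 <= h0 / 2)); last lra.
have : 0 < d * h0 by rewrite mulr_gt0.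
by move: (f _) (f _) => a b dh /ler_normlP[_]; nra.
Qed.

Lemma expR_rate_small (a : nat -> R) (l C : R) : a n @[n --> \oo] --> l -> l < 0 -> 0 < C ->
  \forall n \near \oo, expR (n.+1%:R * a n) <= C.
Proof.
move=> al l0 C0.
have l2 : l < l / 2 by lra.
near=> n.
have h1 : a n < l / 2 by near: n; exact: (cvgr_lt l).
have h2 : ln C / (l / 2) <= n%:R.
  by near: n; exact: nbhs_infty_ger.
rewrite -(lnK (_ : C \is Num.pos)) ?posrE// ler_expR.
apply: (@le_trans _ _ (n.+1%:R * (l / 2))).
  by rewrite ler_wpM2l// ltW.
rewrite -ler_ndivrMr; last by lra.
by rewrite (le_trans h2)// ler_nat.
Unshelve. all: by end_near. Qed.

End calculus.

(** * Chernoff bounds for slices *)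

Section volume_bounds.
Context {R : realType}.
Local Notation mu := (@lebesgue_measure R).
Local Notation T2 := (measurableTypeR R * measurableTypeR R)%type.
Variables (p : R) (hp : 2 <= p).

Let p0 : 0 < p. Proof. by rewrite (lt_le_trans _ hp). Qed.

Definition psi_mean (n : nat) (th : nat -> R) (v : R) : R :=
  n%:R^-1 * \sum_(i < n) psi p (v * th i).

Lemma prod_mgf n (th : nat -> R) (v s : R) : 0 < s -> (0 < n)%N ->
  \prod_(i < n) mgf p (s `^ p) (v * s * th i) =
  expR (n%:R * (psi_mean n th v - ln s)).
Proof.
move=> s0 n0.
rewrite mulrBr /psi_mean mulrA divff ?pnatr_eq0 -?lt0n// mul1r.
have -> : n%:R * ln s = \sum_(i < n) ln s by rewrite sumr_const card_ord mulr_natl.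
rewrite -sumrB expR_sum; apply: eq_bigr => i _.
have := mgf_scale hp (v * th i) ltr01 s0; rewrite mul1r mulrAC => ->.
rewrite psi.unlock expRB !lnK ?posrE ?mgf_gt0//.
by rewrite mulrC.
Qed.

(** On [D] the exponential weight is at least [exp (n K)], so the indicator is bounded by the weight
    divided by this number. *)
Lemma slice_chernoff n th (D : set T2) (K v s : R) : (0 < n)%N -> 0 < s -> measurable D ->
  (forall t, D t -> v * s * t.1 - s `^ p * t.2 >= n%:R * K) ->
  (slice_integral p n th (fun t => (\1_D t)%:E) (0, 0)%R <=
   (expR (n%:R * (psi_mean n th v - ln s - K)))%:E)%E.
Proof.
move=> n0 s0 mD DK.
have sp0 : 0 < s `^ p by rewrite powR_gt0.
have mw := measurable_tilt_weight (v * s) (s `^ p).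
have w0 := tilt_weight_ge0 (v * s) (s `^ p).
have kw0 t : (0 <= (expR (- (n%:R * K)))%:E * tilt_weight (v * s) (s `^ p) t)%E.
  by rewrite mule_ge0// lee_fin expR_ge0.
apply: (@le_trans _ _ (slice_integral p n th
   (fun t => (expR (- (n%:R * K)))%:E * tilt_weight (v * s) (s `^ p) t)%E (0, 0)%R)).
  apply: slice_mono => //.
  - by apply/measurable_EFinP; exact: measurable_indic.
  - exact: emeasurable_funM.
  - move=> t; rewrite indicE; have [Dt|Dt] := boolP (t \in D); last exact: kw0.
    rewrite /tilt_weight -EFinM lee_fin -expRD -[leLHS]expR0 ler_expR.
    by have := DK t (set_mem Dt); lra.
rewrite slice_scale ?expR_ge0// slice_tilt_weight// prod_mgf//.
by rewrite /= !mulr0 subrr expR0 mul1r -EFinM lee_fin -expRD ler_expR; lra.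
Qed.

(** Each triple [((v, s), K)] is a perturbed tilt with its threshold per coordinate; the sum is a
    Chernoff majorant of the tilted weight off the target. *)
Definition tilt_sum (N : R) (ks : seq (R * R * R)) (t : T2) : \bar R :=
  (\sum_(k <- ks) (expR (- (N * k.2)))%:E * tilt_weight (k.1.1 * k.1.2) (k.1.2 `^ p) t)%E.

Lemma measurable_tilt_sum N ks : measurable_fun setT (tilt_sum N ks).
Proof.
apply: emeasurable_sum => k; apply: emeasurable_funM => //.
exact: measurable_tilt_weight.
Qed.

Lemma tilt_sum_ge0 N ks t : (0 <= tilt_sum N ks t)%E.
Proof. by apply: sume_ge0 => k _; rewrite mule_ge0// lee_fin expR_ge0. Qed.

Lemma slice0 n (th : nat -> R) t : slice_integral p n th (cst 0%E) t = 0%E.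
Proof.
elim: n th t => [|n IH] th t //=.
by under eq_integral do rewrite IH; rewrite integral0.
Qed.

Lemma slice_tilt_sum n (th : nat -> R) (ks : seq (R * R * R)) : (0 < n)%N ->
  (forall k, k \in ks -> 0 < k.1.2) ->
  slice_integral p n th (tilt_sum n%:R ks) (0, 0)%R =
  (\sum_(k <- ks) expR (n%:R * (psi_mean n th k.1.1 - ln k.1.2 - k.2)))%:E.
Proof.
move=> n0; elim: ks => [|k ks IH] ks0.
  rewrite big_nil (_ : tilt_sum _ _ = cst 0%E) ?slice0//.
  by apply/funext => t; rewrite /tilt_sum big_nil.
have -> : tilt_sum n%:R (k :: ks) = (fun t => (fun t => (expR (- (n%:R * k.2)))%:E *
    tilt_weight (k.1.1 * k.1.2) (k.1.2 `^ p) t) t + tilt_sum n%:R ks t)%E.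
  by apply/funext => t; rewrite /tilt_sum big_cons.
have k0 : 0 < k.1.2 by apply: ks0; rewrite mem_head.
have mw := measurable_tilt_weight (k.1.1 * k.1.2) (k.1.2 `^ p).
rewrite slice_add//; last 4 first.
- exact: emeasurable_funM.
- exact: measurable_tilt_sum.
- by move=> t; rewrite mule_ge0// lee_fin expR_ge0.
- by move=> t; exact: tilt_sum_ge0.
have -> := slice_scale p n th (0, 0) mw (tilt_weight_ge0 _ _) (expR_ge0 (- (n%:R * k.2))).
rewrite slice_tilt_weight ?powR_gt0// prod_mgf//.
rewrite IH; last by move=> j jks; apply: ks0; rewrite inE jks orbT.
rewrite /= !mulr0 subrr expR0 mul1r -EFinM -EFinD big_cons -expRD.
by congr (expR _ + _)%:E; ring.
Qed.

(** The total tilted mass is split between [D], where the weight is at most [exp (n K0)], and the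
    ways of leaving [D], each paid by one perturbed tilt. Once the last sum is small, this bounds
    the slice over [D] from below. *)
Lemma slice_tilt_le n (th : nat -> R) (D : set T2) (v s K0 : R) (ks : seq (R * R * R)) :
  (0 < n)%N -> 0 < s -> measurable D -> (forall k, k \in ks -> 0 < k.1.2) ->
  (forall t : T2, (D t /\ v * s * t.1 - s `^ p * t.2 <= n%:R * K0) \/
     exists2 k, k \in ks &
       n%:R * k.2 <= (k.1.1 * k.1.2 - v * s) * t.1 - (k.1.2 `^ p - s `^ p) * t.2) ->
  ((expR (n%:R * (psi_mean n th v - ln s)))%:E <=
   (expR (n%:R * K0))%:E * slice_integral p n th (fun t => (\1_D t)%:E) (0, 0)%R +
   (\sum_(k <- ks) expR (n%:R * (psi_mean n th k.1.1 - ln k.1.2 - k.2)))%:E)%E.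
Proof.
move=> n0 s0 mD ks0 cover.
have mw := measurable_tilt_weight (v * s) (s `^ p).
have mE : measurable_fun setT (fun t : T2 => (\1_D t)%:E : \bar R).
  by apply/measurable_EFinP; exact: measurable_indic.
have sp0 : 0 < s `^ p by rewrite powR_gt0.
rewrite -prod_mgf// -slice_tilt_sum// -slice_scale ?expR_ge0//.
have h0 t : (0 <= (expR (n%:R * K0))%:E * (\1_D t)%:E)%E.
  by rewrite mule_ge0// lee_fin ?expR_ge0.
have mh : measurable_fun setT (fun t : T2 => (expR (n%:R * K0))%:E * (\1_D t)%:E)%E.
  exact: emeasurable_funM.
rewrite -(slice_add p n th (0, 0) mh (measurable_tilt_sum _ _) h0 (tilt_sum_ge0 _ _)).
have := slice_tilt_weight hp n th (v * s) (0, 0) sp0.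
rewrite /= !mulr0 subrr expR0 mul1r => <-.
apply: slice_mono => //.
- by apply: emeasurable_funD => //; exact: measurable_tilt_sum.
- by move=> t; exact: tilt_weight_ge0.
- move=> t; have [[Dt h]|[k kks h]] := cover t.
    rewrite indicE mem_set// mule1 (@le_trans _ _ (expR (n%:R * K0))%:E)//.
      by rewrite lee_fin ler_expR.
    by rewrite leeDl// tilt_sum_ge0.
  apply: (@le_trans _ _ (tilt_sum n%:R ks t)); last first.
    by rewrite leeDr// mule_ge0// lee_fin expR_ge0.
  rewrite /tilt_sum (big_rem k)//=.
  apply: (@le_trans _ _ ((expR (- (n%:R * k.2)))%:E * tilt_weight (k.1.1 * k.1.2) (k.1.2 `^ p)
      t)%E).
    by rewrite /tilt_weight -EFinM lee_fin -expRD ler_expR; move: h; lra.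
  by rewrite leeDl// sume_ge0// => j _; rewrite mule_ge0// lee_fin expR_ge0.
Qed.

End volume_bounds.

Section volume_lower_bound.
Context {R : realType}.
Local Notation T2 := (measurableTypeR R * measurableTypeR R)%type.
Variables (p : R) (hp : 2 <= p).

Let p0 : 0 < p. Proof. by rewrite (lt_le_trans _ hp). Qed.

Definition target (n : nat) (x e : R) : set T2 :=
  [set t | `|t.1 - n%:R * x| < n%:R * e /\ t.2 <= n%:R].

Lemma measurable_target n x e : measurable (target n x e).
Proof.
rewrite (_ : target n x e = [set t : T2 | `|t.1 - n%:R * x| < n%:R * e] `&` [set t : T2 | t.2 <=
    n%:R])//.
apply: measurableI; rewrite -[X in measurable X]setTI.
  apply: measurable_fun_ltr => //; apply: measurableT_comp => //.
  by apply: measurable_funB => //; exact: measurable_fst.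
by apply: measurable_fun_ler => //; exact: measurable_snd.
Qed.

(** With [z = ln s] and [v] fixed, this is the Chernoff exponent [b s^p - a s - ln s], up to a
    constant. *)
Lemma is_derive_expfun (a b y : R) :
  is_derive y 1 (fun z => b * expR (z * p) - a * expR z - z) (p * b * expR (y * p) - a * expR y -
      1).
Proof.
have D2 : is_derive y (1 : R) (fun z => expR (z * p)) (p * expR (y * p)).
  have h1 : is_derive y (1 : R) (fun z : R => z * p) p.
    apply: is_derive_eq; rewrite scaler0 add0r; exact: mulr1.
  have := @is_derive1_comp _ expR (fun z : R => z * p) y _ _ (is_derive_expR _) h1.
  by rewrite mulrC.
have D3 : is_derive y (1 : R) (fun z => a * expR z) (a * expR y).
  exact: (is_deriveZ a (is_derive_expR y)).
have D4 : is_derive y (1 : R) (fun z => b * expR (z * p)) (b * (p * expR (y * p))).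
  exact: (is_deriveZ b D2).
have -> : p * b * expR (y * p) = b * (p * expR (y * p)) by ring.
by apply: is_deriveB; apply: is_deriveB.
Qed.

(** The four tilts answer the four ways out: first coordinate too large or too small ([v] raised or
    lowered), second too large or too small ([s] lowered or raised). The target allows small second
    coordinates, but excluding them bounds the weight. Changing [s] also moves the coefficient of
    the first coordinate, so those two cases use the bounds already obtained on it. *)
Lemma target_cover n (t : T2) (v s x e e1 tau eta h1 h2 s3 s4 : R) :
  0 <= v -> 0 <= s -> 0 <= s `^ p -> e1 <= e -> tau + eta <= 1 ->
  s3 <= s -> s <= s4 -> s3 `^ p <= s `^ p -> s `^ p <= s4 `^ p -> 0 <= h1 -> 0 <= h2 ->
  (target n x e t /\ v * s * t.1 - s `^ p * t.2 <=
      n%:R * (v * s * (x + e1) - s `^ p * (tau - eta))) \/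
  exists2 k : R * R * R, k \in [:: ((v + h1, s), h1 * s * (x + e1));
      ((v - h2, s), - (h2 * s * (x - e1)));
      ((v, s3), - (v * (s - s3) * (x + e1)) + (s `^ p - s3 `^ p) * (tau + eta));
      ((v, s4), v * (s4 - s) * (x - e1) - (s4 `^ p - s `^ p) * (tau - eta))] &
    n%:R * k.2 <= (k.1.1 * k.1.2 - v * s) * t.1 - (k.1.2 `^ p - s `^ p) * t.2.
Proof.
move=> v0 s0; have n0 : 0 <= n%:R :> R by [].
rewrite /target /=; move: (n%:R) n0 => N N0; case: t => a b /=.
move E : (s `^ p) => z; move E3 : (s3 `^ p) => z3; move E4 : (s4 `^ p) => z4.
move=> z0 e1e eta1 s3s ss4 c3 c4 h10 h20.
have [a1|a1s] := lerP (N * (x + e1)) a; last have a1 := ltW a1s.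
  right; exists ((v + h1, s), h1 * s * (x + e1)); first by rewrite !inE eqxx.
  by have := ler_wpM2l (mulr_ge0 h10 s0) a1; rewrite /= E => H; lra.
have [a2|a2s] := lerP a (N * (x - e1)); last have a2 := ltW a2s.
  right; exists ((v - h2, s), - (h2 * s * (x - e1))); first by rewrite !inE eqxx orbT.
  by have := ler_wpM2l (mulr_ge0 h20 s0) a2; rewrite /= E => H; lra.
have [b1|/ltW b1] := lerP (N * (tau + eta)) b.
  right; exists ((v, s3), - (v * (s - s3) * (x + e1)) + (z - z3) * (tau + eta)).
    by rewrite !inE eqxx !orbT.
  have d1 : 0 <= v * (s - s3) by rewrite mulr_ge0// subr_ge0.
  have d2 : 0 <= z - z3 by rewrite subr_ge0.
  by have := ler_wpM2l d1 a1; have := ler_wpM2l d2 b1; rewrite /= E3; lra.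
have [b2|/ltW b2] := lerP b (N * (tau - eta)).
  right; exists ((v, s4), v * (s4 - s) * (x - e1) - (z4 - z) * (tau - eta)).
    by rewrite !inE eqxx !orbT.
  have d1 : 0 <= v * (s4 - s) by rewrite mulr_ge0// subr_ge0.
  have d2 : 0 <= z4 - z by rewrite subr_ge0.
  by have := ler_wpM2l d1 a2; have := ler_wpM2l d2 b2; rewrite /= E4; lra.
left; split; first split.
- by have h := ler_wpM2l N0 e1e; rewrite ltr_norml; apply/andP; split; lra.
- by apply: (le_trans b1); have := ler_wpM2l N0 eta1; rewrite mulr1.
- have d := mulr_ge0 v0 s0.
  by have := ler_wpM2l d a1; have := ler_wpM2l z0 b2; lra.
Qed.

(* Tilt Lebesgue measure by [exp (v s t1 - s^p t2)]. The two stationarity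
   conditions make the tilted averages of [th i * x_i] and [|x_i|^p] equal to [x]
   and [tau < 1], so every way of leaving the target is exponentially unlikely,
   by Chernoff bounds at perturbed values of [v] and [s]. *)
Lemma slice_lower (th : nat -> nat -> R) (F : R -> R) (v s x tau e delta : R) :
  (forall w, psi_mean p n.+1 (th n) w @[n --> \oo] --> F w) ->
  0 <= v -> 0 < s -> 0 < tau < 1 -> is_derive v 1 F (s * x) ->
  p * s `^ p * tau = v * s * x + 1 -> 0 < e -> 0 < delta ->
  \forall n \near \oo,
    ((expR (n.+1%:R * (F v - ln s - v * s * x + s `^ p * tau - delta)))%:E <=
     slice_integral p n.+1 (th n) (fun t => (\1_(target n.+1 x e) t)%:E) (0, 0)%R)%E.
Proof.
move=> cvgF v0 s0 /andP[tau0 tau1] dF stat e0 delta0.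
have sp0 : 0 < s `^ p by rewrite powR_gt0.
(* The first bound keeps [tau + eta] inside the ball, the second limits the loss in the exponent. *)
pose eta := Num.min (1 - tau) (delta / 4 / s `^ p).
have eta0 : 0 < eta by rewrite lt_min subr_gt0 tau1 !divr_gt0.
have eta1 : tau + eta <= 1 by rewrite -lerBrDl ge_min lexx.
have eta2 : s `^ p * eta <= delta / 4.
  by rewrite mulrC -ler_pdivlMr// ge_min lexx orbT.
pose q := Num.min (delta / 4) (p * s `^ p * eta / 2).
have q0 : 0 < q by rewrite lt_min !divr_gt0 ?mulr_gt0.
have vs0 : 0 <= v * s by rewrite mulr_ge0// ltW.
(* The window for the linear form is narrowed so that [v s e1 < p s^p eta]: moving [s] then still
   helps although it also affects the linear term. *)
pose e1 := Num.min e (q / (v * s + 1)).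
have vs1 : 0 < v * s + 1 by rewrite ltr_wpDl.
have e10 : 0 < e1 by rewrite lt_min e0 divr_gt0.
have e1e : e1 <= e by rewrite ge_min lexx.
have vse1 : v * s * e1 <= q.
  apply: (@le_trans _ _ ((v * s + 1) * e1)); first by rewrite ler_wpM2r ?ltW// ltrDl.
  by rewrite mulrC -ler_pdivlMr// ge_min lexx orbT.
have vse2 : v * s * e1 <= delta / 4 by rewrite (le_trans vse1)// ge_min lexx.
have vse3 : v * s * e1 < p * s `^ p * eta.
  apply: (le_lt_trans vse1); rewrite gt_min; apply/orP; right.
  have : 0 < p * s `^ p * eta by rewrite !mulr_gt0.
  lra.
pose y := ln s.
have sE : s = expR y by rewrite /y lnK// posrE.
have spE z : expR z `^ p = expR (z * p) by rewrite expRM.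
have D1 (c : R) : is_derive v (1 : R) (fun w => F w - w * (s * c)) (s * x - s * c).
  have D2 : is_derive v (1 : R) (fun w : R => w * (s * c)) (s * c).
    apply: is_derive_eq; rewrite scaler0 add0r; exact: mulr1.
  exact: is_deriveB.
have [h1 h10 H1] : exists2 h, 0 < h & F (v + h) - (v + h) * (s * (x + e1)) < F v - v * (s * (x +
    e1)).
  apply: (derive_lt0_right (D1 (x + e1))); have := mulr_gt0 s0 e10; lra.
have [h2 h20 H2] : exists2 h, 0 < h & F (v - h) - (v - h) * (s * (x - e1)) < F v - v * (s * (x -
    e1)).
  apply: (derive_gt0_left (D1 (x - e1))); have := mulr_gt0 s0 e10; lra.
(* By stationarity this derivative is [p s^p eta - v s e1]; the one in [dneg] is its opposite. *)
have dpos : 0 < p * (tau + eta) * expR (y * p) - v * (x + e1) * expR y - 1.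
  by rewrite -spE -sE; lra.
have [h3 h30 H3] := derive_gt0_left (is_derive_expfun (v * (x + e1)) (tau + eta) y) dpos.
have dneg : p * (tau - eta) * expR (y * p) - v * (x - e1) * expR y - 1 < 0.
  by rewrite -spE -sE; lra.
have [h4 h40 H4] := derive_lt0_right (is_derive_expfun (v * (x - e1)) (tau - eta) y) dneg.
pose s3 := expR (y - h3); pose s4 := expR (y + h4).
have s30 : 0 < s3 by exact: expR_gt0.
have s40 : 0 < s4 by exact: expR_gt0.
have s3s : s3 < s by rewrite sE ltr_expR; lra.
have ss4 : s < s4 by rewrite sE ltr_expR; lra.
have s3sp : s3 `^ p <= s `^ p by rewrite ge0_ler_powR ?nnegrE ?ltW.
have ss4p : s `^ p <= s4 `^ p by rewrite ge0_ler_powR ?nnegrE ?ltW.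
have ln3 : ln s3 = y - h3 by rewrite expRK.
have ln4 : ln s4 = y + h4 by rewrite expRK.
rewrite -!spE -/s3 -/s4 -!sE in H3 H4.
pose K1 := h1 * s * (x + e1).
pose K2 := - (h2 * s * (x - e1)).
pose K3 := - (v * (s - s3) * (x + e1)) + (s `^ p - s3 `^ p) * (tau + eta).
pose K4 := v * (s4 - s) * (x - e1) - (s4 `^ p - s `^ p) * (tau - eta).
pose ks : seq (R * R * R) := [:: ((v + h1, s), K1); ((v - h2, s), K2); ((v, s3), K3); ((v, s4),
    K4)].
pose K0 := v * s * (x + e1) - s `^ p * (tau - eta).
have ks0 k : k \in ks -> 0 < k.1.2.
  by rewrite !inE => /or4P[] /eqP->.
have cover n (t : T2) : (target n x e t /\ v * s * t.1 - s `^ p * t.2 <= n%:R * K0) \/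
     exists2 k, k \in ks &
       n%:R * k.2 <= (k.1.1 * k.1.2 - v * s) * t.1 - (k.1.2 `^ p - s `^ p) * t.2.
  have [t0|[k kks H]] := @target_cover n t v s x e e1 tau eta h1 h2 s3 s4 v0 (ltW s0) (ltW sp0)
      e1e eta1 (ltW s3s) (ltW ss4)
    s3sp ss4p (ltW h10) (ltW h20); [by left|right].
  by exists k => //; move: kks; rewrite !inE => /or4P[] /eqP ->; rewrite !inE eqxx ?orbT.
have small k : k \in ks -> F k.1.1 - ln k.1.2 - k.2 - (F v - ln s) < 0.
  rewrite !inE => /or4P[] /eqP-> /=; rewrite ?ln3 ?ln4 -?/y /K1 /K2 /K3 /K4.
  - by move: H1; clear; move: (F (v + h1)) (F v) (ln s) => z1 z2 z3; lra.
  - by move: H2; clear; move: (F (v - h2)) (F v) (ln s) => z1 z2 z3; lra.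
  - by move: H3; clear; move: (F v) (s `^ p) (s3 `^ p) => z1 z2 z3; lra.
  - by move: H4; clear; move: (F v) (s `^ p) (s4 `^ p) => z1 z2 z3; lra.
(* Four escape terms, each at most an eighth of the total mass, leave half of it for the target. *)
have small_near k : k \in ks -> \forall n \near \oo,
    expR (n.+1%:R * (psi_mean p n.+1 (th n) k.1.1 - ln k.1.2 - k.2)) <=
    8^-1 * expR (n.+1%:R * (psi_mean p n.+1 (th n) v - ln s)).
  move=> kks; have := small k kks => neg.
  have cv : (psi_mean p n.+1 (th n) k.1.1 - ln k.1.2 - k.2 - (psi_mean p n.+1 (th n) v - ln s))
      @[n --> \oo] --> F k.1.1 - ln k.1.2 - k.2 - (F v - ln s).
    apply: cvgB; last by apply: cvgB; [exact: cvgF|exact: cvg_cst].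
    apply: cvgB; last exact: cvg_cst.
    by apply: cvgB; [exact: cvgF|exact: cvg_cst].
  have e8 : 0 < 8^-1 :> R by [].
  have := expR_rate_small cv neg e8; apply: filterS => n.
  by rewrite mulrBr expRB ler_pdivrMr ?expR_gt0.
have in1 : ((v + h1, s), K1) \in ks by rewrite !inE eqxx.
have in2 : ((v - h2, s), K2) \in ks by rewrite !inE eqxx orbT.
have in3 : ((v, s3), K3) \in ks by rewrite !inE eqxx !orbT.
have in4 : ((v, s4), K4) \in ks by rewrite !inE eqxx !orbT.
have dF4 : F v - delta / 4 < F v by rewrite ltrBlDr ltrDl divr_gt0.
have d4 : - (delta / 4) < 0 by rewrite oppr_lt0 divr_gt0.
have half2 : 0 < 2^-1 :> R by [].
have half_near := expR_rate_small (cvg_cst (- (delta / 4))) d4 half2.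
near=> n.
have meanF : F v - delta / 4 <= psi_mean p n.+1 (th n) v.
  by apply: ltW; near: n; exact: (cvgr_gt _ (cvgF v) _ dF4).
have half : expR (- (n.+1%:R * (delta / 4))) <= 2^-1.
  by rewrite -mulrN; near: n; exact: half_near.
have Q1 : expR (n.+1%:R * (psi_mean p n.+1 (th n) (v + h1) - ln s - K1)) <=
    8^-1 * expR (n.+1%:R * (psi_mean p n.+1 (th n) v - ln s)).
  by near: n; exact: (small_near _ in1).
have Q2 : expR (n.+1%:R * (psi_mean p n.+1 (th n) (v - h2) - ln s - K2)) <=
    8^-1 * expR (n.+1%:R * (psi_mean p n.+1 (th n) v - ln s)).
  by near: n; exact: (small_near _ in2).
have Q3 : expR (n.+1%:R * (psi_mean p n.+1 (th n) v - ln s3 - K3)) <=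
    8^-1 * expR (n.+1%:R * (psi_mean p n.+1 (th n) v - ln s)).
  by near: n; exact: (small_near _ in3).
have Q4 : expR (n.+1%:R * (psi_mean p n.+1 (th n) v - ln s4 - K4)) <=
    8^-1 * expR (n.+1%:R * (psi_mean p n.+1 (th n) v - ln s)).
  by near: n; exact: (small_near _ in4).
have N0 : 0 < n.+1%:R :> R by [].
have := slice_tilt_le hp (th n) (ltn0Sn n) s0 (measurable_target n.+1 x e) ks0 (cover n.+1).
set W := expR (n.+1%:R * (psi_mean p n.+1 (th n) v - ln s)).
set S := (\sum_(k <- ks) _).
set J := slice_integral _ _ _ _ _ => H.
have SW : S <= W / 2.
  rewrite /S /ks !big_cons big_nil addr0 /=.
  move: Q1 Q2 Q3 Q4; rewrite -/W; clear.
  by move: (expR _) (expR _) (expR _) (expR _) W => z1 z2 z3 z4 z5; lra.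
have J0 : (0 <= J)%E by apply: slice_ge0 => t; rewrite lee_fin.
case: J J0 H => [r| |] //= r0; last by rewrite leey.
rewrite -EFinM -EFinD !lee_fin => H.
have H5 : W / 2 <= expR (n.+1%:R * K0) * r by move: H SW; clear; move: (expR _ * r) => z; lra.
have H6 : expR (- (n.+1%:R * K0)) * (W / 2) <= r.
  by rewrite mulrC expRN ler_pdivrMr ?expR_gt0// [leRHS]mulrC.
apply: le_trans H6.
apply: (@le_trans _ _ (expR (- (n.+1%:R * K0)) * (W * expR (- (n.+1%:R * (delta / 4)))))).
  rewrite /W -!expRD ler_expR -!mulrN -!mulrDr ler_pM2l//.
  rewrite /K0; move: (psi_mean _ _ _ _) meanF => z hz.
  move: hz eta2 vse2; clear; move: (F v) (ln s) (s `^ p) => z1 z2 z3; lra.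
by rewrite ler_wpM2l ?expR_ge0// ler_wpM2l// /W expR_ge0.
Unshelve. all: by end_near. Qed.

End volume_lower_bound.

(** * Large deviations for a fixed frame *)

Section limsup.
Context {R : realType}.
Local Open Scope ereal_scope.
Implicit Types (u : nat -> \bar R) (c : \bar R).

Lemma limn_esup_ub u c : (\forall n \near \oo, u n <= c) -> limn_esup u <= c.
Proof.
move=> H; apply: (@le_trans _ _ (ereal_sup (u @` [set n | u n <= c]))).
  by apply: ereal_inf_lbound; exists [set n | u n <= c].
by apply: ge_ereal_sup => _ [n /= h <-].
Qed.

Lemma limn_einf_lb u c : (\forall n \near \oo, c <= u n) -> c <= limn_einf u.
Proof.
move=> H; rewrite /limn_einf leeNr; apply: limn_esup_ub.
by apply: filterS H => n h; rewrite leeN2.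
Qed.

Lemma lne_le_exp (N c : R) x : (0 < N)%R -> 0 <= x -> x <= (expR (N * c))%:E ->
  (N^-1)%:E * lne x <= c%:E.
Proof.
move=> N0 x0 xc; rewrite lee_pdivrMl// -EFinM.
rewrite (_ : (N * c)%:E = lne (expR (N * c))%:E); last first.
  by rewrite lne_EFin ?expR_gt0// expRK.
by rewrite lee_lne// in_itv/= leey ?andbT// lee_fin expR_ge0.
Qed.

Lemma exp_le_lne (N c : R) x : (0 < N)%R -> (expR (N * c))%:E <= x ->
  c%:E <= (N^-1)%:E * lne x.
Proof.
move=> N0 xc; rewrite lee_pdivlMl// -EFinM.
rewrite (_ : (N * c)%:E = lne (expR (N * c))%:E); last first.
  by rewrite lne_EFin ?expR_gt0// expRK.
have e0 := expR_ge0 (N * c).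
by rewrite lee_lne// in_itv/= leey ?andbT ?lee_fin//; apply: le_trans xc; rewrite lee_fin.
Qed.

Lemma lee_dense (x y : \bar R) : (forall c : R, c%:E < x -> c%:E <= y) -> x <= y.
Proof.
case: x => [x| |] H; last by rewrite leNye.
  apply/lee_subgt0Pr => e e0; rewrite -EFinB; apply: H.
  by rewrite lte_fin ltrBlDr ltrDl.
case: y H => [y| |] H //.
  by have := H (y + 1)%R (ltry _); rewrite lee_fin gerDl ler10.
by have := H 0%R (ltry _); rewrite leeNy_eq.
Qed.

Lemma inf_closure (A : set R) : has_inf A -> closure A (inf A).
Proof.
move=> hA B /nbhs_ballP[e /= e0 eB].
have [x Ax xe] := inf_adherent e0 hA; exists x; split => //; apply: eB.
have h : (inf A <= x)%R by apply: ge_inf => //; case: hA.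
by rewrite /ball/= ler0_norm ?subr_le0// opprB ltrBlDl.
Qed.

End limsup.

Lemma union_bound d (T : measurableType d) (R : realType) (mu : {measure set T -> \bar R})
    (I : Type) (r : seq I) (F : I -> set T) : (forall i, measurable (F i)) ->
  (mu (\big[setU/set0]_(i <- r) F i) <= \sum_(i <- r) mu (F i))%E.
Proof.
move=> mF; elim: r => [|i r IH]; first by rewrite !big_nil measure0.
rewrite !big_cons; apply: (@le_trans _ _ (mu (F i) + mu (\big[setU/set0]_(i <- r) F i))%E).
  by apply: measureU2 => //; apply: bigsetU_measurable => j _; exact: mF.
by rewrite leeD2l.
Qed.

Section exponential_rates.
Context {R : realType}.

(** Absorbs the union bound: at most [n + 1] columns in dimension [n + 1], and two signs for
    each. *)
Lemma natr_le_exp (eps : R) : 0 < eps ->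
  \forall n \near \oo, n.+1%:R *+ 2 <= expR (n.+1%:R * eps).
Proof.
move=> e0; near=> n.
have N0 : 0 < n.+1%:R :> R by [].
have h : 4 / eps ^+ 2 <= n.+1%:R.
  apply: (@le_trans _ _ n%:R); last by rewrite ler_nat.
  by near: n; exact: nbhs_infty_ger.
apply: le_trans (expR_ge1Dxn 1 (mulr_ge0 (ltW N0) (ltW e0))).
have -> : 2`!%:R = 2 :> R by [].
rewrite -[n.+1%:R *+ 2]mulr_natl -[leLHS]add0r lerD ?ler01//.
have e20 : 0 < eps ^+ 2 by rewrite exprn_gt0.
rewrite ler_pdivrMr// in h.
rewrite exprMn ler_pdivlMr// expr2 -mulrA.
move: h N0; clear; move: (n.+1%:R) (eps ^+ 2) => N e h N0; nra.
Unshelve. all: by end_near. Qed.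

Lemma exp_half (h : R) : 0 < h -> \forall n \near \oo, expR (- (n.+1%:R * h)) <= 2^-1.
Proof.
move=> h0; have h1 : - h < 0 by rewrite oppr_lt0.
have h2 : 0 < 2^-1 :> R by [].
have cv : (fun _ : nat => - h) n @[n --> \oo] --> - h by exact: cvg_cst.
have := expR_rate_small cv h1 h2.
by apply: filterS => n; rewrite mulrN.
Qed.

End exponential_rates.

(** * Exponential order of the volume of the ball *)

Section ball_volume.
Context {R : realType}.
Variables (p : R) (hp : 2 <= p).
Local Notation T2 := (measurableTypeR R * measurableTypeR R)%type.

Let p0 : 0 < p. Proof. by rewrite (lt_le_trans _ hp). Qed.

Definition ball_volume (n : nat) : \bar R := volume (@lp_ball R p n.+1).

Lemma ball_volume_slice n (th : nat -> R) :
  ball_volume n =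
  slice_integral p n.+1 th (fun t => (\1_[set t : T2 | t.2 <= n.+1%:R] t)%:E) (0, 0).
Proof.
rewrite -(volume_slice p n.+1 th [set t : T2 | t.2 <= n.+1%:R]); congr volume.
by apply/seteqP; split => v /=; rewrite add0r.
Qed.

Lemma measurable_ball_slice (N : R) : measurable [set t : T2 | t.2 <= N].
Proof.
rewrite -[X in measurable X]setTI.
by apply: measurable_fun_ler => //; exact: measurable_snd.
Qed.

Lemma ball_volume_le n : (ball_volume n <= (expR (n.+1%:R * kappa p))%:E)%E.
Proof.
rewrite (ball_volume_slice n (cst 0)).
pose s := p `^ (- p^-1).
have s0 : 0 < s by rewrite powR_gt0.
have sp : s `^ p = p^-1 by rewrite -powRrM mulNr mulVf ?gt_eqF// powR_inv1// ltW.
apply: (le_trans (@slice_chernoff R p hp n.+1 (cst 0) _ (- p^-1) 0 s _ _ _ _)) => //.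
- exact: measurable_ball_slice.
- move=> t tn; have pV : 0 <= p^-1 by rewrite invr_ge0 ltW.
  by have := ler_wpM2l pV tn; rewrite sp; move: (p^-1) => q; lra.
- rewrite lee_fin ler_expR ler_pM2l// opprK /s ln_powR /kappa /psi_mean.
  under eq_bigr do rewrite mul0r.
  rewrite sumr_const card_ord -[psi p 0 *+ _]mulr_natl mulKf//.
  by move: (ln p) (psi _ _) => a b; lra.
Qed.

Lemma ball_volume_ge (eta : R) : 0 < eta -> \forall n \near \oo,
  ((expR (n.+1%:R * (kappa p - eta)))%:E <= ball_volume n)%E.
Proof.
(* [slice_lower] asks for [tau < 1]. With [s^p tau = 1/p] this choice raises [ln s] by exactly
   [eta / 2], and [delta = eta / 2] spends the rest. The zero linear form makes the limit function
   constant. *)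
move=> eta0; pose tau := expR (- (p * (eta / 2))).
have tau0 : 0 < tau by exact: expR_gt0.
have tau1 : tau < 1 by rewrite -[ltRHS]expR0 ltr_expR oppr_lt0 mulr_gt0// divr_gt0.
pose s := (p * tau) `^ (- p^-1).
have pt0 : 0 < p * tau by rewrite mulr_gt0.
have s0 : 0 < s by rewrite powR_gt0.
have sp : s `^ p = (p * tau)^-1 by rewrite -powRrM mulNr mulVf ?gt_eqF// powR_inv1// ltW.
have cv w : psi_mean p n.+1 (cst 0) w @[n --> \oo] --> psi p 0.
  rewrite (_ : (fun n => _) = cst (psi p 0)); first exact: cvg_cst.
  apply/funext => n; rewrite /psi_mean; under eq_bigr do rewrite mulr0.
  by rewrite sumr_const card_ord -[psi p 0 *+ _]mulr_natl mulKf.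
have D : is_derive (0 : R) 1 (cst (psi p 0)) (s * 0) by rewrite mulr0; exact: is_derive_cst.
have st : p * s `^ p * tau = 0 * s * 0 + 1.
  by rewrite sp !mul0r add0r mulrAC mulfV// gt_eqF.
have tau01 : 0 < tau < 1 by rewrite tau0.
have e2 : 0 < eta / 2 by rewrite divr_gt0.
have := @slice_lower R p hp (fun=> cst 0) _ 0 s 0 tau 1 (eta / 2) cv (lexx _) s0 tau01 D st ltr01
    e2.
apply: filterS => n H; rewrite (ball_volume_slice n (cst 0)).
apply: (@le_trans _ _ _ _ _ (le_trans _ H)).
  rewrite lee_fin ler_expR ler_pM2l// sp /s ln_powR lnM ?posrE// expRK.
  rewrite /kappa !mul0r invfM.
  have -> : p^-1 / tau * tau = p^-1 by rewrite divfK// gt_eqF.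
  have -> : - p^-1 * (ln p - p * (eta / 2)) = - (ln p / p) + eta / 2.
    by move: (ln p) => l; field; rewrite gt_eqF.
  by move: (ln p / p) (psi _ _) (p^-1) => a b c; lra.
apply: slice_mono.
- by apply/measurable_EFinP; apply: measurable_indic; exact: measurable_target.
- by apply/measurable_EFinP; apply: measurable_indic; exact: measurable_ball_slice.
- by move=> t; rewrite lee_fin.
- move=> t; rewrite lee_fin !indicE.
  have [tt|] := boolP (t \in target _ _ _) => //.
  by rewrite mem_set//; move/set_mem: tt => -[].
Qed.

End ball_volume.

(** * Deviations of the maximum over the columns *)

Section max_deviations.
Context {R : realType}.
Variables (p : R) (hp : 2 <= p).
Local Notation T2 := (measurableTypeR R * measurableTypeR R)%type.
Variables (k : nat -> nat) (k_bounds : forall n, (0 < n)%N -> (0 < k n <= n)%N).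
Unset Implicit Arguments.
Variable (th : forall n, 'I_(k n.+1) -> nat -> R).
Hypothesis th_good : forall v eps : R, 0 < eps ->
  \forall n \near \oo, forall j, `|psi_mean p n.+1 (th n j) v - phi p v| <= eps.
Variables (d : nat -> measure_display) (W : forall n, measurableType (d n)).
Variables (P : forall n, probability (W n) R).
Variables (X : forall n, 'I_(k n.+1) -> W n -> R) (M : forall n, W n -> R).
Hypothesis mX : forall n j, measurable_fun setT (X n j : W n -> measurableTypeR R).
Hypothesis mM : forall n, measurable_fun setT (M n : W n -> measurableTypeR R).
Hypothesis X_law : forall n j (D : set (measurableTypeR R)), measurable D ->
  P n (X n j @^-1` D) = (slice_integral p n.+1 (th n j)
    (fun t => (\1_[set t : T2 | D (n.+1%:R^-1 * t.1)%R /\ t.2 <= n.+1%:R] t)%:E) (0, 0)%R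
    / ball_volume p n)%E.
Hypothesis M_ub : forall n j x, `|X n j x| <= M n x.
Hypothesis M_attained : forall n x, exists j, M n x = `|X n j x|.

Set Implicit Arguments.

Let p0 : 0 < p. Proof. by rewrite (lt_le_trans _ hp). Qed.

Lemma div_ball_volume_le (x : \bar R) n (b c : R) :
  ((expR (n.+1%:R * b))%:E <= ball_volume p n)%E -> (0 <= x)%E ->
  (x <= (expR (n.+1%:R * c))%:E)%E ->
  (x / ball_volume p n <= (expR (n.+1%:R * (c - b)))%:E)%E.
Proof.
have := ball_volume_le hp n; move: (ball_volume p n) => V Vle Vge.
have V0 : (0 < V)%E by rewrite (lt_le_trans _ Vge)// lte_fin expR_gt0.
case: V V0 Vle Vge => [V| |]//; rewrite lte_fin !lee_fin => V0 Vle Vge.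
case: x => [x| |]//; rewrite !lee_fin => x0 xc.
rewrite inver gt_eqF// -EFinM lee_fin ler_pdivrMr//.
apply: (le_trans xc); apply: (@le_trans _ _ (expR (n.+1%:R * (c - b)) * expR (n.+1%:R * b))).
  by rewrite -expRD -mulrDr subrK.
by rewrite ler_wpM2l ?expR_ge0.
Qed.

Lemma div_ball_volume_ge (x : \bar R) n (b c : R) :
  ((expR (n.+1%:R * b))%:E <= ball_volume p n)%E ->
  ((expR (n.+1%:R * c))%:E <= x)%E ->
  ((expR (n.+1%:R * (c - kappa p)))%:E <= x / ball_volume p n)%E.
Proof.
have := ball_volume_le hp n; move: (ball_volume p n) => V Vle Vge.
have V0 : (0 < V)%E by rewrite (lt_le_trans _ Vge)// lte_fin expR_gt0.
case: V V0 Vle Vge => [V| |]//; rewrite lte_fin !lee_fin => V0 Vle Vge.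
case: x => [x| |]//; rewrite ?lee_fin => xc; last first.
  by rewrite inver gt_eqF// mulyr gtr0_sg ?invr_gt0// mul1e leey.
rewrite inver gt_eqF// -EFinM lee_fin ler_pdivlMr//.
apply: (@le_trans _ _ (expR (n.+1%:R * (c - kappa p)) * expR (n.+1%:R * kappa p))).
  by rewrite ler_wpM2l ?expR_ge0.
by rewrite -expRD -mulrDr subrK.
Qed.

Lemma measurable_slab n (D : set (measurableTypeR R)) : measurable D ->
  measurable [set t : T2 | D (n.+1%:R^-1 * t.1) /\ t.2 <= n.+1%:R].
Proof.
move=> mD; apply: measurableI; last exact: measurable_ball_slice.
have mf : measurable_fun setT (fun t : T2 => n.+1%:R^-1 * t.1 : measurableTypeR R).
  by apply: measurable_funM => //; exact: measurable_fst.
by rewrite -[X in measurable X]setTI; exact: mf.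
Qed.

Lemma tail_upper (v s r eps : R) : 0 <= v -> 0 < s -> 0 < eps ->
  \forall n \near \oo, forall j, (P n [set x | (r <= `|X n j x|)%R] <=
    (expR (- (n.+1%:R * (tilt_gain p r v s - eps))) *+ 2)%:E)%E.
Proof.
move=> v0 s0 e0.
have e2 : 0 < eps / 2 by rewrite divr_gt0.
have := th_good v _ e2; have := ball_volume_ge hp e2.
apply: filterS2 => n Vn H j.
have {H} := H j; rewrite ler_distl => /andP[_ H].
pose D1 := [set x : measurableTypeR R | r <= x].
pose D2 := [set x : measurableTypeR R | x <= - r].
have mD1 : measurable D1.
  rewrite (_ : D1 = `[r, +oo[%classic)//; apply/seteqP; split => x /=; by rewrite in_itv/= andbT.
have mD2 : measurable D2.
  rewrite (_ : D2 = `]-oo, (- r)]%classic)//; apply/seteqP; split => x /=; by rewrite in_itv.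
have -> : [set x | (r <= `|X n j x|)%R] = X n j @^-1` D1 `|` X n j @^-1` D2.
  apply/seteqP; split => x /=.
    by rewrite ler_normr => /orP[h|h]; [left|right; rewrite /D2/= lerNr].
  by case => /= h; rewrite ler_normr ?h// lerNr h orbT.
have mP D : measurable D -> measurable (X n j @^-1` D).
  by move=> mD; rewrite -[X in measurable X]setTI; exact: mX.
apply: (le_trans (measureU2 _ (mP _ mD1) (mP _ mD2))).
rewrite mulr2n EFinD; apply: leeD.
  rewrite [X in (X <= _)%E](X_law n j _ mD1).
  apply: (@le_trans _ _ (expR (n.+1%:R * ((phi p v + eps / 2) - ln s - (v * s * r - s `^ p)
      - (kappa p - eps / 2))))%:E); last first.
    rewrite lee_fin ler_expR -[leRHS]mulrN ler_pM2l// /tilt_gain.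
    by move: (phi p v) (ln s) (s `^ p) (kappa p) => a b c e; lra.
  apply: div_ball_volume_le => //; first by apply: slice_ge0 => t; rewrite lee_fin.
  apply: (le_trans (@slice_chernoff R p hp n.+1 (th n j) _ (v * s * r - s `^ p) v s _ s0
     (measurable_slab n mD1) _)) => //.
    move=> t [/= t1 t2]; rewrite /D1/= ler_pdivlMl// in t1.
    have := ler_wpM2l (mulr_ge0 v0 (ltW s0)) t1.
    have := ler_wpM2l (powR_ge0 s p) t2.
    by move: (s `^ p) => a; lra.
  by rewrite lee_fin ler_expR ler_pM2l// !lerD2r.
rewrite [X in (X <= _)%E](X_law n j _ mD2).
apply: (@le_trans _ _ (expR (n.+1%:R * ((phi p v + eps / 2) - ln s - (v * s * r - s `^ p)
      - (kappa p - eps / 2))))%:E); last first.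
  rewrite lee_fin ler_expR -[leRHS]mulrN ler_pM2l// /tilt_gain.
  by move: (phi p v) (ln s) (s `^ p) (kappa p) => a b c e; lra.
apply: div_ball_volume_le => //; first by apply: slice_ge0 => t; rewrite lee_fin.
(* The negative side is tilted by [- v]; as [psi] is even, the bound is the same. *)
apply: (le_trans (@slice_chernoff R p hp n.+1 (th n j) _ (v * s * r - s `^ p) (- v) s _ s0
   (measurable_slab n mD2) _)) => //.
  move=> t [/= t1 t2]; rewrite /D2/= ler_pdivrMl// in t1.
  have := ler_wpM2l (mulr_ge0 v0 (ltW s0)) t1.
  have := ler_wpM2l (powR_ge0 s p) t2.
  by move: (s `^ p) => a; lra.
have -> : psi_mean p n.+1 (th n j) (- v) = psi_mean p n.+1 (th n j) v.
  by rewrite /psi_mean; congr (_ * _); apply: eq_bigr => i _; rewrite mulNr psiN.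
by rewrite lee_fin ler_expR ler_pM2l// !lerD2r.
Qed.

Lemma measurable_M n (D : set (measurableTypeR R)) : measurable D ->
  measurable [set x | D (M n x)].
Proof. by move=> mD; rewrite -[X in measurable X]setTI; exact: mM. Qed.

Lemma measurable_ray (r : R) : measurable [set x : measurableTypeR R | r <= x].
Proof.
rewrite (_ : mkset _ = `[r, +oo[%classic)//.
by apply/seteqP; split => x /=; rewrite in_itv/= andbT.
Qed.

Lemma max_upper (r c : R) : (c%:E < tilt_rate p r)%E -> 0 <= r ->
  \forall n \near \oo, (P n [set x | (r <= M n x)%R] <= (expR (- (n.+1%:R * c)))%:E)%E.
Proof.
move=> /ereal_sup_gt[_ [v [s [s0 ->]]]]; rewrite lte_fin => cg r0.
(* For [r >= 0] a negative [v] may be replaced by [- v], since [phi] is even and the linear term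
   increases. *)
wlog v0 : v cg / 0 <= v.
  move=> H; have [|v0] := leP 0 v; first exact: H.
  apply: (H (- v)); last by rewrite oppr_ge0 ltW.
  apply: (lt_le_trans cg); rewrite /tilt_gain phiN// !lerD2r.
  have := mulr_le0_ge0 (ltW v0) (mulr_ge0 (ltW s0) r0).
  by rewrite -!mulrA mulNr => vsr; rewrite (le_trans vsr)// oppr_ge0.
pose eps := (tilt_gain p r v s - c) / 2.
have e0 : 0 < eps by rewrite divr_gt0// subr_gt0.
have := natr_le_exp e0; have := tail_upper r v0 s0 e0.
apply: filterS2 => n H1 H2.
apply: (@le_trans _ _ (\sum_(j < k n.+1) P n [set x : W n | (r <= `|X n j x|)%R])%E).
  have mA j : measurable [set x | (r <= `|X n j x|)%R].
    rewrite -[X in measurable X]setTI; apply: measurable_fun_ler => //.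
    by apply: measurableT_comp => //; exact: mX.
  have -> : [set x | (r <= M n x)%R] = \big[setU/set0]_(j < k n.+1) [set x | (r <= `|X n j x|)%R].
    rewrite -bigcup_seq; apply/seteqP; split => x /=.
      by have [j ->] := M_attained n x => h; exists j => //=; rewrite mem_index_enum.
    by move=> [j _ /= h]; exact: le_trans h (M_ub _ _ _).
  exact: union_bound.
apply: (@le_trans _ _ (\sum_(j < k n.+1) (expR (- (n.+1%:R * (tilt_gain p r v s - eps))) *+
    2)%:E)%E).
  by apply: lee_sum => j _; exact: H1.
rewrite sumEFin lee_fin sumr_const card_ord.
have /andP[_ kn] := k_bounds (ltn0Sn n).
set E := expR _.
apply: (@le_trans _ _ (E * (n.+1%:R *+ 2))).
  rewrite mulrnAr -mulrnA mulnC mulrnA ler_wMn2r// mulr_natr ler_wpMn2l ?expR_ge0//.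
apply: (le_trans (ler_wpM2l (expR_ge0 _) H2)).
rewrite -expRD ler_expR -!mulrN -mulrDr ler_pM2l// /eps.
by move: (tilt_gain _ _ _ _) => a; lra.
Qed.

Lemma slab_target n (x e : R) :
  [set t : T2 | `|n.+1%:R^-1 * t.1 - x| < e /\ t.2 <= n.+1%:R] = target n.+1 x e.
Proof.
have N0 : 0 < n.+1%:R :> R by [].
have E (t : T2) : (`|n.+1%:R^-1 * t.1 - x| < e) = (`|t.1 - n.+1%:R * x| < n.+1%:R * e).
  rewrite -[RHS](@ltr_pM2l _ n.+1%:R^-1) ?invr_gt0// mulKf//.
  by rewrite -[X in X * `|_|]ger0_norm ?invr_ge0// -normrM mulrBr mulKf.
by apply/seteqP; split => t /=; rewrite E.
Qed.

(** Any one column suffices; the first is taken, so that its means form a single sequence as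
    [slice_lower] expects. *)
Lemma point_lower (v s x tau e delta : R) : 0 <= v -> 0 < s -> 0 < tau < 1 ->
  dphi p v = s * x -> p * s `^ p * tau = v * s * x + 1 -> 0 < e -> 0 < delta ->
  \forall n \near \oo, exists j,
    ((expR (n.+1%:R * (phi p v - ln s - v * s * x + s `^ p * tau - delta - kappa p)))%:E <=
     P n [set y : W n | (`|X n j y - x| < e)%R])%E.
Proof.
move=> v0 s0 tau01 dv st e0 delta0.
have kp n : (0 < k n.+1)%N by have /andP[] := k_bounds (ltn0Sn n).
pose j0 n : 'I_(k n.+1) := Ordinal (kp n).
have cv w : psi_mean p n.+1 (th n (j0 n)) w @[n --> \oo] --> phi p w.
  apply/cvgrPdist_le => eps eps0; have := th_good w _ eps0.
  by apply: filterS => n /(_ (j0 n)); rewrite distrC.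
have D : is_derive v (1 : R) (phi p) (s * x) by rewrite -dv; exact: is_derive_phi.
have := slice_lower hp cv v0 s0 tau01 D st e0 delta0.
have := ball_volume_ge hp ltr01; apply: filterS2 => n Vn H; exists (j0 n).
have mD : measurable [set z : measurableTypeR R | `|z - x| < e].
  by rewrite -[X in measurable X]setTI; apply: measurable_fun_ltr => //;
     apply: measurableT_comp => //; exact: measurable_funB.
have -> : P n [set y | (`|X n (j0 n) y - x| < e)%R] =
    P n (X n (j0 n) @^-1` [set z : measurableTypeR R | `|z - x| < e]) by [].
rewrite (X_law n (j0 n) _ mD); apply: div_ball_volume_ge => //; first exact: Vn.
by rewrite (slab_target n x e).
Qed.

Lemma measurable_X n j (D : set (measurableTypeR R)) : measurable D ->
  measurable (X n j @^-1` D).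
Proof. by move=> mD; rewrite -[X in measurable X]setTI; exact: mX. Qed.

(** For [r > 0] the point is taken strictly below [r], because [exists_critical] uses finiteness of
    the rate at a larger point; at [r = 0] the critical pair is explicit. *)
Lemma critical_near (r e : R) : 0 <= r -> (tilt_rate p r < +oo)%E -> 0 < e ->
  exists r1 v s, [/\ 0 <= r1 <= r, r - r1 < e, 0 <= v, 0 < s &
    dphi p v = s * r1 /\ p * s `^ p = v * s * r1 + 1].
Proof.
rewrite le_eqVlt => /predU1P[<- _|r0 rfin] e0.
  have [v [s [v0 s0 h1 h2]]] := exists_critical0 hp.
  by exists 0, v, s; split => //; [rewrite lexx|rewrite subrr].
pose r1 := Num.max (r / 2) (r - e / 2).
have r10 : 0 < r1 by rewrite lt_max divr_gt0.
have r1r : r1 < r by rewrite gt_max; apply/andP; split; lra.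
have [v [s [v0 s0 h1 h2]]] := exists_critical hp r10 r1r rfin.
exists r1, v, s; split => //; first by rewrite !ltW.
have : r - e / 2 <= r1 by rewrite le_max lexx orbT.
by lra.
Qed.

(** One column lands near a point just below [r1] with probability about [exp (- n G)]. The event
    that some column reaches [r2 > r1] has a strictly larger rate, so removing it costs at most half
    and leaves the maximum in [U]. *)
Lemma max_lower (U : set R) (r eta : R) : open U -> U r -> 0 <= r ->
  (tilt_rate p r < +oo)%E -> 0 < eta ->
  \forall n \near \oo, ((expR (n.+1%:R * - (fine (tilt_rate p r) + eta)))%:E <=
    P n [set y : W n | U (M n y)])%E.
Proof.
move=> oU Ur r0 rfin eta0.
have [e0 /= e00 Ue] : \forall e \near (0 : R)^'+, ball r e `<=` U.
  exact: open_subball.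
have [e e1 e2] : exists2 e, 0 < e & forall y, `|r - y| < e -> U y.
  exists (e0 / 2); first by rewrite divr_gt0.
  move=> y ry; apply: (Ue (e0 / 2)) => //=; last by rewrite divr_gt0.
  by rewrite sub0r normrN ger0_norm; lra.
have e4 : 0 < e / 4 by rewrite divr_gt0.
have [r1 [v [s1 [/andP[r10 r1r] rr1 v0 s10 [dv st]]]]] := critical_near r0 rfin e4.
pose r2 := r1 + e / 4.
have r12 : r1 < r2 by rewrite ltrDl.
pose G := tilt_gain p r1 v s1.
have GB : G <= fine (tilt_rate p r).
  rewrite -lee_fin fineK; last by rewrite ge0_fin_numE ?tilt_rate_ge0.
  apply: (le_trans _ (tilt_gain_le p r v s10)).
  by rewrite lee_fin tilt_gain_mono.
have [_ [w [s [s0 ->]]]] := ereal_sup_gt (tilt_gain_strict hp v0 s10 r12 dv).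
rewrite lte_fin -/G => Gc'; set c' := tilt_gain p r2 w s in Gc'.
have c'r2 : (c'%:E <= tilt_rate p r2)%E by exact: tilt_gain_le.
pose gap := (c' - G) / 2.
have gap0 : 0 < gap by rewrite divr_gt0// subr_gt0.
pose c := G + gap.
have cr2 : (c%:E < tilt_rate p r2)%E.
  by apply: lt_le_trans c'r2; rewrite lte_fin /c /gap; lra.
have r20 : 0 <= r2 by rewrite addr_ge0// ltW.
(* The first two bounds keep [h + delta] below half of each margin [gap] and [eta]; the third keeps
   [x] within [e / 8] of [r1]. *)
pose h := Num.min (Num.min (gap / 4) (eta / 4)) (e / (8 * (r1 + 1))).
have r11 : 0 < r1 + 1 by rewrite ltr_wpDl.
have h0 : 0 < h.
  by rewrite !lt_min; apply/andP; split; [apply/andP; split|]; rewrite divr_gt0// mulr_gt0.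
have hgap : h <= gap / 4 by rewrite !ge_min lexx.
have heta : h <= eta / 4 by rewrite !ge_min lexx orbT.
have hr1 : r1 * h <= e / 8.
  have : h <= e / (8 * (r1 + 1)) by rewrite !ge_min lexx !orbT.
  rewrite ler_pdivlMr ?mulr_gt0// => H.
  by move: h h0 H {hgap heta} => h h0 H; nra.
(* Raising [s] and lowering [r1] by the same factor preserves [s r1], hence the condition on [dphi],
   while [tau] drops from 1 to [exp (- h p)], as the lower bound requires. The cost is
   [ln s2 - ln s1 = h]. *)
pose x := r1 * expR (- h); pose s2 := s1 * expR h.
have s20 : 0 < s2 by rewrite mulr_gt0 ?expR_gt0.
have s2x : s2 * x = s1 * r1.
  by rewrite /s2 /x mulrACA -expRD subrr expR0 mulr1.
have s2p : s2 `^ p * expR (- (h * p)) = s1 `^ p.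
  rewrite /s2 powRM ?expR_ge0 ?ltW//.
  have -> : expR h `^ p = expR (h * p) by rewrite expRM.
  by rewrite -mulrA -expRD subrr expR0 mulr1.
have tau01 : 0 < expR (- (h * p)) < 1.
  by rewrite expR_gt0 -[ltRHS]expR0 ltr_expR oppr_lt0 mulr_gt0.
have dv2 : dphi p v = s2 * x by rewrite s2x.
have st2 : p * s2 `^ p * expR (- (h * p)) = v * s2 * x + 1.
  by rewrite -mulrA s2p st -(mulrA v s2 x) s2x mulrA.
have xr1 : x <= r1.
  by rewrite /x ler_piMr// -[leRHS]expR0 ler_expR oppr_le0 ltW.
have xr1' : r1 - e / 8 <= x.
  have := expR_ge1Dx (- h); move: (expR (- h)) @x {s2 s20 s2x s2p tau01 dv2 st2 xr1} => z x h1.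
  have := ler_wpM2l r10 h1; rewrite /x; lra.
have er2 : 0 < r2 - x by rewrite /r2; lra.
have h4 : 0 < eta / 4 by rewrite divr_gt0.
have g2 : 0 < gap / 2 by rewrite divr_gt0.
pose delta := Num.min (gap / 4) (eta / 4).
have delta0 : 0 < delta by rewrite lt_min h4 andbT divr_gt0.
have dgap : delta <= gap / 4 by rewrite !ge_min lexx.
have deta : delta <= eta / 4 by rewrite !ge_min lexx orbT.
have := point_lower v0 s20 tau01 dv2 st2 er2 delta0.
have -> : phi p v - ln s2 - v * s2 * x + s2 `^ p * expR (- (h * p)) - delta - kappa p =
    - G - h - delta.
  rewrite s2p /G /tilt_gain lnM ?posrE ?expR_gt0// expRK -(mulrA v s2 x) s2x mulrA.
  by move: (phi p v) (ln s1) (s1 `^ p) (kappa p) => *; ring.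
move=> HL; near=> n.
have N0 : 0 < n.+1%:R :> R by [].
have [j Hj] : exists j, ((expR (n.+1%:R * (- G - h - delta)))%:E <=
     P n [set y : W n | (`|X n j y - x| < r2 - x)%R])%E by near: n.
have Hu : (P n [set y : W n | (r2 <= M n y)%R] <= (expR (- (n.+1%:R * c)))%:E)%E.
  by near: n; exact: max_upper.
have half1 : expR (- (n.+1%:R * (gap / 2))) <= 2^-1 by near: n; exact: exp_half.
have half2 : expR (- (n.+1%:R * (eta / 4))) <= 2^-1 by near: n; exact: exp_half.
have mU : measurable [set y : W n | U (M n y)].
  by apply: (@measurable_M n U); exact: open_measurable.
have mr2 := measurable_M n (measurable_ray r2).
(* Closeness to [x] gives [X n j y > 2 x - r2], and [M] is at least [|X n j y|]; so [M] lies between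
   [2 x - r2] and [r2], inside the window around [r], unless it reaches [r2]. *)
have sub : [set y : W n | (`|X n j y - x| < r2 - x)%R] `<=`
    [set y | U (M n y)] `|` [set y | (r2 <= M n y)%R].
  move=> y /= Hy; have [r2M|Mr2] := leP r2 (M n y); [by right|left].
  apply: e2; rewrite ltr_norml.
  have := M_ub n j y; have := ler_norm (X n j y).
  move: Hy; rewrite ltr_norml => /andP[+ _].
  move: (X n j y) (M n y) Mr2 => a b; rewrite /r2; move: rr1 xr1' xr1 r1r e1 => *.
  by apply/andP; split; lra.
have mXj : measurable [set y : W n | (`|X n j y - x| < r2 - x)%R].
  have := @measurable_X n j [set z | `|z - x| < r2 - x]; apply.
  by rewrite -[X in measurable X]setTI; apply: measurable_fun_ltr => //;
     apply: measurableT_comp => //; exact: measurable_funB.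
have PU : (P n [set y : W n | (`|X n j y - x| < r2 - x)%R] <=
    P n [set y | U (M n y)] + P n [set y | (r2 <= M n y)%R])%E.
  apply: le_trans (measureU2 _ mU mr2).
  by apply: le_measure; rewrite ?inE//; exact: measurableU.
have PUfin : P n [set y | U (M n y)] \is a fin_num by rewrite fin_num_measure.
have Prfin : P n [set y | (r2 <= M n y)%R] \is a fin_num by rewrite fin_num_measure.
have {Hj}Hj := le_trans Hj PU.
move: PUfin Prfin Hu Hj; case: (P n _) => [a| |]// _; case: (P n _) => [b| |]// _.
rewrite !lee_fin => Hu Hj.
have H1 : expR (- (n.+1%:R * c)) <= expR (n.+1%:R * (- G - h - delta)) * 2^-1.
  apply: (@le_trans _ _ (expR (n.+1%:R * (- G - h - delta)) * expR (- (n.+1%:R * (gap / 2)))));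
      last first.
    by rewrite ler_wpM2l ?expR_ge0.
  rewrite -expRD ler_expR -!mulrN -mulrDr ler_pM2l// /c.
  by lra.
have H2 : expR (n.+1%:R * (- (fine (tilt_rate p r) + eta))) <=
    expR (n.+1%:R * (- G - h - delta)) * 2^-1.
  apply: (@le_trans _ _ (expR (n.+1%:R * (- G - h - delta)) * expR (- (n.+1%:R * (eta / 4)))));
      last first.
    by rewrite ler_wpM2l ?expR_ge0.
  rewrite -expRD ler_expR -(mulrN _ (eta / 4)) -mulrDr ler_pM2l//.
  by lra.
apply: (le_trans H2); move: Hu Hj H1.
by move: (expR _) (expR _) => z1 z2; lra.
Unshelve. all: by end_near. Qed.

Definition half_line_rate (r : R) : \bar R := if 0 <= r then tilt_rate p r else +oo%E.

Lemma borel_measurableR (B : set R) : <<s @open R >> B ->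
  measurable (B : set (measurableTypeR R)).
Proof.
apply: (@smallest_sub _ _ _ (@measurable _ (measurableTypeR R))) => //.
  exact: sigma_algebra_measurable.
by move=> A oA; exact: open_measurable.
Qed.

Lemma max_LDP : LDP P M (fun n => n.+1%:R) half_line_rate.
Proof.
have kp n : (0 < k n.+1)%N by have /andP[] := k_bounds (ltn0Sn n).
have M0 n x : 0 <= M n x.
  by rewrite (le_trans _ (M_ub n (Ordinal (kp n)) x)).
split.
  by move=> x; rewrite /half_line_rate; case: ifP => // _; exact: tilt_rate_ge0.
move=> B sB; have mB := borel_measurableR sB; split; last 2 first.
- exact: limn_einf_sup.
- set F := closure B.
  have [[b Fb]|Fempty] := pselect (exists b, F b /\ 0 <= b); last first.
    apply: (@le_trans _ _ -oo%E); last exact: leNye.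
    apply: limn_esup_ub; apply: nearW => n.
    have -> : M n @^-1` B = set0.
      apply/seteqP; split => // x /= Bx; apply: Fempty; exists (M n x); split => //.
      exact: subset_closure.
    by rewrite measure0 /= lexx/= gt0_muleNy// lte_fin invr_gt0.
  (* The closed set [F0] has a least element [r0], and [B] forces [M >= r0] because [M] is
     nonnegative. The tail bound at [r0] is enough, without any monotonicity of the rate. *)
  pose F0 := F `&` [set x | 0 <= x].
  have cF0 : closed F0.
    by apply: closedI; [exact: closed_closure|exact: closed_ge].
  have hF0 : has_inf F0.
    by split; [exists b|exists 0 => x []].
  pose r0 := inf F0.
  have F0r0 : F0 r0.
    by apply: cF0; exact: inf_closure.
  apply: (@le_trans _ _ (- half_line_rate r0)%E); last first.
    by rewrite leeN2; apply: ereal_inf_lbound; exists r0 => //; case: F0r0.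
  have [_ r00] := F0r0.
  rewrite /half_line_rate r00 leeNr; apply: lee_dense => c cr0.
  rewrite leeNr -EFinN; apply: limn_esup_ub.
  have := max_upper cr0 r00; apply: filterS => n H; apply: lne_le_exp => //.
  rewrite mulrN; apply: le_trans H; apply: le_measure; rewrite ?inE.
  - exact: (measurable_M n mB).
  - exact: (measurable_M n (measurable_ray r0)).
  - move=> x /= Bx; apply: ge_inf; first by have [] := hF0.
    by split => //=; exact: subset_closure.
- rewrite leeNl; apply: le_ereal_inf_tmp => _ [r Ur <-]; rewrite leeNl.
  rewrite /half_line_rate; have [r0|_] := boolP (0 <= r); last by rewrite leNye.
  have [rfin|] := boolP (tilt_rate p r < +oo)%E; last by rewrite -leNgt leye_eq => /eqP->;
      rewrite leNye.
  have fin : tilt_rate p r \is a fin_num by rewrite ge0_fin_numE ?tilt_rate_ge0.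
  rewrite -(fineK fin); apply/lee_subgt0Pr => eta eta0.
  rewrite -EFinN -EFinB; apply: limn_einf_lb.
  have := max_lower (@open_interior _ B) Ur r0 rfin eta0.
  apply: filterS => n H; apply: exp_le_lne => //.
  rewrite -opprD; apply: (le_trans H); apply: le_measure; rewrite ?inE.
  - by apply: (@measurable_M n (interior B)); apply: open_measurable; exact: open_interior.
  - exact: (measurable_M n mB).
  - by move=> x /=; exact: interior_subset.
Qed.

End max_deviations.

(** * Rotation invariance of Gaussian vectors *)

Section affine.
Context {R : realType}.
Local Notation mu := (@lebesgue_measure R).
Local Open Scope ereal_scope.

Lemma ge0_integral_affine (f : R -> \bar R) (a c : R) : c != 0%R ->
  measurable_fun setT f -> (forall x, 0 <= f x) ->
  `|c|%:E * \int[mu]_x f (c * x + a)%R = \int[mu]_x f x.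
Proof.
move=> c0 mf f0.
have mfa : measurable_fun setT (fun x : R => f (x + a)%R).
  by apply: measurableT_comp => //; exact: measurable_funD.
rewrite -(ge0_integral_shift a mf)//.
move: c0; rewrite neq_lt => /orP[c0|c0].
  rewrite -[RHS](ge0_integral_opp mfa)//.
  have mfo : measurable_fun setT (fun x : R => f (- x + a)%R).
    apply: (measurableT_comp mfa); exact: measurable_funN.
  rewrite -[RHS](@ge0_integral_scale _ _ (- c))// ?oppr_gt0//.
  by rewrite ltr0_norm//; under [in RHS]eq_integral do rewrite mulNr opprK.
by rewrite -[RHS](@ge0_integral_scale _ _ c)// gtr0_norm.
Qed.

End affine.

Lemma rotation_coordinate (R : fieldType) (c s u w : R) : c ^+ 2 + s ^+ 2 = 1 -> c != 0 ->
  (u - s * (c * w + s * u)) / c = c * u - s * w.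
Proof.
move=> cs1 c0; apply: (mulIf c0); rewrite mulfVK// -[X in X - _]mul1r -cs1; ring.
Qed.

Section rotation.
Context {R : realType}.
Local Notation mu := (@lebesgue_measure R).
Local Notation T1 := (measurableTypeR R).
Local Notation T2 := (measurableTypeR R * measurableTypeR R)%type.
Local Open Scope ereal_scope.

Lemma tonelli_swap (G : T1 * T1 -> \bar R) :
  measurable_fun setT G -> (forall t, 0 <= G t) ->
  \int[mu]_x \int[mu]_y G (x, y) = \int[mu]_y \int[mu]_x G (x, y).
Proof. by move=> mG G0; exact: (@fubini_tonelli _ _ T1 T1 R mu mu). Qed.

Variables (h : T2 -> \bar R).
Hypothesis mh : measurable_fun setT h.
Hypothesis h0 : forall t, 0 <= h t.

Let lin (a b : R) (q : T1 * T1) : T1 := (a * q.1 + b * q.2)%R.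

Let mlin a b : measurable_fun setT (lin a b).
Proof.
by apply: measurable_funD; apply: measurable_funM.
Qed.

Let sq (a b c d : R) (q : T1 * T1) : T1 := (lin a b q ^+ 2 + lin c d q ^+ 2)%R.

Let mcomp a b a1 b1 a2 b2 :
  measurable_fun setT (fun q : T1 * T1 => h (lin a b q, sq a1 b1 a2 b2 q)).
Proof.
apply: measurableT_comp => //; apply: measurable_fun_pair; first exact: mlin.
by apply: measurable_funD; apply: measurable_funX; exact: mlin.
Qed.

(* The rotation is written as two successive affine substitutions in one
   variable each, the other one being frozen; the Jacobians [c^-1] and [c]
   cancel. *)
Lemma integral_rotation_unit (r c s : R) : (c ^+ 2 + s ^+ 2 = 1)%R ->
  \int[mu]_x \int[mu]_y h (r * (c * x + s * y), x ^+ 2 + y ^+ 2)%R =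
  \int[mu]_x \int[mu]_y h (r * x, x ^+ 2 + y ^+ 2)%R.
Proof.
move=> cs1.
have [c0|c0] := eqVneq c 0%R.
  move: cs1; rewrite c0 expr0n add0r => s1.
  have ss : (`|s| = 1)%R.
    by apply/eqP; rewrite -(@eqrXn2 _ 2)// ?normr_ge0// real_normK ?num_real// s1 expr1n.
  transitivity (\int[mu]_x \int[mu]_y h (r * s * y, x ^+ 2 + (s * y) ^+ 2)%R).
    apply: eq_integral => x _; apply: eq_integral => y _.
    by rewrite mul0r add0r mulrA exprMn s1 mul1r.
  transitivity (\int[mu]_x \int[mu]_y h (r * y, x ^+ 2 + y ^+ 2)%R).
    apply: eq_integral => x _.
    rewrite -[RHS](@ge0_integral_affine _ (fun y => h (r * y, x ^+ 2 + y ^+ 2)%R) 0 s)//.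
    - rewrite ss mul1e; apply: eq_integral => y _; by rewrite addr0 mulrA.
    - by rewrite -normr_eq0 ss oner_neq0.
    - have := measurableT_comp (mcomp 0 r 1 0 0 1) (measurable_pair1 x).
      congr measurable_fun; apply/funext => y /=.
      by rewrite /sq /lin/= !mul0r !mul1r !add0r !addr0.
  have := @tonelli_swap (fun q => h (lin 0 r q, sq 1 0 0 1 q)) (mcomp 0 r 1 0 0 1) (fun=> h0 _).
  rewrite /sq /lin /= => H; transitivity (\int[mu]_x \int[mu]_y
      h (0 * x + r * y, (1 * x + 0 * y) ^+ 2 + (0 * x + 1 * y) ^+ 2)%R).
    apply: eq_integral => x _; apply: eq_integral => y _.
    by rewrite !mul0r !mul1r !add0r !addr0.
  rewrite H; apply: eq_integral => y _; apply: eq_integral => x _.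
  by rewrite !mul0r !mul1r !add0r !addr0 addrC.
pose G (q : T1 * T1) := h (r * q.1, ((q.1 - s * q.2) / c) ^+ 2 + q.2 ^+ 2)%R.
have GE : G = (fun q => h (lin r 0 q, sq (c^-1) (- (s / c)) 0 1 q)).
  apply/funext => q; rewrite /G /sq /lin; congr (h (_, _ ^+ 2 + _ ^+ 2)%R).
  - by rewrite mul0r addr0.
  - by rewrite mulrBl mulNr mulrAC (mulrC _ q.1).
  - by rewrite mul0r add0r mul1r.
have mG : measurable_fun setT G by rewrite GE.
have G0 q : 0 <= G q by exact: h0.
have c0' : 0 < `|c|%:E :> \bar R by rewrite lte_fin normr_gt0.
have kV : (`|c|^-1)%:E * `|c|%:E = 1 :> \bar R by rewrite -EFinM mulVf// normr_eq0.
have swap1 := @tonelli_swap (fun q => h (lin (r * c) (r * s) q, sq 1 0 0 1 q))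
   (mcomp (r * c) (r * s) 1 0 0 1) (fun=> h0 _).
transitivity (\int[mu]_y \int[mu]_x h (r * (c * x + s * y), x ^+ 2 + y ^+ 2)%R).
  transitivity (\int[mu]_x \int[mu]_y
    (fun q => h (lin (r * c) (r * s) q, sq 1 0 0 1 q)) (x, y)).
    apply: eq_integral => x _; apply: eq_integral => y _.
    by rewrite /sq /lin /= !mul0r !mul1r !addr0 !add0r mulrDr !mulrA.
  rewrite swap1; apply: eq_integral => x _; apply: eq_integral => y _.
  by rewrite /sq /lin /= !mul0r !mul1r !addr0 !add0r mulrDr !mulrA.
have step1 y : \int[mu]_x h (r * (c * x + s * y), x ^+ 2 + y ^+ 2)%R =
    (`|c|^-1)%:E * \int[mu]_u G (u, y).
  have mGy' : measurable_fun setT (fun u : T1 => G (u, y)).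
    exact: (measurableT_comp mG (measurable_pair2 y)).
  rewrite -[in RHS](ge0_integral_affine (s * y) c0 mGy' (fun u => G0 (u, y))).
  rewrite muleA kV mul1e; apply: eq_integral => x _.
  by rewrite /G /= addrK mulrAC divff// mul1r.
under eq_integral do rewrite step1.
have mGy : measurable_fun setT (fun y : T1 => \int[mu]_u G (u, y)).
  exact: (@measurable_fun_fubini_tonelli_G _ _ T1 T1 R mu G mG).
have cV0 : 0 <= (`|c|^-1)%:E by rewrite lee_fin invr_ge0.
have gy0 y : setT y -> 0 <= \int[mu]_u G (u, y).
  by move=> _; apply: integral_ge0 => u _; exact: G0.
rewrite (ge0_integralZl _ measurableT mGy gy0 cV0).
rewrite -(tonelli_swap mG G0).
have step2 u : \int[mu]_y G (u, y) = `|c|%:E * \int[mu]_w h (r * u, u ^+ 2 + w ^+ 2)%R.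
  have mGu : measurable_fun setT (fun y : T1 => G (u, y)).
    exact: (measurableT_comp mG (measurable_pair1 u)).
  rewrite -[LHS](ge0_integral_affine (s * u) c0 mGu (fun y => G0 (u, y))).
  congr (_ * _); apply: eq_integral => w _; rewrite /G /=; congr (h (_, _)).
  rewrite (rotation_coordinate _ _ cs1 c0).
  transitivity ((c ^+ 2 + s ^+ 2) * (u ^+ 2 + w ^+ 2))%R; first by ring.
  by rewrite cs1 mul1r.
under eq_integral do rewrite step2.
have mK : measurable_fun setT (fun u : T1 => \int[mu]_w h (r * u, u ^+ 2 + w ^+ 2)%R).
  have := @measurable_fun_fubini_tonelli_F _ _ T1 T1 R mu _ (mcomp r 0 1 0 0 1) (fun=> h0 _).
  congr measurable_fun; apply/funext => u; apply: eq_integral => w _.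
  by rewrite /sq /lin /= !mul0r !mul1r !addr0 !add0r.
have k0 u : setT u -> 0 <= \int[mu]_w h (r * u, u ^+ 2 + w ^+ 2)%R.
  by move=> _; apply: integral_ge0 => w _; exact: h0.
rewrite (ge0_integralZl _ measurableT mK k0 (ltW c0')).
by rewrite muleA kV mul1e.
Qed.

Lemma integral_rotation (c s : R) :
  \int[mu]_x \int[mu]_y h (c * x + s * y, x ^+ 2 + y ^+ 2)%R =
  \int[mu]_x \int[mu]_y h (Num.sqrt (c ^+ 2 + s ^+ 2) * x, x ^+ 2 + y ^+ 2)%R.
Proof.
set r := Num.sqrt _.
have r2 : (r ^+ 2 = c ^+ 2 + s ^+ 2)%R by rewrite sqr_sqrtr// addr_ge0// sqr_ge0.
have [r0|r0] := eqVneq r 0%R.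
  move: r2; rewrite r0 expr0n => /esym/eqP.
  rewrite paddr_eq0; [|exact: sqr_ge0..]; rewrite !sqrf_eq0 => /andP[/eqP-> /eqP->].
  by apply: eq_integral => x _; apply: eq_integral => y _; rewrite !mul0r addr0.
rewrite -(@integral_rotation_unit r (c / r) (s / r)); last first.
  by rewrite !exprMn -mulrDl -r2 exprVn mulfV// expf_neq0.
apply: eq_integral => x _; apply: eq_integral => y _; congr (h (_, _)).
by field.
Qed.

End rotation.

Section slice_rotation.
Context {R : realType}.
Local Notation mu := (@lebesgue_measure R).
Local Notation T2 := (measurableTypeR R * measurableTypeR R)%type.
Local Notation J := (slice_integral 2).

Lemma norm_powR2 (x : R) : `|x| `^ 2 = x ^+ 2.
Proof. by rewrite powR_mulrn// real_normK ?num_real. Qed.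

Definition axis (r : R) (i : nat) : R := if i == 0%N then r else 0.

(** For exponent 2 the second coordinate is rotation invariant. The induction turns the tail of [u]
    onto its first axis, so only planar rotations occur. *)
Lemma slice_rotation n (u : nat -> R) (f : T2 -> \bar R) t :
  measurable_fun setT f -> (forall t, 0 <= f t)%E ->
  J n u f t = J n (axis (Num.sqrt (\sum_(i < n) u i ^+ 2))) f t.
Proof.
move=> mf f0; elim: n u t => [|n IH] u t //=.
under eq_integral do rewrite IH norm_powR2.
under [RHS]eq_integral do rewrite norm_powR2.
rewrite big_ord_recl /=; set r := Num.sqrt (\sum_(i < n) u i.+1 ^+ 2).
have -> : \sum_(i < n) u (lift ord0 i) ^+ 2 = r ^+ 2.
  by rewrite sqr_sqrtr//; apply: sumr_ge0 => i _; exact: sqr_ge0.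
(* In dimension one a negative [u 0] is handled by a reflection; otherwise one planar rotation
   merges [u 0] with the norm of the tail. *)
rewrite /axis eqxx; case: n @r {IH} => [|n] r /=.
  have -> : r = 0 by rewrite /r big_ord0 sqrtr0.
  rewrite expr0n addr0 sqrtr_sqr; have [u0|u0] := leP 0 (u 0%N); first by rewrite ger0_norm.
  rewrite (ltr0_norm u0).
  rewrite -ge0_integral_opp.
  - by apply: eq_integral => x _; rewrite mulrN mulNr sqrrN.
  - have := measurable_slice_x 2 0 (axis 0) (u 0%N) t mf f0.
    by congr measurable_fun; apply/funext => x /=; rewrite norm_powR2.
  - by move=> x; exact: f0.
pose h (q : T2) := J n (axis 0) f (t.1 + q.1, t.2 + q.2).
have mh : measurable_fun setT h.
  apply: measurableT_comp; first exact: measurable_slice.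
  by apply: measurable_fun_pair; exact: measurable_funD.
have h0 q : (0 <= h q)%E by exact: slice_ge0.
have ax0 : (fun i => if i.+1 == 0%N then r else 0) = axis 0.
  by apply/funext => i; rewrite /axis /=; case: ifP.
transitivity (\int[mu]_x \int[mu]_y h (u 0%N * x + r * y, x ^+ 2 + y ^+ 2)%R)%E.
  apply: eq_integral => x _; apply: eq_integral => y _.
  rewrite /h norm_powR2 /= !addrA; congr (slice_integral _ _ _ _ _).
  by apply/funext => i; rewrite /axis /=; case: ifP.
rewrite (integral_rotation mh h0).
apply: eq_integral => x _; apply: eq_integral => y _.
rewrite /h norm_powR2 /= !addrA mul0r addr0; congr (slice_integral _ _ _ _ _).
by apply/funext => i; rewrite /axis /=; case: ifP.
Qed.

(** [slice_integral] peels off the first coordinate, whereas the Gaussian induction integrates out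
    the last one. *)
Lemma slice_last (p : R) n (th : nat -> R) (f : T2 -> \bar R) t :
  slice_integral p n.+1 th f t = slice_integral p n th
    (fun t => \int[mu]_x f (t.1 + th n * x, t.2 + `|x| `^ p)%R)%E t.
Proof.
elim: n th t => [|n IH] th t //.
by apply: eq_integral => x _; exact: IH.
Qed.

End slice_rotation.

Section gauss_slice.
Context {R : realType} d (O : measurableType d) (Q : probability O R).
Variables (g : nat -> {RV Q >-> R}) (g_iid : iid_standard_gaussian g).
Local Notation mu := (@lebesgue_measure R).
Local Notation N := (normal_prob 0 1 : probability (measurableTypeR R) R).
Local Notation T2 := (measurableTypeR R * measurableTypeR R)%type.
Local Notation J := (slice_integral 2).

Definition gauss_sums (n : nat) (u : nat -> R) (x : O) : T2 :=
  (\sum_(i < n) u i * g i x, \sum_(i < n) g i x ^+ 2).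

Lemma measurable_gauss_sums n u : @measurable_fun _ _ (other_space g n) T2 setT (gauss_sums n u).
Proof.
have mg (i : 'I_n) : @measurable_fun _ _ (other_space g n) R setT (g i).
  by apply: measurable_other_g; rewrite neq_ltn ltn_ord.
apply: measurable_fun_pair.
  by apply: (@measurable_sum _ (other_space g n)) => i; apply: measurable_funM => //;
      exact: measurable_cst.
by apply: (@measurable_sum _ (other_space g n)) => i; apply: measurable_funX.
Qed.

Let C : R := (gauss_const 2^-1)^-1.

Definition gauss_density (n : nat) (t : T2) : \bar R := (C ^+ n * expR (- (2^-1 * t.2)))%:E.

Lemma measurable_gauss_density n : measurable_fun setT (gauss_density n).
Proof.
apply/measurable_EFinP; apply: measurable_funM => //; apply: measurableT_comp => //.
apply: measurableT_comp => //; apply: measurable_funM => //; exact: measurable_snd.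
Qed.

(** The Gaussian density depends on the vector only through the sum of squares, which is the second
    coordinate of the slice integral with exponent 2. *)
Lemma gauss_slice n (u : nat -> R) (F : T2 -> \bar R) :
  measurable_fun setT F -> (forall t, 0 <= F t)%E ->
  (\int[Q]_x F (gauss_sums n u x) = J n u (fun t => F t * gauss_density n t) (0, 0)%R)%E.
Proof.
elim: n F => [|n IH] F mF F0.
  rewrite /gauss_sums; under eq_integral do rewrite !big_ord0.
  rewrite integral_cst//= probability_setT mule1 /gauss_density expr0 mul1r mulr0.
  by rewrite oppr0 expR0 mule1.
pose F1 (q : T2 * measurableTypeR R) := F (q.1.1 + u n * q.2, q.1.2 + q.2 ^+ 2).
have mF1 : measurable_fun setT F1.
  have := measurableT_comp mF (measurable_slice_step 2 (u n)).
  by congr measurable_fun; apply/funext => q; rewrite /F1/= norm_powR2.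
have F10 q : (0 <= F1 q)%E by exact: F0.
transitivity (\int[Q]_x F1 (gauss_sums n u x, g n x))%E.
  by apply: eq_integral => x _; rewrite /F1 /gauss_sums /= !big_ord_recr.
rewrite (integral_other g_iid (measurable_gauss_sums u) mF1 F10).
pose F2 (t : T2) := (\int[N]_z F1 (t, z))%E.
have mF2 : measurable_fun setT F2.
  exact: (@measurable_fun_fubini_tonelli_F _ _ T2 (measurableTypeR R) R N F1 mF1 F10).
have F20 t : (0 <= F2 t)%E by apply: integral_ge0.
rewrite (IH F2 mF2 F20) slice_last; congr slice_integral; apply/funext => t.
have mF1t : measurable_fun setT (fun z : measurableTypeR R => F1 (t, z)).
  exact: (measurableT_comp mF1 (measurable_pair1 t)).
rewrite /F2 (ge0_integral_normal mF1t (fun z => F10 (t, z))).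
have C0 : 0 < C by rewrite invr_gt0 gauss_const_gt0// invr_gt0.
have d0 : (0 <= gauss_density n t)%E by rewrite lee_fin mulr_ge0 ?exprn_ge0 ?expR_ge0 ?ltW.
rewrite muleC -ge0_integralZl//; last 2 first.
- apply: emeasurable_funM => //; apply/measurable_EFinP; exact: measurable_normal_pdf.
- by move=> z _; rewrite mule_ge0// lee_fin normal_pdf_ge0.
apply: eq_integral => z _; rewrite /F1 /= norm_powR2 muleCA; congr (_ * _)%E.
rewrite /gauss_density -EFinM normal_pdf01E -/C /=; congr EFin.
rewrite [C ^+ n.+1]exprSr mulrDr opprD expRD.
by ring.
Qed.

End gauss_slice.

(** * Gaussian concentration *)

Section exponential_deviations.
Context {R : realType} {d : measure_display} {O : measurableType d}.
Variables (Q : probability O R) (g : nat -> {RV Q >-> R}).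
Hypothesis g_iid : iid_standard_gaussian g.
Local Notation N := (normal_prob 0 1 : probability (measurableTypeR R) R).

Lemma expR_le_quadratic (x : R) : expR x <= 1 + x + x ^+ 2 * expR `|x|.
Proof.
have [x0|x0] := leP 0 x.
  rewrite (ger0_norm x0).
  have [x1|x1] := leP 1 x.
    have h : expR x <= x ^+ 2 * expR x by rewrite ler_peMl ?expR_ge0// expr_ge1.
    by rewrite (le_trans h)// lerDr addr_ge0.
  have h1 : (1 - x) * expR x <= 1.
    have := expR_ge1Dx (- x); rewrite expRN -(ler_pM2r (expR_gt0 x)).
    by rewrite mulVf// gt_eqF// expR_gt0.
  have h2 : 0 <= 1 + x by rewrite addr_ge0.
  by have := ler_wpM2l h2 h1; move: (expR x) => z; lra.
rewrite (ltr0_norm x0).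
have h1 : 1 <= expR (- x) by rewrite -[leLHS]expR0 ler_expR oppr_ge0 ltW.
have h2 := expR_ge1Dx (- x).
have h3 : expR x * expR (- x) = 1 by rewrite -expRD subrr expR0.
have h4 : expR x <= 1 + x + x ^+ 2.
  rewrite -(ler_pM2r (expR_gt0 (- x))) h3.
  have h5 : 0 <= 1 + x + x ^+ 2 by nra.
  apply: le_trans (ler_wpM2l h5 h2).
  have -> : (1 + x + x ^+ 2) * (1 + - x) = 1 - x ^+ 3 by ring.
  have : x ^+ 3 <= 0 by rewrite exprS nmulr_rle0// sqr_ge0.
  lra.
apply: (le_trans h4); rewrite lerD2l ler_peMr ?sqr_ge0//.
Qed.

Definition gauss_sum (f : R -> R) (n : nat) (x : O) : R := \sum_(i < n) f (g i x).

Lemma measurable_gauss_sum_other (f : R -> R) n : measurable_fun setT f ->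
  @measurable_fun _ _ (other_space g n) (measurableTypeR R) setT (gauss_sum f n).
Proof.
move=> mf; apply: (@measurable_sum _ (other_space g n)) => i.
by apply: measurableT_comp => //; apply: measurable_other_g; rewrite neq_ltn ltn_ord.
Qed.

Lemma measurable_gauss_sum (f : R -> R) n : measurable_fun setT f ->
    measurable_fun setT (gauss_sum f n).
Proof. by move=> mf; exact: (other_mfun (@measurable_gauss_sum_other f n mf)). Qed.

Lemma gauss_sum_mgf (f : R -> R) (s K : R) n : measurable_fun setT f ->
  (\int[N]_z (expR (s * f z))%:E <= K%:E)%E ->
  (\int[Q]_x (expR (s * gauss_sum f n x))%:E <= (K ^+ n)%:E)%E.
Proof.
move=> mf fK; elim: n => [|n IH].
  rewrite /gauss_sum; under eq_integral do rewrite big_ord0 mulr0 expR0.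
  by rewrite integral_cst//= probability_setT mule1.
have K0 : (0 <= K%:E)%E by apply: le_trans fK; apply: integral_ge0 => z _; rewrite lee_fin expR_ge0.
have mef : measurable_fun setT (fun z : measurableTypeR R => (expR (s * f z))%:E).
  by apply/measurable_EFinP; apply: measurableT_comp => //; exact: measurable_funM.
pose F (q : measurableTypeR R * measurableTypeR R) : \bar R :=
  ((expR (s * q.1))%:E * (expR (s * f q.2))%:E)%E.
have mF : measurable_fun setT F.
  apply: emeasurable_funM; last exact: (measurableT_comp mef measurable_snd).
  by apply/measurable_EFinP; apply: measurableT_comp => //; exact: measurable_funM.
have F0 q : (0 <= F q)%E by rewrite mule_ge0// lee_fin expR_ge0.
have mS := @measurable_gauss_sum_other f n mf.
have -> : (\int[Q]_x (expR (s * gauss_sum f n.+1 x))%:E = \int[Q]_x F (gauss_sum f n x, g n x))%E.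
  apply: eq_integral => x _; rewrite /F /= -EFinM -expRD -mulrDr; congr (expR (s * _))%:E.
  by rewrite /gauss_sum big_ord_recr.
rewrite (integral_other g_iid mS mF F0).
apply: (@le_trans _ _ (\int[Q]_x (K%:E * (expR (s * gauss_sum f n x))%:E))%E).
  apply: integral_mono => x; rewrite /F /= ge0_integralZl//.
  by rewrite muleC; apply: lee_wpmul2r => //; rewrite lee_fin expR_ge0.
have mSn : measurable_fun setT (fun x => (expR (s * gauss_sum f n x))%:E : \bar R).
  apply/measurable_EFinP; apply: measurableT_comp => //; apply: measurable_funM => //.
  exact: measurable_gauss_sum.
rewrite ge0_integralZl//.
by rewrite exprS EFinM; exact: lee_wpmul2l.
Qed.

Lemma gauss_sum_chernoff (f : R -> R) (s K a : R) n : 0 <= s -> measurable_fun setT f ->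
  (\int[N]_z (expR (s * f z))%:E <= K%:E)%E ->
  (Q [set x | (n%:R * a <= gauss_sum f n x)%R] <= ((K * expR (- (s * a))) ^+ n)%:E)%E.
Proof.
move=> s0 mf fK; have H := gauss_sum_mgf n mf fK.
set A := [set x | _].
have mA : measurable A.
  rewrite -[X in measurable X]setTI; apply: measurable_fun_ler => //.
  exact: measurable_gauss_sum.
have -> : (Q A = \int[Q]_x (\1_A x)%:E)%E by rewrite integral_indic// setIT.
apply: (@le_trans _ _ (\int[Q]_x ((expR (- (s * (n%:R * a))))%:E * (expR (s * gauss_sum f n
    x))%:E))%E).
  apply: integral_mono => x; rewrite indicE -EFinM lee_fin -expRD.
  have [Ax|_] := boolP (x \in A); last exact: expR_ge0.
  rewrite -[leLHS]expR0 ler_expR; have := set_mem Ax; rewrite /A /= => h.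
  by have := ler_wpM2l s0 h; lra.
have mE : measurable_fun setT (fun x => (expR (s * gauss_sum f n x))%:E : \bar R).
  apply/measurable_EFinP; apply: measurableT_comp => //; apply: measurable_funM => //.
  exact: measurable_gauss_sum.
rewrite ge0_integralZl//.
rewrite exprMn [(K ^+ n * _)%R]mulrC EFinM.
have -> : expR (- (s * a)) ^+ n = expR (- (s * (n%:R * a))).
  by rewrite -expRM_natl; congr expR; ring.
by apply: lee_wpmul2l => //; rewrite lee_fin expR_ge0.
Qed.

Lemma normal_mgf_le (f : R -> R) (C m e : R) : measurable_fun setT f -> 0 < C -> 0 < e ->
  (forall z, `|f z| <= C * (1 + z ^+ 2)) -> (\int[N]_z (f z)%:E = m%:E)%E ->
  exists2 s, 0 < s & (\int[N]_z (expR (s * f z))%:E <= (expR (s * (m + e)))%:E)%E.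
Proof.
move=> mf C0 e0 fC fm.
(* With [y = 1 + z^2] and [s C <= 1/8], the quadratic remainder divided by [s^2] is at most
   [C^2 y^2 exp (y / 8)]. Since [y^2 <= 128 exp (y / 8)], it is below [128 C^2 exp (y / 4)], which
   is integrable because [1/4 < 1/2]. *)
pose h (z : R) := 128 * C ^+ 2 * expR 4^-1 * expR (0 * z + 4^-1 * z ^+ 2).
have ih : N.-integrable setT (EFin \o h).
  rewrite (_ : EFin \o h = fun z => ((128 * C ^+ 2 * expR 4^-1)%:E *
      (expR (0 * z + 4^-1 * z ^+ 2))%:E)%E); last by apply/funext => z /=; rewrite EFinM.
  by apply: integrableZl => //; apply: normal_expR_integrable; rewrite ltf_pV2 ?posrE// ltr_nat.
have if_ : N.-integrable setT (EFin \o f).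
  apply: (@normal_poly_integrable _ f C 1) => // z; apply: (le_trans (fC z)).
  rewrite ler_pM2l// sqrrD expr1n mul1r real_normK ?num_real// lerD2r lerDl.
  by rewrite mulrn_wge0.
have h0 z : 0 <= h z.
  by rewrite /h mulr_ge0 ?expR_ge0// mulr_ge0 ?expR_ge0// mulr_ge0// sqr_ge0.
have Bfin : (\int[N]_z (h z)%:E)%E \is a fin_num by apply: integrable_fin_num.
pose B := fine (\int[N]_z (h z)%:E)%E.
have B0 : 0 <= B by rewrite fine_ge0//; apply: integral_ge0 => z _; rewrite lee_fin.
pose s := Num.min (8 * C)^-1 (e / (B + 1)).
have B1 : 0 < B + 1 by rewrite ltr_wpDl.
have s0 : 0 < s by rewrite lt_min invr_gt0 mulr_gt0//= divr_gt0.
have sC : s * C <= 8^-1.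
  have : s <= (8 * C)^-1 by rewrite ge_min lexx.
  by rewrite invfM -ler_pdivlMr.
have sB : s * B <= e.
  have : s <= e / (B + 1) by rewrite ge_min lexx orbT.
  rewrite ler_pdivlMr//; apply: le_trans; by rewrite ler_pM2l// lerDl.
exists s => //.
have pw z : expR (s * f z) <= 1 + s * f z + s ^+ 2 * h z.
  apply: (le_trans (expR_le_quadratic _)); rewrite lerD2l exprMn -mulrA ler_pM2l ?exprn_gt0//.
  have z1 : 0 <= 1 + z ^+ 2 by rewrite addr_ge0// sqr_ge0.
  have q1 : f z ^+ 2 <= C ^+ 2 * (1 + z ^+ 2) ^+ 2.
    rewrite -exprMn -real_normK ?num_real// lerXn2r ?nnegrE ?mulr_ge0// ltW//.
  have q2 : expR `|s * f z| <= expR (8^-1 * (1 + z ^+ 2)).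
    rewrite ler_expR normrM gtr0_norm//; apply: (le_trans (ler_wpM2l (ltW s0) (fC z))).
    by rewrite mulrA ler_wpM2r.
  have q3 : (1 + z ^+ 2) ^+ 2 <= 128 * expR (8^-1 * (1 + z ^+ 2)).
    have h8 : 0 <= 8^-1 :> R by [].
    have := expR_ge1Dxn 1 (mulr_ge0 h8 z1).
    have -> : 2`!%:R = 2 :> R by [].
    by rewrite exprMn; move: (expR _) ((1 + z ^+ 2) ^+ 2) => a b; lra.
  apply: (le_trans (ler_pM (sqr_ge0 _) (expR_ge0 _) q1 q2)).
  rewrite -mulrA (le_trans (ler_wpM2l (sqr_ge0 C) (ler_wpM2r (expR_ge0 _) q3)))//.
  rewrite le_eqVlt; apply/orP; left; apply/eqP.
  rewrite /h -[RHS]mulrA -expRD -[X in C ^+ 2 * X]mulrA -expRD mulrCA mulrA.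
  by congr (_ * expR _); field.
apply: (@le_trans _ _ (\int[N]_z ((1 + s * f z + s ^+ 2 * h z)%R)%:E)%E).
  by apply: integral_mono => z; rewrite lee_fin.
have i1 : N.-integrable setT (fun z => (1%:E + s%:E * (f z)%:E)%E).
  apply: integrableD => //; last exact: integrableZl.
  exact: finite_measure_integrable_cst.
have i2 : N.-integrable setT (fun z => ((s ^+ 2)%:E * (h z)%:E)%E) by exact: integrableZl.
have -> : (\int[N]_z ((1 + s * f z + s ^+ 2 * h z)%R)%:E =
    \int[N]_z ((1%:E + s%:E * (f z)%:E) + (s ^+ 2)%:E * (h z)%:E))%E.
  by apply: eq_integral => z _; rewrite -!EFinM -!EFinD.
rewrite integralD// integralD//; last 2 first.
- exact: finite_measure_integrable_cst.
- exact: integrableZl.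
rewrite !integralZl// fm integral_cst//= probability_setT mule1 -(fineK Bfin) -/B.
rewrite -!EFinM -!EFinD lee_fin; apply: le_trans (expR_ge1Dx _).
by have := ler_wpM2l (ltW s0) sB; rewrite mulrDr expr2; lra.
Qed.

Lemma gauss_sum_deviation (f : R -> R) (C m e : R) : measurable_fun setT f -> 0 < C -> 0 < e ->
  (forall z, `|f z| <= C * (1 + z ^+ 2)) -> (\int[N]_z (f z)%:E = m%:E)%E ->
  exists2 c, 0 < c & forall n,
    (Q [set x | (n%:R * (m + e) <= gauss_sum f n x)%R] <= (expR (- (n%:R * c)))%:E)%E.
Proof.
move=> mf C0 e0 fC fm; have e2 : 0 < e / 2 by rewrite divr_gt0.
have [s s0 H] := normal_mgf_le mf C0 e2 fC fm.
exists (s * (e / 2)); first by rewrite mulr_gt0.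
move=> n; apply: (le_trans (gauss_sum_chernoff (m + e) n (ltW s0) mf H)).
rewrite lee_fin -expRD -expRM_natl ler_expR -[leRHS]mulrN ler_wpM2l//.
by rewrite le_eqVlt; apply/orP; left; apply/eqP; field.
Qed.

Lemma gauss_const_sqr (c : R) : 0 < c -> gauss_const c ^+ 2 * c = pi.
Proof.
move=> c0; rewrite gauss_const.unlock /normal_peak invrK.
have c2 : 0 < (2 * c)^-1 by rewrite invr_gt0 mulr_gt0.
rewrite [Num.sqrt _ ^+ 2 * pi]mulrC sqr_sqrtr ?ltW// sqr_sqrtr.
  by field; rewrite gt_eqF.
by rewrite mulrn_wge0// mulr_ge0 ?pi_ge0// ltW.
Qed.

(** The value is [(1 - 2 s)^(-1/2)], recorded through its square. *)
Lemma normal_sqr_mgf (s : R) : s < 2^-1 ->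
  exists2 K, K ^+ 2 * (1 - 2 * s) = 1 & (\int[N]_z (expR (s * z ^+ 2))%:E = K%:E)%E /\ 0 < K.
Proof.
move=> s2; have c0 : 0 < 2^-1 - s by rewrite subr_gt0.
have h0 : 0 < 2^-1 :> R by [].
exists (gauss_const (2^-1 - s) / gauss_const 2^-1).
  have := gauss_const_sqr c0; have := gauss_const_sqr h0; have := gauss_const_gt0 h0.
  have := pi_gt0 R; move: (gauss_const _) (gauss_const _) pi => a b q q0 a0 E1 E2.
  have a2 : a ^+ 2 = q / (2^-1 - s) by rewrite -E2 mulfK// gt_eqF.
  have b2 : b ^+ 2 = 2 * q by rewrite -E1; field.
  have -> : 1 - 2 * s = 2 * (2^-1 - s) by field.
  rewrite exprMn exprVn a2 b2; move: (2^-1 - s) c0 => w w0; field.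
  by rewrite !gt_eqF.
split; last by rewrite divr_gt0 ?gauss_const_gt0.
have ms : measurable_fun setT (fun z : R => (expR (s * z ^+ 2))%:E).
  by apply/measurable_EFinP; apply: measurableT_comp => //; apply: measurable_funM => //;
      exact: exprn_measurable.
rewrite ge0_integral_normal//.
transitivity (\int[@lebesgue_measure R]_z ((gauss_const 2^-1)^-1%:E *
    (expR (0 * z - (2^-1 - s) * z ^+ 2))%:E))%E.
  apply: eq_integral => z _; rewrite normal_pdf01E -!EFinM mulrCA -expRD; congr (_ * expR _)%:E.
  by ring.
rewrite integralZl//; last exact: gauss_integrable.
by rewrite gauss_integral// expr0n mul0r expR0 mul1r -EFinM mulrC.
Qed.

(** Read off from the Laplace transform of the square: [1 + s V <= E exp (s z^2)] gives
    [(1 + s V)^2 (1 - 2 s) <= 1]. The left side is [1 + 2 s (V - 1)] to first order, so small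
    positive [s] excludes [V > 1] and small negative [s] excludes [V < 1]. *)
Lemma normal_var1 : @normal_var R = 1%:E.
Proof.
have Vfin := @normal_var_fin R; rewrite -(fineK Vfin); congr EFin.
set V := fine _.
have V0 : 0 <= V by rewrite fine_ge0//; apply: integral_ge0 => z _; rewrite lee_fin sqr_ge0.
have iz : N.-integrable setT (fun z => (z ^+ 2)%:E).
  apply: (@normal_poly_integrable _ (fun z => z ^+ 2) 1 1); first exact: exprn_measurable.
  by move=> z; rewrite mul1r normrX lerXn2r ?nnegrE ?addr_ge0// lerDr.
have H (s : R) : s < 2^-1 -> 0 <= 1 + s * V -> (1 + s * V) ^+ 2 * (1 - 2 * s) <= 1.
  move=> s2 sV; have [K KE [IK K0]] := normal_sqr_mgf s2.
  rewrite -[leRHS]KE ler_wpM2r//; first by rewrite subr_ge0; lra.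
  rewrite lerXn2r ?nnegrE//; first exact: ltW.
  rewrite -lee_fin -IK.
  have -> : ((1 + s * V)%:E = \int[N]_z (1%:E + s%:E * (z ^+ 2)%:E))%E.
    rewrite integralD//; last 2 first.
    - exact: finite_measure_integrable_cst.
    - exact: integrableZl.
      have EV : (\int[N]_z (z ^+ 2)%:E)%E = V%:E by exact: (esym (fineK Vfin)).
    by rewrite integral_cst//= probability_setT mule1 integralZl// EV.
  by apply: integral_mono => z; rewrite -EFinM -EFinD lee_fin expR_ge1Dx.
apply/eqP; rewrite eq_le; apply/andP; split; rewrite leNgt; apply/negP => V1.
  pose s := Num.min 4^-1 ((V - 1) / (8 * (V + 1) ^+ 2)).
  have s0 : 0 < s by rewrite lt_min invr_gt0 ltr0n/= divr_gt0 ?subr_gt0// mulr_gt0// exprn_gt0//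
      ltr_wpDl.
  have s1 : s <= 4^-1 by rewrite ge_min lexx.
  have sV : s * (8 * (V + 1) ^+ 2) <= V - 1.
    by rewrite -ler_pdivlMr ?ge_min ?lexx ?orbT// mulr_gt0// exprn_gt0// ltr_wpDl.
  have := H s; move: s s0 s1 sV {iz Vfin} => s s0 s1 sV {}H.
  have {}H : (1 + s * V) ^+ 2 * (1 - 2 * s) <= 1 by apply: H; [lra|nra].
  have e : (1 + s * V) ^+ 2 * (1 - 2 * s) - 1 =
    s * (2 * (V - 1) - s * (4 * V - V ^+ 2) - 2 * s ^+ 2 * V ^+ 2) by ring.
  have : 0 < 2 * (V - 1) - s * (4 * V - V ^+ 2) - 2 * s ^+ 2 * V ^+ 2.
    have : s ^+ 2 * V ^+ 2 <= s * V ^+ 2 by rewrite ler_wpM2r ?sqr_ge0// expr2; nra.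
    nra.
  by move=> P; have := mulr_gt0 s0 P; lra.
pose s := Num.min 4^-1 ((1 - V) / 8).
have s0 : 0 < s by rewrite lt_min invr_gt0 ltr0n/= divr_gt0 ?subr_gt0.
have s1 : s <= 4^-1 by rewrite ge_min lexx.
have sV : s <= (1 - V) / 8 by rewrite ge_min lexx orbT.
have := H (- s); move: s s0 s1 sV {iz Vfin} => s s0 s1 sV {}H.
have {}H : (1 + - s * V) ^+ 2 * (1 - 2 * - s) <= 1 by apply: H; [lra|nra].
have e : (1 + - s * V) ^+ 2 * (1 - 2 * - s) - 1 =
  s * (2 * (1 - V) - s * (4 * V - V ^+ 2) + 2 * s ^+ 2 * V ^+ 2) by ring.
have : 0 < 2 * (1 - V) - s * (4 * V - V ^+ 2) + 2 * s ^+ 2 * V ^+ 2.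
  have h1 : 0 <= s ^+ 2 * V ^+ 2 by rewrite mulr_ge0 ?sqr_ge0.
  have h2 : s * (4 * V - V ^+ 2) <= 4 * s by nra.
  nra.
by move=> P; have := mulr_gt0 s0 P; lra.
Qed.

End exponential_deviations.

(** * Concentration for normalised Gaussian vectors *)

Section normalized_deviations.
Context {R : realType} {d : measure_display} {O : measurableType d}.
Variables (Q : probability O R) (g : nat -> {RV Q >-> R}).
Hypothesis g_iid : iid_standard_gaussian g.
Variables (p : R) (hp : 2 <= p).
Local Notation N := (normal_prob 0 1 : probability (measurableTypeR R) R).

Definition gauss_norm (n : nat) (x : O) : R := Num.sqrt (\sum_(i < n) g i x ^+ 2).

Lemma psi_quadratic (v : R) : exists2 C, 0 < C & forall z, `|psi p (v * z)| <= C * (1 + z ^+ 2).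
Proof.
set A := `|psi p 0| + `|@psi_const R| + v ^+ 2.
have A0 : 0 <= A by rewrite !addr_ge0// sqr_ge0.
exists (2 * A + 1) => [|z]; first by rewrite ltr_wpDl// mulr_ge0.
apply: (le_trans (psi_growth hp v z)); rewrite -/A.
rewrite sqrrD expr1n mul1r real_normK ?num_real//.
have h1 := sqr_ge0 (1 - `|z|); rewrite sqrrB expr1n mul1r real_normK ?num_real// in h1.
have h2 : 1 + `|z| *+ 2 + z ^+ 2 <= 2 * (1 + z ^+ 2).
  by move: h1; rewrite -mulr_natr; move: (`|z|) (z ^+ 2) => a b; lra.
apply: (le_trans (ler_wpM2l A0 h2)).
have := sqr_ge0 z; move: (z ^+ 2) => b b0.
by have := mulr_ge0 A0 b0; nra.
Qed.

Lemma integral_normalN (f : R -> R) (m : R) : N.-integrable setT (fun z => (f z)%:E) ->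
  (\int[N]_z (f z)%:E = m%:E)%E -> (\int[N]_z (- f z)%:E = (- m)%:E)%E.
Proof.
move=> fi fm; transitivity (\int[N]_z ((-1)%:E * (f z)%:E))%E.
  by apply: eq_integral => z _; rewrite -EFinM mulN1r.
by rewrite integralZl// fm -EFinM mulN1r.
Qed.

Lemma phi_near (v e : R) : 0 < e -> exists2 k, 0 < k < 1 &
  `|phi p (v * (1 - k)) - phi p v| < e /\ `|phi p (v * (1 + k)) - phi p v| < e.
Proof.
move=> e0.
have [h /= h0 H] : \forall w \near v, `|phi p v - phi p w| < e.
  by have := @continuous_phi R p hp v; move/cvgrPdist_lt => /(_ e e0).
pose k := Num.min 2^-1 (h / (2 * (`|v| + 1))).
have v1 : 0 < 2 * (`|v| + 1) by rewrite mulr_gt0// ltr_wpDl.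
have k0 : 0 < k by rewrite lt_min invr_gt0 ltr0n/= divr_gt0.
have vk : `|v * k| < h.
  rewrite normrM (gtr0_norm k0).
  have : k <= h / (2 * (`|v| + 1)) by rewrite ge_min lexx orbT.
  rewrite ler_pdivlMr//; have := normr_ge0 v; move: (`|v|) => a a0 kh.
  by have := mulr_ge0 (ltW k0) a0; nra.
have k1 : k < 1 by rewrite gt_min; apply/orP; left; rewrite invf_lt1// ltr1n.
exists k; first by rewrite k0.
split; rewrite distrC; apply: H; rewrite /ball_ /=.
  by have -> : v - v * (1 - k) = v * k by ring.
by have -> : v - v * (1 + k) = - (v * k); [ring|rewrite normrN].
Qed.

(** The factor [sqrt n / |g|] stays within [k] of 1 except with exponentially small probability. As
    [psi] increases with the absolute value, the normalised mean is then squeezed between sums of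
    independent terms at [v (1 - k)] and [v (1 + k)], and [phi] is continuous. Four Chernoff events
    in all. *)
Lemma normalized_deviation (v e : R) : 0 < e -> exists2 c, 0 < c &
  forall n, (0 < n)%N -> exists2 A, measurable A &
    [set x | e <= `|psi_mean p n (fun i => Num.sqrt n%:R * (g i x / gauss_norm n x)) v
                    - phi p v|] `<=` A /\ (Q A <= (4 * expR (- (n%:R * c)))%:E)%E.
Proof.
move=> e0; have e2 : 0 < e / 2 by rewrite divr_gt0.
have [k /andP[k0 k1] [H1 H2]] := phi_near v e2.
pose l1 := 1 - k; pose l2 := 1 + k.
have l10 : 0 < l1 by rewrite subr_gt0.
have l20 : 0 < l2 by rewrite addr_gt0.
have l1_1 : l1 ^+ 2 < 1 by rewrite expr_lt1// ?ltW// /l1; lra.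
have l2_1 : 1 < l2 ^+ 2 by rewrite expr_gt1// ?ltW// /l2; lra.
have l1s : 0 < l1 ^+ 2 by rewrite exprn_gt0.
have l2s : 0 < l2 ^+ 2 by rewrite exprn_gt0.
have [C2 C20 G2] := psi_quadratic (v * l2).
have [C1 C10 G1] := psi_quadratic (v * l1).
have mpsi (w : R) : measurable_fun setT (fun z : R => psi p (w * z)) by exact: measurable_psiM.
have msq : measurable_fun setT (fun z : R => z ^+ 2) by exact: exprn_measurable.
have E2 := esym (EFin_phi hp (v * l2)).
have E1 : (\int[N]_z (- psi p (v * l1 * z))%:E = (- phi p (v * l1))%:E)%E.
  by apply: integral_normalN; [exact: psi_integrable|rewrite -EFin_phi].
have E3 : (\int[N]_z (z ^+ 2)%:E = 1%:E)%E by exact: normal_var1.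
have E4 : (\int[N]_z (- z ^+ 2)%:E = (- 1)%:E)%E.
  apply: integral_normalN => //.
  apply: (@normal_poly_integrable _ (fun z => z ^+ 2) 1 1) => // z.
  by rewrite mul1r normrX lerXn2r ?nnegrE ?addr_ge0// lerDr.
(* The mean of the squares is compared with [l1^-2] and [l2^-2]: between these values [sqrt n / |g|]
   lies between [l1] and [l2]. *)
have e3 : 0 < (l1 ^+ 2)^-1 - 1 by rewrite subr_gt0 invf_gt1.
have e4 : 0 < 1 - (l2 ^+ 2)^-1 by rewrite subr_gt0 invf_lt1.
have G1' z : `|- psi p (v * l1 * z)| <= C1 * (1 + z ^+ 2) by rewrite normrN.
have G3 (z : R) : `|z ^+ 2| <= 1 * (1 + z ^+ 2).
  by rewrite mul1r ger0_norm ?sqr_ge0// lerDr.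
have G4 (z : R) : `|- z ^+ 2| <= 1 * (1 + z ^+ 2) by rewrite normrN.
have [c2 c20 D2] := gauss_sum_deviation g_iid (mpsi _) C20 e2 G2 E2.
have [c1 c10 D1] := gauss_sum_deviation g_iid (measurable_funN (mpsi _)) C10 e2 G1' E1.
have [c3 c30 D3] := gauss_sum_deviation g_iid msq ltr01 e3 G3 E3.
have [c4 c40 D4] := gauss_sum_deviation g_iid (measurable_funN msq) ltr01 e4 G4 E4.
pose c := Num.min (Num.min c1 c2) (Num.min c3 c4).
exists c; first by rewrite !lt_min c10 c20 c30.
move=> n n0; have N0 : 0 < n%:R :> R by rewrite ltr0n.
have mS f a : measurable_fun setT f -> measurable [set x | n%:R * a <= gauss_sum g f n x].
  move=> mf; rewrite -[X in measurable X]setTI; apply: measurable_fun_ler => //.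
  exact: measurable_gauss_sum.
have mA1 := mS _ (- phi p (v * l1) + e / 2) (measurable_funN (mpsi (v * l1))).
have mA2 := mS _ (phi p (v * l2) + e / 2) (mpsi (v * l2)).
have mA3 := mS _ (1 + ((l1 ^+ 2)^-1 - 1)) msq.
have mA4 := mS _ (- 1 + (1 - (l2 ^+ 2)^-1)) (measurable_funN msq).
have := D4 n; have := D3 n; have := D2 n; have := D1 n; move: mA1 mA2 mA3 mA4.
set A1 := [set x | _]; set A2 := [set x | _]; set A3 := [set x | _]; set A4 := [set x | _].
move=> mA1 mA2 mA3 mA4 Q1 Q2 Q3 Q4.
have mA12 := measurableU _ _ mA1 mA2; have mA34 := measurableU _ _ mA3 mA4.
exists ((A1 `|` A2) `|` (A3 `|` A4)); first exact: measurableU.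
have mono c' : c <= c' -> (expR (- (n%:R * c')) <= expR (- (n%:R * c))).
  by move=> cc; rewrite ler_expR lerN2 ler_pM2l.
split; last first.
  apply: (le_trans (measureU2 _ mA12 mA34)).
  have -> : 4 * expR (- (n%:R * c)) = (expR (- (n%:R * c)) + expR (- (n%:R * c))) +
    (expR (- (n%:R * c)) + expR (- (n%:R * c))) by ring.
  rewrite EFinD; apply: leeD.
    apply: (le_trans (measureU2 _ mA1 mA2)); rewrite EFinD; apply: leeD.
      by apply: (le_trans Q1); rewrite lee_fin mono// /c !ge_min lexx.
    by apply: (le_trans Q2); rewrite lee_fin mono// /c !ge_min lexx orbT.
  apply: (le_trans (measureU2 _ mA3 mA4)); rewrite EFinD; apply: leeD.
    by apply: (le_trans Q3); rewrite lee_fin mono// /c !ge_min lexx !orbT.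
  by apply: (le_trans Q4); rewrite lee_fin mono// /c !ge_min lexx !orbT.
move=> x /= Hx; apply: contrapT => /not_orP[/not_orP[B1 B2] /not_orP[B3 B4]].
move: Hx; apply/negP; rewrite -ltNge.
move: B1 B2 B3 B4 => /negP + /negP + /negP + /negP; rewrite -!ltNge /gauss_sum !sumrN.
rewrite /gauss_norm; set T := \sum_(i < n) g i x ^+ 2 => B1 B2 B3 B4.
have {}B3 : T * l1 ^+ 2 < n%:R.
  by move: B3; rewrite addrC subrK -ltr_pdivlMr.
have {}B4 : n%:R < T * l2 ^+ 2.
  by move: B4; rewrite addKr mulrN ltrN2 ltr_pdivrMr.
have T0 : 0 < T by rewrite -(pmulr_lgt0 _ l2s) (lt_trans _ B4).
pose l := Num.sqrt n%:R / Num.sqrt T.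
have l0 : 0 < l by rewrite divr_gt0 ?sqrtr_gt0.
have l2E : l ^+ 2 = n%:R / T by rewrite exprMn exprVn !sqr_sqrtr ?ltW.
have ll1 : l1 <= l.
  have : l1 ^+ 2 <= l ^+ 2 by rewrite l2E ler_pdivlMr// mulrC ltW.
  by rewrite ler_sqr ?nnegrE ?(ltW l10) ?(ltW l0).
have ll2 : l <= l2.
  have : l ^+ 2 <= l2 ^+ 2 by rewrite l2E ler_pdivrMr// mulrC ltW.
  by rewrite ler_sqr ?nnegrE ?(ltW l20) ?(ltW l0).
have E i : psi p (v * (Num.sqrt n%:R * (g i x / Num.sqrt T))) = psi p (v * l * g i x).
  by congr psi; rewrite /l; ring.
rewrite /psi_mean; under eq_bigr do rewrite E.
clearbody l.
have P1 : \sum_(i < n) psi p (v * l1 * g i x) <= \sum_(i < n) psi p (v * l * g i x).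
  apply: ler_sum => i _; apply: psi_convex_bound => //; rewrite !normrM ler_wpM2r//.
  by rewrite ler_wpM2l// !gtr0_norm.
have P2 : \sum_(i < n) psi p (v * l * g i x) <= \sum_(i < n) psi p (v * l2 * g i x).
  apply: ler_sum => i _; apply: psi_convex_bound => //; rewrite !normrM ler_wpM2r//.
  by rewrite ler_wpM2l// !gtr0_norm.
have {P1 B1}B1 : phi p (v * l1) - e / 2 < n%:R^-1 * \sum_(i < n) psi p (v * l * g i x).
  rewrite ltr_pdivlMl//; apply: lt_le_trans P1.
  by rewrite -ltrN2 -mulrN opprB addrC.
have {P2 B2}B2 : n%:R^-1 * \sum_(i < n) psi p (v * l * g i x) < phi p (v * l2) + e / 2.
  by rewrite ltr_pdivrMl//; exact: le_lt_trans P2 B2.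
move: H1 H2; rewrite -/l1 -/l2 !ltr_distl => /andP[H1 _] /andP[_ H2].
move: B1 B2 H1 H2 e0; move: (n%:R^-1 * _) (phi p _) (phi p _) (phi p _) => m a b f B1 B2 H1 H2 e0.
by apply/andP; split; lra.
Qed.

End normalized_deviations.

(** * Haar distributed frames *)

Section gaussian_caps.
Context {R : realType} {d : measure_display} {O : measurableType d}.
Variables (Q : probability O R) (g : nat -> {RV Q >-> R}).
Hypothesis g_iid : iid_standard_gaussian g.
Local Notation N := (normal_prob 0 1 : probability (measurableTypeR R) R).
Local Notation T2 := (measurableTypeR R * measurableTypeR R)%type.

Lemma measurable_gauss_sumsT n u : measurable_fun setT (gauss_sums g n u).
Proof. exact: (other_mfun (measurable_gauss_sums u)). Qed.

Lemma gauss_sums_law n (u w : nat -> R) (C : set T2) : measurable C ->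
  \sum_(i < n) u i ^+ 2 = \sum_(i < n) w i ^+ 2 ->
  Q (gauss_sums g n u @^-1` C) = Q (gauss_sums g n w @^-1` C).
Proof.
move=> mC uw.
have mI : measurable_fun setT (fun t : T2 => (\1_C t)%:E : \bar R).
  by apply/measurable_EFinP; exact: measurable_indic.
have I0 t : (0 <= (\1_C t)%:E :> \bar R)%E by rewrite lee_fin.
have E (a : nat -> R) : (Q (gauss_sums g n a @^-1` C) =
    \int[Q]_x ((\1_C (gauss_sums g n a x))%:E : \bar R))%E.
  transitivity (\int[Q]_x ((\1_(gauss_sums g n a @^-1` C) x)%:E : \bar R))%E.
    rewrite integral_indic// ?setIT//.
    by rewrite -[X in measurable X]setTI; exact: measurable_gauss_sumsT.
  apply: eq_integral => x _; rewrite !indicE; suff -> : (x \in gauss_sums g n a @^-1` C) =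
      (gauss_sums g n a x \in C) by [].
  by apply/idP/idP; rewrite !inE.
have mD : measurable_fun setT (fun t : T2 => ((\1_C t)%:E * gauss_density n t)%E : \bar R).
  by apply: emeasurable_funM => //; exact: measurable_gauss_density.
have C0 : 0 < (gauss_const 2^-1)^-1 :> R by rewrite invr_gt0 gauss_const_gt0// invr_gt0.
have D0 t : (0 <= (\1_C t)%:E * gauss_density n t :> \bar R)%E.
  by rewrite mule_ge0// lee_fin mulr_ge0 ?expR_ge0// exprn_ge0// ltW.
rewrite !E (gauss_slice g_iid n u mI I0) (gauss_slice g_iid n w mI I0).
by rewrite (slice_rotation n u _ mD D0) (slice_rotation n w _ mD D0) uw.
Qed.

Lemma normal_prob_itv_gt0 (a b : R) : a < b -> (0 < N `[a, b]%classic)%E.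
Proof.
move=> ab; set A := `[a, b]%classic.
have mA : measurable (A : set (measurableTypeR R)) by exact: measurable_itv.
have -> : (N A = \int[N]_z (\1_A z)%:E)%E by rewrite integral_indic// setIT.
rewrite ge0_integral_normal//; last by apply/measurable_EFinP; exact: measurable_indic.
pose M := a ^+ 2 + b ^+ 2.
pose m := (gauss_const 2^-1)^-1 * expR (- (2^-1 * M)).
have C0 : 0 < (gauss_const 2^-1)^-1 :> R by rewrite invr_gt0 gauss_const_gt0// invr_gt0.
have m0 : 0 < m by rewrite mulr_gt0// expR_gt0.
apply: (@lt_le_trans _ _ (m%:E * lebesgue_measure A)%E).
  rewrite /A lebesgue_measure_itv/= lte_fin ab -EFinD -EFinM lte_fin mulr_gt0// subr_gt0//.
have -> : (lebesgue_measure A = \int[@lebesgue_measure R]_z (\1_A z)%:E)%E.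
  by rewrite integral_indic// setIT.
rewrite -ge0_integralZl//; last 2 first.
- by apply/measurable_EFinP; exact: measurable_indic.
- by rewrite lee_fin ltW.
apply: integral_mono => z; rewrite indicE; have [Az|_] := boolP (z \in A);
    last by rewrite mule0 mul0e.
rewrite mule1 mul1e lee_fin normal_pdf01E /m ler_pM2l// ler_expR lerN2 ler_pM2l ?invr_gt0//.
have := set_mem Az; rewrite /A /= in_itv /= => /andP[az zb]; rewrite /M.
have [z0|z0] := leP 0 z.
  have : z ^+ 2 <= b ^+ 2 by rewrite lerXn2r ?nnegrE// (le_trans z0).
  by have := sqr_ge0 a; lra.
have : (- z) ^+ 2 <= (- a) ^+ 2.
  by rewrite lerXn2r ?nnegrE ?oppr_ge0 ?lerN2// ltW// (le_lt_trans az).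
by rewrite !sqrrN; have := sqr_ge0 b; lra.
Qed.

(** For [t = (<u, g>, |g|^2)] with [u] a unit vector and [g] nonzero, it says that the cosine of the
    angle between [u] and [g] exceeds [l]. *)
Definition cap (l : R) : set T2 := [set t | l * Num.sqrt t.2 < t.1].

Lemma measurable_cap l : measurable (cap l).
Proof.
rewrite -[X in measurable X]setTI; apply: measurable_fun_ltr => //.
apply: measurable_funM => //.
have ms : measurable_fun setT (@Num.sqrt R) by apply: continuous_measurable_fun;
    exact: sqrt_continuous.
exact: (measurableT_comp ms measurable_snd).
Qed.

Lemma cap_gt0 n (u : nat -> R) (l : R) : 0 < l < 1 -> \sum_(i < n.+1) u i ^+ 2 = 1 ->
  (0 < Q (gauss_sums g n.+1 u @^-1` cap l))%E.
Proof.
move=> /andP[l0 l1] u1.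
rewrite (@gauss_sums_law _ u (axis 1) _ (measurable_cap l)); last first.
  rewrite u1 big_ord_recl /axis /= expr1n big1 ?addr0// => i _.
  by rewrite /= expr0n.
have l2 : 0 < 1 - l ^+ 2 by rewrite subr_gt0 expr_lt1// ltW.
(* By rotation invariance [u] is the first axis. In the box [g 0 >= M] and [|g i| <= 1], membership
   in the cap follows from [(1 - l^2) M > n], using [M^2 >= M]. *)
pose M := 1 + n%:R / (1 - l ^+ 2).
have M1 : 1 <= M by rewrite lerDl divr_ge0// ltW.
pose B (i : nat) : set R := if i == 0%N then `[M, M + 1]%classic else `[(-1), 1]%classic.
have mB i : measurable (B i) by rewrite /B; case: ifP => _; exact: measurable_itv.
have mE : measurable (\bigcap_(i < n.+1) (g i @^-1` B i)).
  apply: bigcap_measurable => //; first by exists 0%N.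
  by move=> i _; exact: measurable_preim_g.
apply: (@lt_le_trans _ _ (Q (\bigcap_(i < n.+1) (g i @^-1` B i)))); last first.
  apply: le_measure; rewrite ?inE//.
    rewrite -[X in measurable X]setTI; apply: measurable_gauss_sumsT => //; exact: measurable_cap.
  move=> x Bx; rewrite /cap /gauss_sums /=.
  have -> : \sum_(i < n.+1) axis 1 i * g i x = g 0%N x.
    by rewrite big_ord_recl /axis /= mul1r big1 ?addr0// => i _; rewrite mul0r.
  have := Bx 0%N (ltn0Sn n); rewrite /B /= in_itv /= => /andP[g0 _].
  have gi (i : 'I_n) : g i.+1 x ^+ 2 <= 1.
    have := Bx i.+1; rewrite /B /= in_itv /= ltnS => /(_ (ltn_ord i)) h.
    by rewrite -[leRHS](expr1n _ 2) -real_normK ?num_real// lerXn2r ?nnegrE// ler_norml.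
  have g00 : 0 <= g 0%N x by rewrite (le_trans _ g0)// (le_trans _ M1).
  have lg : 0 <= l * Num.sqrt (\sum_(i < n.+1) g i x ^+ 2) by rewrite mulr_ge0 ?sqrtr_ge0// ltW.
  suff : (l * Num.sqrt (\sum_(i < n.+1) g i x ^+ 2)) ^+ 2 < g 0%N x ^+ 2.
    by rewrite ltr_sqr ?nnegrE.
  rewrite exprMn sqr_sqrtr; last by apply: sumr_ge0 => i _; exact: sqr_ge0.
  rewrite big_ord_recl /=.
  have S : \sum_(i < n) g (lift ord0 i) x ^+ 2 <= n%:R.
    have -> : n%:R = \sum_(i < n) (1 : R) by rewrite sumr_const card_ord.
    by apply: ler_sum => i _; exact: gi.
  have Mn : n%:R < (1 - l ^+ 2) * M.
    by rewrite /M mulrDr mulr1 mulrCA mulfV ?gt_eqF// mulr1 ltrDr.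
  have M2 : M <= g 0%N x ^+ 2.
    apply: (le_trans g0); rewrite expr2 ler_peMl//; exact: le_trans g0.
  have h1 := ler_wpM2l (ltW l2) M2.
  have h2 : l ^+ 2 * \sum_(i < n) g (lift ord0 i) x ^+ 2 <= n%:R.
    rewrite (le_trans _ S)// ler_piMl//; first by apply: sumr_ge0 => i _; exact: sqr_ge0.
    by rewrite ltW// -subr_gt0.
  by rewrite mulrDr; move: h1 h2 Mn; rewrite mulrBl; lra.
have [_ indep] := g_iid.
have := indep (seq_fset tt (iota 0 n.+1)) B mB.
have -> : \bigcap_(i in [set` seq_fset tt (iota 0 n.+1)]) (g i @^-1` B i) =
    \bigcap_(i < n.+1) (g i @^-1` B i).
  have E i : (i \in seq_fset tt (iota 0 n.+1)) = (i < n.+1)%N.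
    by rewrite seq_fsetE mem_iota.
  apply/seteqP; split => x H i ii; apply: H; first by move: ii; rewrite /mkset -E.
  by move: ii; rewrite /mkset -E.
move=> ->; apply: (big_ind (fun y => 0 < y)%E) => [|a b|i _]; [exact: lte01|exact: mule_gt0|].
rewrite (distribution_gauss g_iid i (mB i)) /B; case: ifP => _.
  by apply: normal_prob_itv_gt0; rewrite ltrDl.
by apply: normal_prob_itv_gt0; lra.
Qed.

End gaussian_caps.

Section borel_matrices.
Context {R : realType}.

Lemma continuous_borel_measurable (T : ptopologicalType) (f : T -> R) :
  continuous f -> measurable_fun setT (f : borel T -> measurableTypeR R).
Proof.
move=> cf; 
apply: (@measurability _ _ (borel T) (measurableTypeR R) setT f (@RGenOInfty.G R)).
  exact: RGenOInfty.measurableE.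
move=> _ [_ [x ->] <-].
rewrite setTI; apply: sub_sigma_algebra.
by apply: open_comp => // y _; exact: cf.
Qed.

Lemma measurable_coord n k i j :
  measurable_fun setT ((fun A : 'M[R]_(n.+1, k) => A i j) : borel 'M[R]_(n.+1, k) ->
      measurableTypeR R).
Proof. by apply: continuous_borel_measurable; exact: coord_continuous. Qed.

Lemma measurable_stiefel n k : measurable (@stiefel R n.+1 k : set (borel 'M[R]_(n.+1, k))).
Proof.
pose h (A : borel 'M[R]_(n.+1, k)) : R :=
  \sum_i \sum_j (\sum_l (A : 'M[R]_(n.+1, k)) l i * (A : 'M[R]_(n.+1, k)) l j - (i == j)%:R) ^+ 2.
have mh : measurable_fun setT (h : borel 'M[R]_(n.+1, k) -> measurableTypeR R).
  apply: (@measurable_sum _ (borel 'M[R]_(n.+1, k))) => i.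
  apply: (@measurable_sum _ (borel 'M[R]_(n.+1, k))) => j; apply: measurable_funX.
  apply: measurable_funB => //.
  by apply: (@measurable_sum _ (borel 'M[R]_(n.+1, k))) => l; apply: measurable_funM;
      exact: measurable_coord.
have -> : @stiefel R n.+1 k = h @^-1` [set 0].
  apply/seteqP; split => A /=; rewrite /stiefel /h /=.
    move=> E; rewrite big1// => i _; rewrite big1// => j _.
    have := congr1 (fun B : 'M[R]_k => B i j) E; rewrite !mxE => <-.
    under [X in _ - X]eq_bigr do rewrite mxE.
    by rewrite subrr expr0n.
  move=> /eqP; rewrite psumr_eq0; last first.
    by move=> i _; apply: sumr_ge0 => j _; exact: sqr_ge0.
  move=> /allP H; apply/matrixP => i j; rewrite !mxE.
  have := H i (mem_index_enum _); rewrite /= psumr_eq0; last by move=> ? _; exact: sqr_ge0.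
  move=> /allP/(_ j (mem_index_enum _)) /=; rewrite sqrf_eq0 subr_eq0 => /eqP <-.
  by apply: eq_bigr => l _; rewrite mxE.
rewrite -[X in measurable X]setTI; apply: mh => //; exact: measurable_set1.
Qed.

Lemma colvec_eq0 n (z : 'cV[R]_n) : (z^T *m z) 0 0 = 0 -> z = 0.
Proof.
move=> z0; apply/colP => i; rewrite [RHS]mxE; move: z0; rewrite mxE => /eqP.
rewrite psumr_eq0; last by move=> l _; rewrite mxE -expr2 sqr_ge0.
by move=> /allP/(_ i (mem_index_enum _)) /=; rewrite mxE -expr2 sqrf_eq0 => /eqP.
Qed.

(** The reflection along [u - v] exchanges two vectors of equal length. The transpose is stated
    because [(H A)^T y = A^T (H^T y)]. *)
Lemma householder n (u v : 'cV[R]_n) : u^T *m u = v^T *m v ->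
  exists2 H : 'M[R]_n, H^T *m H = 1%:M & H^T *m u = v.
Proof.
move=> uv; pose w := u - v.
have wE : w^T *m w = (2 : R) *: (w^T *m u).
  have vu : v^T *m u = u^T *m v by apply/matrixP => i j; rewrite !ord1 !mxE; apply: eq_bigr =>
      l _; rewrite !mxE mulrC.
  have -> : w^T = u^T - v^T by rewrite /w linearB.
  rewrite /w !mulmxBl !mulmxBr uv vu scaler_nat mulr2n.
  by rewrite opprB.
have [w0|w0] := eqVneq w 0.
  exists 1%:M; first by rewrite trmx1 mulmx1.
  by rewrite trmx1 mul1mx; apply/eqP; rewrite -subr_eq0 -/w w0.
pose c := (w^T *m w) 0 0.
have cE : w^T *m w = c%:M by rewrite [LHS]mx11_scalar.
have c0 : c != 0.
  by apply: contra_neq w0; exact: colvec_eq0.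
pose H := 1%:M - (2 / c) *: (w *m w^T).
have HT : H^T = H by apply/matrixP => i j; rewrite !mxE eq_sym; congr (_ - _ * _);
  apply: eq_bigr => l _; rewrite !mxE mulrC.
exists H; rewrite HT.
  rewrite /H mulmxBl mul1mx mulmxBr mulmx1 -scalemxAl -scalemxAr scalerA.
  rewrite mulmxA -(mulmxA w) cE mul_mx_scalar -scalemxAl scalerA.
  have -> : 2 / c * (2 / c) * c = 2 / c + 2 / c by field.
  by rewrite scalerDl; move: ((2 / c) *: _) => X; rewrite -[X - (X + X)]opprB addrK opprK subrK.
rewrite /H mulmxBl mul1mx -scalemxAl -mulmxA.
have -> : w^T *m u = (c / 2)%:M.
  apply: (scalerI (_ : 2 != 0 :> R)) => //.
  by rewrite -wE cE scale_scalar_mx; congr (_%:M); field.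
rewrite mul_mx_scalar scalerA; have -> : 2 / c * (c / 2) = 1 by field.
by rewrite scale1r /w opprB addrC subrK.
Qed.

End borel_matrices.

Section haar.
Context {R : realType} {d : measure_display} {O : measurableType d}.
Variables (Q : probability O R) (g : nat -> {RV Q >-> R}).
Hypothesis g_iid : iid_standard_gaussian g.
Variables (n k : nat) (mu : probability (borel 'M[R]_(n.+1, k)) R).
Hypothesis mu_haar : is_stiefel_haar mu.
Variable j : 'I_k.
Local Notation M := (borel 'M[R]_(n.+1, k)).
Local Notation S := (@stiefel R n.+1 k : set M).

Definition column_cap (l : R) (y : 'cV[R]_n.+1) : set M :=
  [set A | S A /\ l * Num.sqrt (\sum_i y i 0 ^+ 2) < \sum_i A i j * y i 0].

Lemma measurable_column_cap l y : measurable (column_cap l y).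
Proof.
apply: measurableI; first exact: measurable_stiefel.
rewrite -[X in measurable X]setTI.
have mh : measurable_fun setT ((fun A : M => \sum_i (A : 'M[R]_(n.+1, k)) i j * y i 0) : M ->
    measurableTypeR R).
  apply: (@measurable_sum _ M) => i; apply: measurable_funM => //; exact: measurable_coord.
exact: (measurable_fun_ltr (measurable_cst _) mh).
Qed.

Lemma stiefel_orthogonal (H : 'M[R]_n.+1) (A : 'M[R]_(n.+1, k)) : H^T *m H = 1%:M ->
  stiefel (H *m A) <-> stiefel A.
Proof. by move=> HH; rewrite /stiefel /= trmx_mul mulmxA -(mulmxA A^T) HH mulmx1. Qed.

(* A reflection takes [y] to a multiple of the first coordinate vector. *)
Lemma column_cap_haar l (y : 'cV[R]_n.+1) : y != 0 ->
  mu (column_cap l y) = mu (column_cap l (delta_mx 0 0)).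
Proof.
move=> y0; set r := Num.sqrt (\sum_i y i 0 ^+ 2).
have r2 : r ^+ 2 = \sum_i y i 0 ^+ 2.
  by rewrite sqr_sqrtr//; apply: sumr_ge0 => i _; exact: sqr_ge0.
have yy : y^T *m y = (r ^+ 2)%:M.
  rewrite [LHS]mx11_scalar r2 mxE; congr (_%:M).
  by apply: eq_bigr => i _; rewrite mxE expr2.
have r0 : 0 < r.
  rewrite lt_neqAle sqrtr_ge0 andbT eq_sym; apply: contra_neq y0 => r0.
  by apply: colvec_eq0; rewrite yy r0 expr0n mxE mul0rn.
have dd : (delta_mx 0 0 : 'cV[R]_n.+1)^T *m delta_mx 0 0 = 1%:M.
  by rewrite trmx_delta mul_delta_mx; apply/matrixP => a b; rewrite !ord1 !mxE.
have [H HH Hy] : exists2 H : 'M[R]_n.+1, H^T *m H = 1%:M & H^T *m y = r *: delta_mx 0 0.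
  apply: householder; rewrite yy.
  have -> : (r *: (delta_mx 0 0 : 'cV[R]_n.+1))^T = r *: (delta_mx 0 0)^T.
    by apply/matrixP => a b; rewrite !mxE.
  rewrite -scalemxAl -scalemxAr dd scalerA.
  by rewrite scale_scalar_mx mulr1 expr2.
have [_ inv] := mu_haar.
rewrite -(inv H HH _ (measurable_column_cap l y)); congr (mu _).
have e0 (F : 'I_n.+1 -> R) : \sum_i F i * (delta_mx 0 0 : 'cV[R]_n.+1) i 0 = F ord0.
  rewrite big_ord_recl mxE /= mulr1 big1 ?addr0// => i _.
  by rewrite mxE /= mulr0.
have e1 : \sum_i (delta_mx 0 0 : 'cV[R]_n.+1) i 0 ^+ 2 = 1.
  by under eq_bigr do rewrite expr2; rewrite e0 mxE.
have HA (A : M) : \sum_i (H *m A) i j * y i 0 = r * (A : 'M[R]_(n.+1, k)) ord0 j.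
  transitivity (((H *m A)^T *m y) j 0).
    by rewrite [RHS]mxE; apply: eq_bigr => i _; congr (_ * _); rewrite [RHS]mxE.
  rewrite trmx_mul -mulmxA Hy -scalemxAr mxE; congr (_ * _).
  by rewrite mxE -[RHS](e0 (fun i => (A : 'M[R]_(n.+1, k)) i j)); apply: eq_bigr => i _;
      rewrite mxE.
apply/seteqP; split => A /=; rewrite /column_cap /= HA -/r e1 e0 sqrtr1 mulr1 mulrC ltr_pM2l//;
  by move=> [/(stiefel_orthogonal A HH) SA lA].
Qed.

Definition gauss_vector (x : O) : 'cV[R]_n.+1 := \col_i g i x.

Definition column_sums (A : M) (x : O) := gauss_sums g n.+1 (fun i => (A : 'M[R]_(n.+1,
    k)) (inord i) j) x.

Lemma column_cap_sums l (A : M) (x : O) : S A ->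
  column_cap l (gauss_vector x) A <-> cap l (column_sums A x).
Proof.
move=> SA; rewrite /column_cap /cap /column_sums /gauss_sums /=.
have -> : \sum_i gauss_vector x i 0 ^+ 2 = \sum_(i < n.+1) g i x ^+ 2.
  by apply: eq_bigr => i _; rewrite mxE.
have -> : \sum_i (A : 'M[R]_(n.+1, k)) i j * gauss_vector x i 0 = \sum_(i < n.+1) (A :
    'M[R]_(n.+1, k)) (inord i) j * g i x.
  by apply: eq_bigr => i _; rewrite mxE inord_val.
by split => [[]|].
Qed.

Lemma stiefel_column (A : M) : S A -> \sum_(i < n.+1) (A : 'M[R]_(n.+1, k)) (inord i) j ^+ 2 = 1.
Proof.
move=> SA; have -> : 1 = (1%:M : 'M[R]_k) j j by rewrite mxE eqxx.
rewrite -SA mxE; by apply: eq_bigr => i _; rewrite mxE inord_val expr2.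
Qed.

Definition cap_prob (l : R) : \bar R := Q (gauss_sums g n.+1 (axis 1) @^-1` cap l).

Definition cap_pairs (l : R) (B : set M) : set (M * O) :=
  [set q | B q.1 /\ column_cap l (gauss_vector q.2) q.1].

Lemma measurable_cap_pairs l B : measurable B -> measurable (cap_pairs l B).
Proof.
move=> mB.
have mg i : measurable_fun setT (fun q : M * O => g i q.2) by exact: (measurableT_comp _
    measurable_snd).
have mA i : measurable_fun setT (fun q : M * O => (q.1 : 'M[R]_(n.+1, k)) i j : measurableTypeR R).
  exact: (measurableT_comp (@measurable_coord R n k i j) measurable_fst).
have ms : measurable_fun setT (@Num.sqrt R) by apply: continuous_measurable_fun;
    exact: sqrt_continuous.
have -> : cap_pairs l B = (fst @^-1` B `&` fst @^-1` S) `&`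
    [set q : M * O | l * Num.sqrt (\sum_(i < n.+1) g i q.2 ^+ 2) <
       \sum_(i < n.+1) (q.1 : 'M[R]_(n.+1, k)) i j * g i q.2].
  have E (q : M * O) : (\sum_i gauss_vector q.2 i 0 ^+ 2 = \sum_(i < n.+1) g i q.2 ^+ 2) *
     (\sum_i (q.1 : 'M[R]_(n.+1, k)) i j * gauss_vector q.2 i 0 =
      \sum_(i < n.+1) (q.1 : 'M[R]_(n.+1, k)) i j * g i q.2).
    by split; apply: eq_bigr => i _; rewrite mxE.
  apply/seteqP; split => q /=; rewrite /cap_pairs /column_cap /= !E.
    by move=> [? []].
  by move=> [[]].
apply: measurableI.
  apply: measurableI; rewrite -[X in measurable X]setTI; apply: measurable_fst => //.
  exact: measurable_stiefel.
rewrite -[X in measurable X]setTI; apply: measurable_fun_ltr => //.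
  apply: measurable_funM => //; apply: measurableT_comp => //.
  by apply: (@measurable_sum _ (M * O)%type) => i; apply: measurable_funX.
by apply: (@measurable_sum _ (M * O)%type) => i; apply: measurable_funM; [exact: mA|exact: mg].
Qed.

(* Pairs of a frame and a Gaussian vector that lies in the cap around the [j]-th
   column are counted in two ways; both conditional probabilities are constant
   by rotation invariance. *)
Lemma haar_double_count l (B : set M) : measurable B ->
  (cap_prob l * mu (B `&` S) =
   \int[Q]_x mu (B `&` column_cap l (gauss_vector x)))%E.
Proof.
move=> mB; have mD := measurable_cap_pairs l mB; set D := cap_pairs l B in mD.
have mI : measurable_fun setT (fun q : M * O => (\1_D q)%:E : \bar R).
  by apply/measurable_EFinP; exact: measurable_indic.
have I0 q : (0 <= (\1_D q)%:E :> \bar R)%E by rewrite lee_fin.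
have F := @fubini_tonelli _ _ M O R mu Q _ mI I0.
have mBS : measurable (B `&` S) by apply: measurableI => //; exact: measurable_stiefel.
transitivity (\int[mu]_A \int[Q]_x ((\1_D (A, x))%:E : \bar R))%E; last first.
  rewrite F; apply: eq_integral => x _.
  transitivity (\int[mu]_A ((\1_(B `&` column_cap l (gauss_vector x)) A)%:E : \bar R))%E.
    apply: eq_integral => A _; rewrite !indicE.
    suff -> : ((A, x) \in D) = (A \in B `&` column_cap l (gauss_vector x)) by [].
    by apply/idP/idP; rewrite !inE.
  rewrite integral_indic// ?setIT//.
  by apply: measurableI => //; exact: measurable_column_cap.
transitivity (\int[mu]_A (cap_prob l * (\1_(B `&` S) A)%:E))%E.
  rewrite ge0_integralZl//.
  - by rewrite integral_indic// setIT.
  - by apply/measurable_EFinP; exact: measurable_indic.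
apply: eq_integral => A _; rewrite [in LHS]indicE.
have [/set_mem[BA SA]|nBS] := boolP (A \in B `&` S); last first.
  rewrite mule0; symmetry; apply: integral0_eq => x _; rewrite indicE.
  have [/set_mem[/= BA [SA _]]|//] := boolP ((A, x) \in D).
  by move/negP: nBS; case; rewrite inE.
rewrite mule1 /cap_prob.
rewrite -(@gauss_sums_law R d O Q g g_iid n.+1 (fun i => (A : 'M[R]_(n.+1, k)) (inord i) j)
   (axis 1) _ (measurable_cap l)); last first.
  rewrite stiefel_column// big_ord_recl /axis /= expr1n big1 ?addr0// => i _.
  by rewrite /= expr0n.
transitivity (\int[Q]_x ((\1_(column_sums A @^-1` cap l) x)%:E : \bar R))%E.
  rewrite integral_indic// ?setIT//.
  by rewrite -[X in measurable X]setTI; apply: measurable_gauss_sumsT => //; exact: measurable_cap.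
apply: eq_integral => x _; rewrite !indicE.
suff -> : ((A, x) \in D) = (x \in column_sums A @^-1` cap l) by [].
apply/idP/idP; rewrite !inE => H; first by apply/(column_cap_sums l x SA); case: H.
by split => //; apply/(column_cap_sums l x SA).
Qed.

(** Transfer from frames to Gaussian vectors: [A'] must contain every vector in the cap of a frame
    of [B]. The double count gives [cap_prob * mu (B & S) <= m * Q A'], and the cap probabilities
    cancel because [m <= cap_prob]. *)
Lemma haar_le l (B : set M) (A' : set O) : 0 < l < 1 -> measurable B -> measurable A' ->
  (forall A x, B A -> S A -> cap l (column_sums A x) -> A' x) ->
  (mu (B `&` S) <= Q A')%E.
Proof.
move=> l01 mB mA' H; pose m := mu (column_cap l (delta_mx 0 0)).
have cap0 : (0 < cap_prob l)%E.
  apply: cap_gt0 => //; rewrite big_ord_recl /axis /= expr1n big1 ?addr0// => i _.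
  by rewrite /= expr0n.
have capfin : cap_prob l \is a fin_num.
  apply: fin_num_measure; rewrite -[X in measurable X]setTI.
  by apply: measurable_gauss_sumsT => //; exact: measurable_cap.
have zero x : column_cap l (gauss_vector x) !=set0 -> gauss_vector x != 0.
  move=> [A [_]]; apply: contraTneq => ->; rewrite -leNgt.
  rewrite !big1 ?sqrtr0 ?mulr0// => i _; rewrite mxE ?expr0n ?mulr0//.
(* The same count over all frames compares the two constants; the zero vector, where invariance says
   nothing, is avoided on the event [g 0 <> 0] of probability 1. *)
have m_cap : (m <= cap_prob l)%E.
  have := haar_double_count l (@measurableT _ M).
  rewrite setTI (proj1 mu_haar) mule1 => ->.
  pose G := g 0%N @^-1` [set~ 0].
  have mG : measurable G by apply: measurable_preim_g; apply: measurableC; exact: measurable_set1.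
  have QG : Q G = 1%E.
    rewrite (distribution_gauss g_iid)//; last by apply: measurableC; exact: measurable_set1.
    rewrite probability_setC ?measurable_set1//.
    have /null_content_dominatesP dom := @normal_prob_dominates R 0 1.
    by rewrite [X in (1 - X)%E](dom [set 0] (measurable_set1 _) (lebesgue_measure_set1 _)) sube0.
  apply: (@le_trans _ _ (\int[Q]_x (m * (\1_G x)%:E))%E).
    rewrite ge0_integralZl//.
    - by rewrite integral_indic// setIT [X in (_ * X)%E]QG mule1.
    - by apply/measurable_EFinP; exact: measurable_indic.
    - exact: measure_ge0.
  apply: integral_mono => x; rewrite indicE setTI.
  have [/set_mem Gx|_] := boolP (x \in G); last by rewrite mule0.
  rewrite mule1 column_cap_haar//; apply/eqP => /matrixP/(_ ord0 0).
  by rewrite !mxE.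
rewrite -(lee_pmul2l capfin cap0) haar_double_count//.
apply: (@le_trans _ _ (\int[Q]_x (m * (\1_A' x)%:E))%E).
  apply: integral_mono => x; rewrite indicE.
  have [xA'|xA'] := boolP (x \in A').
    rewrite mule1; have [y0|/negP/negbNE/eqP y0] := pselect (gauss_vector x != 0).
      rewrite /m -(column_cap_haar l y0); apply: le_measure; rewrite ?inE.
      + by apply: measurableI => //; exact: measurable_column_cap.
      + exact: measurable_column_cap.
      + by move=> A [].
    have -> : B `&` column_cap l (gauss_vector x) = set0.
      by apply/seteqP; split => // A [_ CA]; have := zero x (ex_intro _ A CA); rewrite y0 eqxx.
    by rewrite measure0; exact: measure_ge0.
  have -> : B `&` column_cap l (gauss_vector x) = set0.
    apply/seteqP; split => // A [BA CA]; have SA := proj1 CA.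
    by move/negP: xA'; apply; rewrite inE; apply: (H A) => //; apply/column_cap_sums.
  by rewrite measure0 mule0.
rewrite ge0_integralZl//; last 2 first.
- by apply/measurable_EFinP; exact: measurable_indic.
- exact: measure_ge0.
by rewrite integral_indic// setIT; apply: lee_wpmul2r.
Qed.

End haar.

Section psi_mean_continuity.
Context {R : realType}.
Variables (p : R) (hp : 2 <= p).

Lemma psi_lipschitz (V : R) : 0 <= V -> exists2 L, 0 < L & forall s t, `|s| <= V -> `|t| <= V ->
  `|psi p s - psi p t| <= L * `|s - t|.
Proof.
move=> V0; pose L := `|@psi_const R - psi p 0| + (V + 1) ^+ 2 / 4.
have L0 : 0 < L by rewrite ltr_wpDl// divr_gt0// exprn_gt0// ltr_wpDl.
exists L => // s t sV tV.
have D x : `|x| <= V -> `|dpsi p x| <= L.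
  move=> xV; apply: (le_trans (dpsi_le hp x)); rewrite lerD2l ler_wpM2r//.
  by rewrite lerXn2r ?nnegrE ?addr_ge0// lerD2r.
have H (x y : R) : `|x| <= V -> psi p x - psi p y <= L * `|x - y|.
  move=> xV; have := psi_tangent hp x (y - x); rewrite [x + (y - x)]addrC subrK => T.
  have : - ((y - x) * dpsi p x) <= L * `|x - y|.
    apply: (le_trans (ler_norm _)); rewrite normrN normrM mulrC distrC ler_wpM2r//.
    exact: D.
  by move: T; lra.
by rewrite ler_norml lerNl opprB H// andbT distrC H.
Qed.

(** Unit vectors satisfy [|a - b|^2 = 2 - 2 <a, b>], and [psi] is Lipschitz on the bounded range of
    the arguments. Here [l] may depend on [n], since [haar_le] holds for every [l] between 0 and
    1. *)
Lemma psi_mean_close n (v e : R) : (0 < n)%N -> 0 < e -> exists2 l, 0 < l < 1 &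
  forall a b : nat -> R, \sum_(i < n) a i ^+ 2 = 1 -> \sum_(i < n) b i ^+ 2 = 1 ->
    l < \sum_(i < n) a i * b i ->
    `|psi_mean p n (fun i => Num.sqrt n%:R * a i) v
      - psi_mean p n (fun i => Num.sqrt n%:R * b i) v| <= e.
Proof.
move=> n0 e0; have N0 : 0 < n%:R :> R by rewrite ltr0n.
pose V := `|v| * Num.sqrt n%:R.
have V0 : 0 <= V by rewrite mulr_ge0// sqrtr_ge0.
have [L L0 HL] := psi_lipschitz V0.
pose c := L * V + 1.
have c0 : 0 < c by rewrite ltr_wpDl// mulr_ge0// ltW.
pose h := e / c.
have h0 : 0 < h by rewrite divr_gt0.
pose q := Num.min 2^-1 (h ^+ 2 / 2).
have q0 : 0 < q by rewrite lt_min invr_gt0 ltr0n/= divr_gt0// exprn_gt0.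
have q1 : q < 1 by rewrite gt_min; apply/orP; left; rewrite invf_lt1// ltr1n.
have q2 : 2 * q <= h ^+ 2.
  by rewrite -ler_pdivlMl// mulrC ge_min lexx orbT.
exists (1 - q); first by rewrite subr_gt0 q1/= ltrBlDr ltrDl.
move=> a b a1 b1 ab.
have unit1 (f : nat -> R) (i : 'I_n) : \sum_(i < n) f i ^+ 2 = 1 -> `|f i| <= 1.
  move=> f1; have : f i ^+ 2 <= 1.
    by rewrite -f1 (bigD1 i)//= lerDl; apply: sumr_ge0 => l _; exact: sqr_ge0.
  by rewrite -[X in _ <= X](expr1n _ 2) -real_normK ?num_real// ler_sqr ?nnegrE.
have dist : \sum_(i < n) (a i - b i) ^+ 2 <= h ^+ 2.
  have -> : \sum_(i < n) (a i - b i) ^+ 2 = 2 - 2 * \sum_(i < n) a i * b i.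
    rewrite mulr_sumr -[X in X - _](_ : \sum_(i < n) a i ^+ 2 + \sum_(i < n) b i ^+ 2 = 2);
        last by rewrite a1 b1.
    by rewrite -big_split/= -sumrB; apply: eq_bigr => i _; ring.
  by apply: le_trans q2; lra.
have di (i : 'I_n) : `|a i - b i| <= h.
  have : (a i - b i) ^+ 2 <= h ^+ 2.
    apply: le_trans dist.
    by rewrite (bigD1 i)//= lerDl; apply: sumr_ge0 => l _; exact: sqr_ge0.
  by rewrite -[X in X <= _]real_normK ?num_real// ler_sqr ?nnegrE// ltW.
have bnd (f : nat -> R) (i : 'I_n) : `|f i| <= 1 -> `|v * (Num.sqrt n%:R * f i)| <= V.
  move=> f1; rewrite mulrA normrM normrM (ger0_norm (sqrtr_ge0 _)) -/V.
  by rewrite ler_piMr.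
rewrite /psi_mean -mulrBr -sumrB normrM ger0_norm ?invr_ge0//.
rewrite ler_pdivrMl//; apply: (le_trans (ler_norm_sum _ _ _)).
have -> : n%:R * e = \sum_(i < n) e by rewrite sumr_const card_ord mulr_natl.
apply: ler_sum => i _.
apply: (le_trans (HL _ _ (bnd a i (unit1 a i a1)) (bnd b i (unit1 b i b1)))).
rewrite -mulrBr -mulrBr mulrA normrM normrM (ger0_norm (sqrtr_ge0 _)) -/V.
apply: (@le_trans _ _ (L * (V * h))).
  exact: (ler_wpM2l (ltW L0) (ler_wpM2l V0 (di i))).
by rewrite mulrA /h mulrCA ler_piMr ?(ltW e0)// ler_pdivrMr// mul1r lerDl.
Qed.

End psi_mean_continuity.

Section haar_deviation.
Context {R : realType} {d : measure_display} {O : measurableType d}.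
Variables (Q : probability O R) (g : nat -> {RV Q >-> R}).
Hypothesis g_iid : iid_standard_gaussian g.
Variables (p : R) (hp : 2 <= p).

Definition scaled_column n k (A : 'M[R]_(n.+1, k)) (j : 'I_k) (i : nat) : R :=
  Num.sqrt n.+1%:R * A (inord i) j.

Definition bad_frames n k (v e : R) (j : 'I_k) : set (borel 'M[R]_(n.+1, k)) :=
  [set A | e <= `|psi_mean p n.+1 (scaled_column A j) v - phi p v|].

Lemma measurable_bad_frames n k v e (j : 'I_k) : measurable (@bad_frames n k v e j).
Proof.
rewrite -[X in measurable X]setTI; apply: measurable_fun_ler => //.
apply: measurableT_comp => //; apply: measurable_funB => //; apply: measurable_funM => //.
apply: (@measurable_sum _ (borel 'M[R]_(n.+1, k))) => i.
apply: (measurableT_comp (measurable_psiM hp v)); apply: measurable_funM => //.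
exact: measurable_coord.
Qed.

(** In a small enough cap around a bad column, every direction is still bad up to [e / 2], so the
    Gaussian bound applies to the column. *)
Lemma haar_deviation n k (mu : probability (borel 'M[R]_(n.+1, k)) R) (j : 'I_k)
    (v e : R) (A' : set O) : is_stiefel_haar mu -> 0 < e -> measurable A' ->
  [set x | e / 2 <= `|psi_mean p n.+1 (fun i => Num.sqrt n.+1%:R * (g i x / gauss_norm g n.+1 x)) v
                      - phi p v|] `<=` A' ->
  (mu (bad_frames v e j `&` @stiefel R n.+1 k) <= Q A')%E.
Proof.
move=> mu_haar e0 mA' HA'; have e2 : 0 < e / 2 by rewrite divr_gt0.
have [l l01 Hl] := psi_mean_close hp v (ltn0Sn n) e2.
apply: (haar_le g_iid mu_haar (j := j) l01 (measurable_bad_frames v e j) mA') => A x BA SA.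
rewrite /cap /column_sums /gauss_sums /= => capA; apply: HA' => /=.
have T0 : 0 < \sum_(i < n.+1) g i x ^+ 2.
  rewrite lt_neqAle eq_sym; apply/andP; split; last by apply: sumr_ge0 => i _; exact: sqr_ge0.
  apply/eqP => T0; move: capA; rewrite T0 sqrtr0 mulr0 big1 ?ltxx// => i _.
  have := psumr_eq0P (fun i _ => sqr_ge0 _) T0; move=> /(_ i isT)/eqP.
  by rewrite sqrf_eq0 => /eqP ->; rewrite mulr0.
have r0 : 0 < gauss_norm g n.+1 x by rewrite sqrtr_gt0.
have b1 : \sum_(i < n.+1) (g i x / gauss_norm g n.+1 x) ^+ 2 = 1.
  under eq_bigr do rewrite exprMn exprVn.
  by rewrite -mulr_suml /gauss_norm sqr_sqrtr ?ltW// mulfV// gt_eqF.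
have ab : l < \sum_(i < n.+1) A (inord i) j * (g i x / gauss_norm g n.+1 x).
  under eq_bigr do rewrite mulrA.
  by rewrite -mulr_suml ltr_pdivlMr.
have := Hl (fun i => A (inord i) j) (fun i => g i x / gauss_norm g n.+1 x) (stiefel_column j SA)
    b1 ab.
move: BA; rewrite /bad_frames /= /scaled_column.
move: (psi_mean _ _ _ _) (psi_mean _ _ _ _) (phi p v) => a b f h1 h2.
have := ler_normD (b - a) (a - f); rewrite addrA subrK; lra.
Qed.

End haar_deviation.

(** * Almost every sequence of frames *)

Section good_frames.
Context {R : realType} {dO : measure_display} {O : measurableType dO}.
Variables (Q : probability O R) (g : nat -> {RV Q >-> R}).
Hypothesis g_iid : iid_standard_gaussian g.
Variables (p : R) (hp : 2 <= p).
Variables (k : nat -> nat) (k_bounds : forall n, (0 < n)%N -> (0 < k n <= n)%N).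
Variable sigma_ : forall n, probability (borel 'M[R]_(n.+1, k n.+1)) R.
Hypothesis sigma_haar : forall n, is_stiefel_haar (sigma_ n).
Variable sigma : probability (frame_space R k) R.
Hypothesis sigma_marginal : forall n (B : set (borel 'M[R]_(n.+1, k n.+1))),
  measurable B -> sigma [set a | B (a n)] = sigma_ n B.

Lemma measurable_cylinder n (B : set (borel 'M[R]_(n.+1, k n.+1))) : measurable B ->
  measurable [set a : frame_space R k | B (a n)].
Proof. by move=> mB; apply: sub_sigma_algebra; exists n, B. Qed.

Lemma geometric_lty (K q : R) : 0 <= K -> 0 <= q < 1 ->
  (\sum_(n <oo) (K * q ^+ n)%:E < +oo)%E.
Proof.
move=> K0 /andP[q0 q1]; apply: (@le_lt_trans _ _ (K / (1 - q))%:E); last exact: ltry.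
apply: lime_le; first by apply: is_cvg_nneseries => n _ _; rewrite lee_fin mulr_ge0// exprn_ge0.
apply: nearW => n; rewrite sumEFin lee_fin.
have := @geometric_seriesE R K q; rewrite lt_eqF// => /(_ isT)/(congr1 (fun u => u n)).
rewrite /series /= => ->; rewrite ler_wpM2r ?invr_ge0 ?subr_ge0 ?(ltW q1)//.
by rewrite ler_piMr// lerBlDr lerDl exprn_ge0.
Qed.

(** Half of the exponent absorbs the number of columns, by [y exp (- y) <= 1] at
    [y = (n + 1) c / 2]; the other half leaves a geometric series. *)
Lemma bad_frames_measure (v e : R) : 0 < e -> exists2 c, 0 < c & forall n,
  (sigma_ n (\big[setU/set0]_(j < k n.+1) (bad_frames p v e j `&` @stiefel R n.+1 (k n.+1))) <=
   (8 / c * expR (- (c / 2)) ^+ n)%:E)%E.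
Proof.
move=> e0; have e2 : 0 < e / 2 by rewrite divr_gt0.
have [c c0 Hc] := normalized_deviation g_iid hp v e2; exists c => // n.
have [A' mA' [HA' QA']] := Hc n.+1 (ltn0Sn n).
have mB j : measurable (bad_frames p v e j `&` @stiefel R n.+1 (k n.+1)
    : set (borel 'M[R]_(n.+1, k n.+1))).
  by apply: measurableI; [exact: measurable_bad_frames|exact: measurable_stiefel].
apply: (le_trans (union_bound _ _ mB)).
apply: (@le_trans _ _ (\sum_(j < k n.+1) (4 * expR (- (n.+1%:R * c)))%:E)%E).
  apply: lee_sum => j _; apply: le_trans QA'.
  exact: (haar_deviation g_iid hp j (sigma_haar n) e0 mA' HA').
rewrite sumEFin lee_fin sumr_const card_ord.
have /andP[_ kn] := k_bounds (ltn0Sn n).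
apply: (@le_trans _ _ (n.+1%:R * (4 * expR (- (n.+1%:R * c))))).
  by rewrite [leRHS]mulr_natl ler_wpMn2l ?mulr_ge0 ?expR_ge0.
have h1 : n.+1%:R * (c / 2) <= expR (n.+1%:R * (c / 2)).
  by apply: le_trans (expR_ge1Dx _); rewrite lerDr.
have h2 : expR (- (n.+1%:R * c)) = expR (- (n.+1%:R * (c / 2))) * expR (- (n.+1%:R * (c / 2))).
  by rewrite -expRD; congr expR; field.
have h3 : expR (n.+1%:R * (c / 2)) * expR (- (n.+1%:R * (c / 2))) = 1.
  by rewrite -expRD subrr expR0.
have h4 : expR (- (n.+1%:R * (c / 2))) <= expR (- (c / 2)) ^+ n.
  rewrite -expRM_natl ler_expR mulrN lerN2 ler_wpM2r ?divr_ge0 ?(ltW c0)//.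
  by rewrite ler_nat.
have h5 : n.+1%:R * (c / 2) * expR (- (n.+1%:R * (c / 2))) <= 1.
  by rewrite -[leRHS]h3 ler_wpM2r// expR_ge0.
rewrite h2; move: h4 h5; set E := expR _; set D := _ ^+ n => h4 h5.
have E0 : 0 <= E by exact: expR_ge0.
have -> : n.+1%:R * (4 * (E * E)) = 8 / c * (n.+1%:R * (c / 2) * E * E).
  by field; rewrite gt_eqF.
rewrite ler_wpM2l ?divr_ge0 ?(ltW c0)//; apply: le_trans h4.
by rewrite ler_piMl.
Qed.

(** First Borel-Cantelli lemma: it involves only the marginals, so the dependence between the frames
    of different dimensions is irrelevant. *)
Lemma psi_mean_ae_at (v e : R) : 0 < e ->
  {ae sigma, forall a : frame_space R k, \forall n \near \oo, forall j : 'I_(k n.+1),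
     `|psi_mean p n.+1 (scaled_column (a n : 'M[R]_(n.+1, k n.+1)) j) v - phi p v| < e}.
Proof.
move=> e0; have [c c0 Hc] := bad_frames_measure v e0.
pose E n : set (borel 'M[R]_(n.+1, k n.+1)) :=
  \big[setU/set0]_(j < k n.+1) (bad_frames p v e j `&` @stiefel R n.+1 (k n.+1)).
have mE n : measurable (E n).
  apply: bigsetU_measurable => j _.
  by apply: measurableI; [exact: measurable_bad_frames|exact: measurable_stiefel].
pose F n : set (frame_space R k) := [set a | E n (a n)].
have mF n : measurable (F n) by exact: measurable_cylinder.
have FE n : sigma (F n) = sigma_ n (E n) by exact: sigma_marginal.
have F0 : sigma (lim_sup_set F) = 0%E.
  apply: lim_sup_set_cvg0 => //.
  apply: (@le_lt_trans _ _ (\sum_(n <oo) (8 / c * expR (- (c / 2)) ^+ n)%:E)%E).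
    by apply: lee_nneseries => [n *|n *]; [exact: measure_ge0|rewrite [leLHS]FE; exact: Hc].
  apply: geometric_lty; first by rewrite divr_ge0// ltW.
  by rewrite expR_ge0 -[ltRHS]expR0 ltr_expR oppr_lt0 divr_gt0.
have S1 : {ae sigma, forall a : frame_space R k, forall n, stiefel (a n : 'M[R]_(n.+1, k n.+1))}.
  apply: ae_foralln => n.
  have mS := measurable_cylinder (@measurable_stiefel R n (k n.+1)).
  exists (~` [set a : frame_space R k | stiefel (a n : 'M[R]_(n.+1, k n.+1))]); split => //.
    exact: measurableC.
  have S1 : sigma [set a : frame_space R k | stiefel (a n : 'M[R]_(n.+1, k n.+1))] = 1%E.
    rewrite (sigma_marginal (@measurable_stiefel R n (k n.+1))).
    by have [-> _] := sigma_haar n.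
  transitivity (1 - sigma [set a : frame_space R k | stiefel (a n : 'M[R]_(n.+1, k n.+1))])%E.
    exact: probability_setC.
  by rewrite S1 subee.
have L0 : {ae sigma, forall a, ~ lim_sup_set F a}.
  exists (lim_sup_set F); split => //.
    apply: bigcapT_measurable => n; apply: bigcup_measurable => m _; exact: mF.
  by move=> a /= /contrapT.
near=> a; have Sa : forall n, stiefel (a n : 'M[R]_(n.+1, k n.+1)) by near: a.
have : ~ lim_sup_set F a by near: a.
rewrite /lim_sup_set /bigcap /= => /existsNP[m /not_implyP[_ Hm]].
exists m => // n /= mn j; rewrite ltNge; apply/negP => bad; apply: Hm.
exists n => //=; rewrite /F /= /E -bigcup_seq; exists j => //=.
by rewrite mem_index_enum.
Unshelve. all: by end_near. Qed.

Lemma psi_mean_abs n th v : psi_mean p n th `|v| = psi_mean p n th v.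
Proof.
have [v0|v0] := leP 0 v; first by rewrite ger0_norm.
rewrite ltr0_norm// /psi_mean; congr (_ * _); apply: eq_bigr => i _.
by rewrite mulNr psiN.
Qed.

Lemma psi_mean_mono n th (v w : R) : `|v| <= `|w| -> psi_mean p n th v <= psi_mean p n th w.
Proof.
move=> vw; rewrite ler_wpM2l ?invr_ge0//; apply: ler_sum => i _.
by apply: psi_convex_bound => //; rewrite !normrM ler_wpM2r.
Qed.

(** The exceptional set must not depend on [v]: the result holds at countably many parameters, and
    in between [psi_mean] is sandwiched by monotonicity while [phi] is continuous. *)
Lemma psi_mean_ae : {ae sigma, forall a : frame_space R k, forall v e : R, 0 < e ->
  \forall n \near \oo, forall j : 'I_(k n.+1),
     `|psi_mean p n.+1 (scaled_column (a n : 'M[R]_(n.+1, k n.+1)) j) v - phi p v| <= e}.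
Proof.
(* Enumeration of the rationals; the default 0 pads the indices that code none. *)
pose q m : R := ratr (odflt 0 (@choice.unpickle rat m)).
have H : {ae sigma, forall a : frame_space R k, forall m l : nat, \forall n \near \oo,
    forall j : 'I_(k n.+1),
     `|psi_mean p n.+1 (scaled_column (a n : 'M[R]_(n.+1, k n.+1)) j) (q m) - phi p (q m)|
       < l.+1%:R^-1}.
  apply: ae_foralln => m; apply: ae_foralln => l; exact: psi_mean_ae_at.
apply: filterS H => a Ha v e e0.
wlog v0 : v / 0 <= v => [W|].
  have := W `|v| (normr_ge0 v); apply: filterS => n Hn j; have := Hn j.
  rewrite psi_mean_abs; suff -> : phi p `|v| = phi p v by [].
  by have [v0|v0] := leP 0 v; [rewrite ger0_norm|rewrite ltr0_norm// phiN].
have qr (r : rat) : exists m, ratr r = q m.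
  by exists (choice.pickle r); rewrite /q choice.pickleK.
have [l le2] : exists l : nat, l.+1%:R^-1 < e / 2.
  have e2 : 0 < e / 2 by rewrite divr_gt0.
  exists (Num.truncn (e / 2)^-1).
  by rewrite -[ltRHS]invrK ltf_pV2 ?posrE ?invr_gt0// truncnS_gt.
have [h /= h0 Hh] : \forall w \near v, `|phi p v - phi p w| < e / 2.
  by have := @continuous_phi R p hp v; move/cvgrPdist_lt; apply; rewrite divr_gt0.
(* At [v = 0] both means equal [psi p 0]. For [v > 0] the rational below [v] is chosen positive, so
   that monotonicity in [|v|] orders the three values. *)
move: v0; rewrite le_eqVlt => /predU1P[v0|v0].
  apply: nearW => n j; rewrite -v0 phi0// /psi_mean.
  under eq_bigr do rewrite mul0r.
  by rewrite sumr_const card_ord -[psi p 0 *+ _]mulr_natl mulKf// subrr normr0 ltW.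
pose h' := Num.min h v.
have h'0 : 0 < h' by rewrite lt_min h0.
have [r1] : exists r : rat, ratr r \in `]v - h', v[ by apply: rat_in_itvoo; rewrite ltrBlDr ltrDl.
have [r2] : exists r : rat, ratr r \in `]v, v + h'[ by apply: rat_in_itvoo; rewrite ltrDl.
rewrite !in_itv /= => /andP[vr2 r2v] /andP[vr1 r1v].
have [m1 E1] := qr r1; have [m2 E2] := qr r2.
rewrite E1 in vr1 r1v; rewrite E2 in vr2 r2v.
have hh' : h' <= h by rewrite ge_min lexx.
have vh' : h' <= v by rewrite ge_min lexx orbT.
have P1 : `|phi p v - phi p (q m1)| < e / 2.
  by apply: Hh; rewrite /ball_ /= ger0_norm; lra.
have P2 : `|phi p v - phi p (q m2)| < e / 2.
  by apply: Hh; rewrite /ball_ /= ler0_norm; lra.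
have M1 n th : psi_mean p n th (q m1) <= psi_mean p n th v.
  by apply: psi_mean_mono; rewrite !ger0_norm; lra.
have M2 n th : psi_mean p n th v <= psi_mean p n th (q m2).
  by apply: psi_mean_mono; rewrite !ger0_norm; lra.
have := Ha m1 l; have := Ha m2 l; apply: filterS2 => n H2 H1 j.
have {}H1 := H1 j; have {}H2 := H2 j; have {}M1 := M1 n.+1 (scaled_column (a n : 'M[R]_(n.+1,
    k n.+1)) j).
have {}M2 := M2 n.+1 (scaled_column (a n : 'M[R]_(n.+1, k n.+1)) j).
move: H1 H2 P1 P2; rewrite !ltr_norml => /andP[H1 _] /andP[_ H2] /andP[_ P1] /andP[P2 _].
rewrite ler_norml; move: M1 M2 H1 H2 P1 P2 le2.
move: (psi_mean _ _ _ (q m1)) (psi_mean _ _ _ (q m2)) (psi_mean _ _ _ v) => x1 x2 x.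
move: (phi p (q m1)) (phi p (q m2)) (phi p v) (l.+1%:R^-1) => y1 y2 y i *.
by apply/andP; split; lra.
Qed.

End good_frames.

(** * The theorem *)

Section column_vectors.
Context {R : realType}.

Lemma colvec_norm_ub m (v : 'cV[R]_m) i : `|v i 0| <= `|v|.
Proof.
rewrite [leRHS](mx_normrE v).
exact: (@le_bigmax _ _ _ 0 (fun ij : 'I_m * 'I_1 => `|v ij.1 ij.2|) (i, 0)).
Qed.

Lemma colvec_norm_attained m (v : 'cV[R]_m) : (0 < m)%N -> exists i, `|v| = `|v i 0|.
Proof.
move=> m0; have [v0|v0] := eqVneq `|v| 0.
  exists (Ordinal m0); apply/eqP.
  by rewrite eq_le colvec_norm_ub andbT v0 normr_ge0.
have [[i l] vE] := mx_norm_neq0 v0; exists i.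
by move: vE; rewrite /= ord1.
Qed.

Lemma measurable_bigmax d (T : measurableType d) (I : Type) (r : seq I) (F : I -> T -> R) :
  (forall i, measurable_fun setT (F i)) ->
  measurable_fun setT (fun x => \big[Num.max/0]_(i <- r) F i x).
Proof.
move=> mF; elim: r => [|i r IH]; first by under eq_fun do rewrite big_nil; exact: measurable_cst.
by under eq_fun do rewrite big_cons; exact: measurable_maxr.
Qed.

Lemma measurable_colvec_norm d (T : measurableType d) m (f : T -> 'cV[R]_m) :
  (forall i, measurable_fun setT (fun x => f x i 0)) ->
  measurable_fun setT (fun x => `|f x|).
Proof.
move=> mf.
have -> : (fun x => `|f x|) = (fun x => \big[Num.max/0]_ij `|f x ij.1 ij.2|).
  by apply/funext => x; exact: mx_normrE.
by apply: measurable_bigmax => -[i l] /=; rewrite ord1; exact: measurableT_comp.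
Qed.

End column_vectors.

Section projections.
Context {R : realType}.
Variables (p : R) (hp : 2 <= p).
Local Notation T2 := (measurableTypeR R * measurableTypeR R)%type.
Variables (n m : nat) (A : 'M[R]_(n.+1, m)).
Variables (d : measure_display) (W : measurableType d) (P : probability W R).
Variables (Y : {RV P >-> borel 'cV[R]_n.+1}).
Hypothesis Y_unif : uniform_on (@lp_ball R p n.+1) Y.

Definition projection (x : W) : 'cV[R]_m := (Num.sqrt n.+1%:R)^-1 *: (A^T *m Y x).

Let h (j : 'I_m) (y : 'cV[R]_n.+1) : R :=
  (Num.sqrt n.+1%:R)^-1 * \sum_i A i j * y i 0.

Let projectionE j x : projection x j 0 = h j (Y x).
Proof. by rewrite !mxE; congr (_ * _); apply: eq_bigr => i _; rewrite mxE. Qed.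

Let mh j : measurable_fun setT (h j : borel 'cV[R]_n.+1 -> measurableTypeR R).
Proof.
apply: measurable_funM => //; apply: (@measurable_sum _ (borel 'cV[R]_n.+1)) => i.
by apply: measurable_funM => //; exact: measurable_coord.
Qed.

Lemma measurable_projection j : measurable_fun setT (fun x => projection x j 0).
Proof.
under eq_fun do rewrite projectionE.
by apply: measurableT_comp; [exact: mh|exact: measurable_funP].
Qed.

(** Scaling the column by the square root of the dimension [n + 1] turns the prefactor of the
    projection into [(n + 1)^-1], so both coordinates of the slice integral are compared with
    multiples of the dimension. *)
Lemma projection_law j (D : set (measurableTypeR R)) : measurable D ->
  P ((fun x => projection x j 0) @^-1` D) = (slice_integral p n.+1 (scaled_column A j)
    (fun t => (\1_[set t : T2 | D (n.+1%:R^-1 * t.1)%R /\ t.2 <= n.+1%:R] t)%:E) (0, 0)%R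
    / ball_volume p n)%E.
Proof.
move=> mD; pose B : set (borel 'cV[R]_n.+1) := h j @^-1` D.
have mB : measurable B by rewrite -[B]setTI; exact: mh.
have -> : P ((fun x => projection x j 0) @^-1` D) = distribution P Y B.
  by congr (P _); apply/seteqP; split => x /=; rewrite /B /= projectionE.
rewrite (Y_unif mB) /ball_volume; congr (_ / _)%E.
rewrite -(volume_slice p n.+1); congr volume; apply/seteqP.
have N0 : 0 < n.+1%:R :> R by [].
have E (v : 'cV[R]_n.+1) : n.+1%:R^-1 * (0 + \sum_(i < n.+1) scaled_column A j i * v i 0) = h j v.
  rewrite add0r /scaled_column /h; under eq_bigr do rewrite inord_val -mulrA.
  rewrite -mulr_sumr mulrA; congr (_ * _).
  rewrite -[n.+1%:R in X in X * _](sqr_sqrtr (ltW N0)) expr2 invfM mulfVK//.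
by split => v /=; rewrite /B /= /lp_ball /= E add0r.
Qed.

End projections.

Theorem corollary1p4 (R : realType) (p : R) (hp : 2 <= p)
    (k : nat -> nat)
    (k_bounds : forall n, (0 < n)%N -> (0 < k n <= n)%N)
    (k_incr : forall n, (0 < n)%N -> (k n <= k n.+1)%N)
    (k_infty : k n @[n --> \oo] --> \oo)
    (k_sublinear : ((k n)%:R / n%:R : R) @[n --> \oo] --> (0 : R))
    (* sigma_ n is the law sigma_(n+1); see frames for the shift *)
    (sigma_ : forall n, probability (borel 'M[R]_(n.+1, k n.+1)) R)
    (sigma_haar : forall n, is_stiefel_haar (sigma_ n))
    (sigma : probability (frame_space R k) R)
    (sigma_V : sigma (@stiefel_seq R k) = 1%E)
    (sigma_marginal : forall n (B : set (borel 'M[R]_(n.+1, k n.+1))),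
       measurable B -> sigma [set a | B (a n)] = sigma_ n B)
    (* g_0, g_1, g_2, ... in the definition of the rate function *)
    (dO : measure_display) (O : measurableType dO) (Q : probability O R)
    (g : nat -> {RV Q >-> R}) (g_iid : iid_standard_gaussian g)
    (* Y n is the random vector Y^(n+1) *)
    (d : nat -> measure_display) (W : forall n, measurableType (d n))
    (P : forall n, probability (W n) R)
    (Y : forall n, {RV (P n) >-> borel 'cV[R]_n.+1})
    (Y_unif : forall n, uniform_on (@lp_ball R p n.+1) (Y n)) :
  {ae sigma, forall a : frame_space R k,
    LDP P
      (fun n (x : W n) =>
         `| (Num.sqrt (n.+1%:R : R))^-1 *: ((a n)^T *m Y n x) |)
      (fun n => n.+1%:R) (rate_max g p)
    /\ good_rate_function (rate_max g p)}.
Proof.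
have rateE : rate_max g p = half_line_rate p.
  apply/funext => r; rewrite /half_line_rate; case: ifPn => [r0|/negbTE r0].
    exact: rate_maxE.
  by rewrite /rate_max r0.
have := psi_mean_ae g_iid hp k_bounds sigma_haar sigma_marginal.
apply: filterS => a good; rewrite rateE; split.
  apply: (@max_LDP R p hp k k_bounds (fun n j => scaled_column (a n : 'M[R]_(n.+1, k n.+1)) j)
    good d W P (fun n j x => projection (a n : 'M[R]_(n.+1, k n.+1)) (Y n) x j 0)).
  - by move=> n j; exact: measurable_projection.
  - by move=> n; apply: measurable_colvec_norm => i; exact: measurable_projection.
  - by move=> n j D mD; exact: projection_law.
  - by move=> n j x; exact: colvec_norm_ub.
  - move=> n x; apply: colvec_norm_attained.
    by have /andP[] := k_bounds _ (ltn0Sn n).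
move=> alpha alpha0.
have -> : [set r | (half_line_rate p r <= alpha%:E)%E] =
    [set r | 0 <= r /\ (tilt_rate p r <= alpha%:E)%E].
  apply/seteqP; split => r /=; rewrite /half_line_rate.
    by case: ifP.
  by move=> [-> ].
exact: tilt_rate_compact.
Qed.
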